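(* Let $(a_i)_{i\in\mathbb Z}$, $(b_i)_{i\in\mathbb Z}$ be finitely supported sequences of integers, not both identically zero, and put $m=\sum_i a_i$, $n=\sum_i b_i$. Then $(a_i),(b_i)$ are the graded Betti numbers of some finitely generated graded right $A$-module $M$ of Gelfand–Kirillov dimension two and projective dimension one (i.e. $M$ has a minimal graded free resolution $0\to\bigoplus_i A(-i)^{b_i}\to\bigoplus_i A(-i)^{a_i}\to M\to 0$) if and only if (a) all $a_i,b_i$ are non-negative; (b) $m=n$; (c) for all $(\alpha,\beta)\in R_{m,n}$ with $\beta\ge\alpha$ we have $(\alpha,\beta)\in L_{a,b}$, i.e. $S(a)_\alpha<S(b)_\beta$. Moreover, when these conditions hold, $M$ can be chosen to be $g$-torsion free.
   Context: Let $k=\mathbb C$. $A$ is a generic three-dimensional Artin–Schelter regular algebra generated in degree one, of one of two types. Quadratic: $A=k\langle x,y,z\rangle/(f_1,f_2,f_3)$ with $f_1=ayz+bzy+cx^2$, $f_2=azx+bxz+cy^2$, $f_3=axy+byx+cz^2$, where $(a,b,c)\in\mathbb P^2$, $abc\neq0$, $(3abc)^3\neq(a^3+b^3+c^3)^3$, and the associated automorphism $\sigma$ of the point scheme $E$ has infinite order. Cubic: $A=k\langle x,y\rangle/(g_1,g_2)$ with $g_1=ay^2x+byxy+axy^2+cx^3$, $g_2=ax^2y+bxyx+ayx^2+cy^3$, where $abc\ne0$, $b^2\ne c^2$, $(2bc)^2\neq(4a^2-b^2-c^2)^2$, and $\sigma$ has infinite order. (Equivalently: the point scheme $E$ is a smooth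 elliptic curve and $\sigma$ is a translation of infinite order.) $A$ has a central element $g$, unique up to scalar, homogeneous of degree $3$ (quadratic case) or $4$ (cubic case). Modules are finitely generated graded right $A$-modules; $M(n)$ denotes the shift $M(n)_i=M_{n+i}$. For a finitely supported sequence $(c_i)$ of non-negative integers, $S(c)$ is the nondecreasing sequence of length $\sum_i c_i$, indexed from $1$, in which each integer $i$ appears exactly $c_i$ times. For positive integers $m,n$, $R_{m,n}=\{(\alpha,\beta)\in\mathbb Z^2: 1\le\alpha\le m,\ 1\le\beta\le n\}$, and $L_{a,b}=\{(\alpha,\beta)\in R_{m,n}: S(a)_\alpha<S(b)_\beta\}$ with $m=\sum a_i$, $n=\sum b_i$. *)

(* Defs.v *)
From mathcomp Require Import all_boot all_order all_algebra.
From mathcomp Require Import complex Rstruct.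
Set Implicit Arguments. Unset Strict Implicit. Unset Printing Implicit Defensive.
Import Order.TTheory GRing.Theory Num.Theory.
Local Open Scope ring_scope.

Definition C : fieldType := (Rdefinitions.R)[i].

(* Free algebra k<x_0,...,x_{k-1}>: an element is its coefficient function  *)
(* on words; genuine elements are the finitely supported ones (fa_fin).     *)
Definition word (k : nat) := seq 'I_k.
Definition fa (k : nat) := word k -> C.

Definition fa_fin k (p : fa k) := exists B : nat, forall w, (B < size w)%N -> p w = 0.
Definition fa0 k : fa k := fun _ => 0.
Definition fa_word k (u : word k) : fa k := fun w => (w == u)%:R.
Definition fa_mul k (p q : fa k) : fa k :=
  fun w => \sum_(i < (size w).+1) p (take i w) * q (drop i w).
Definition fa_homog k (d : int) (p : fa k) := forall w, p w <> 0 -> (size w)%:Z = d.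

Definition in_ideal k (rels : seq (fa k)) (p : fa k) :=
  exists s : seq (C * word k * nat * word k),
    forall w, p w = \sum_(t <- s)
      t.1.1.1 * fa_mul (fa_mul (fa_word t.1.1.2) (nth (@fa0 k) rels t.1.2)) (fa_word t.2) w.

Inductive ASalg := Quad of C & C & C | Cubic of C & C & C.

Definition ngen (A : ASalg) : nat := match A with Quad _ _ _ => 3 | Cubic _ _ _ => 2 end.
Definition reldeg (A : ASalg) : nat := match A with Quad _ _ _ => 2 | Cubic _ _ _ => 3 end.
Definition gdeg (A : ASalg) : nat := match A with Quad _ _ _ => 3 | Cubic _ _ _ => 4 end.

Definition X3 : 'I_3 := inord 0.
Definition Y3 : 'I_3 := inord 1.
Definition Z3 : 'I_3 := inord 2.
Definition X2 : 'I_2 := inord 0.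
Definition Y2 : 'I_2 := inord 1.

Definition mon k (c : C) (u : word k) : fa k := fun w => c * (w == u)%:R.
Definition fa_add3 k (p q r : fa k) : fa k := fun w => p w + q w + r w.
Definition fa_add4 k (p q r s : fa k) : fa k := fun w => p w + q w + r w + s w.

Definition rels (A : ASalg) : seq (fa (ngen A)) :=
  match A return seq (fa (ngen A)) with
  | Quad a b c =>
    [:: fa_add3 (mon a [:: Y3; Z3]) (mon b [:: Z3; Y3]) (mon c [:: X3; X3]);
        fa_add3 (mon a [:: Z3; X3]) (mon b [:: X3; Z3]) (mon c [:: Y3; Y3]);
        fa_add3 (mon a [:: X3; Y3]) (mon b [:: Y3; X3]) (mon c [:: Z3; Z3])]
  | Cubic a b c =>
    [:: fa_add4 (mon a [:: Y2; Y2; X2]) (mon b [:: Y2; X2; Y2]) (mon a [:: X2; Y2; Y2])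
                (mon c [:: X2; X2; X2]);
        fa_add4 (mon a [:: X2; X2; Y2]) (mon b [:: X2; Y2; X2]) (mon a [:: Y2; X2; X2])
                (mon c [:: Y2; Y2; Y2])]
  end.

Definition generic (A : ASalg) : Prop :=
  match A with
  | Quad a b c => a * b * c <> 0 /\ (3 * a * b * c) ^+ 3 <> (a ^+ 3 + b ^+ 3 + c ^+ 3) ^+ 3
  | Cubic a b c => a * b * c <> 0 /\ b ^+ 2 <> c ^+ 2 /\
                   (2 * b * c) ^+ 2 <> (4 * a ^+ 2 - b ^+ 2 - c ^+ 2) ^+ 2
  end.

(* Point scheme E and the automorphism sigma.                              *)
(* A point of P^{k-1} is a nonzero vector up to scalars.  A "chain" is a    *)
(* sequence of points p_0,p_1,... such that every L = reldeg consecutive    *)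
(* points is a zero of the multilinearized relations (the scheme Gamma).    *)
(* E is the set of (L-1)-tuples starting a chain, and                       *)
(* sigma(p_0,..,p_{L-2}) = (p_1,..,p_{L-1}).                                 *)
Definition point k := 'I_k -> C.
Definition nonzero_pt k (p : point k) := exists j, p j <> 0.
Definition proj_eq k (p q : point k) := exists2 l : C, l <> 0 & forall j, p j = l * q j.

Definition rel_eval k (f : fa k) (ps : seq (point k)) : C :=
  \sum_(w : (size ps).-tuple 'I_k)
     f w * \prod_(i < size ps) (nth (fun=> 0) ps i) (tnth w i).

Definition is_chain (A : ASalg) (ps : seq (point (ngen A))) :=
  (forall i, (i < size ps)%N -> nonzero_pt (nth (fun=> 0) ps i)) /\
  (forall i, (i + reldeg A <= size ps)%N ->
     forall j, (j < size (rels A))%N ->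
       rel_eval (nth (@fa0 _) (rels A) j) (take (reldeg A) (drop i ps)) = 0).

Definition sigma_finite_order (A : ASalg) :=
  exists2 n : nat, (0 < n)%N &
    forall ps : seq (point (ngen A)), is_chain ps -> size ps = (n + reldeg A - 1)%N ->
      forall i, (i < reldeg A - 1)%N ->
        proj_eq (nth (fun=> 0) ps (n + i)) (nth (fun=> 0) ps i).

Definition sigma_infinite_order (A : ASalg) := ~ sigma_finite_order A.

Definition supp_in (N : nat) (a : int -> int) := forall i : int, N%:Z < `|i| -> a i = 0.
Definition wsum (N : nat) (a : int -> int) : int :=
  \sum_(j < (2 * N).+1) a (j%:Z - N%:Z).
Definition nonneg_part (z : int) : nat := if z is Posz n then n else 0%N.
(* S(c) as a list, 0-based: S(c)_alpha (1-based, as in the paper) = nth 0 (Sseq N c) (alpha-1) *)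
Definition Sseq (N : nat) (c : int -> int) : seq int :=
  flatten [seq nseq (nonneg_part (c (j%:Z - N%:Z))) (j%:Z - N%:Z) | j <- iota 0 (2 * N).+1].
Definition S1 (N : nat) (c : int -> int) (alpha : nat) : int := nth 0 (Sseq N c) alpha.-1.

Definition condA (a b : int -> int) := forall i, 0 <= a i /\ 0 <= b i.
Definition condB N (a b : int -> int) := wsum N a = wsum N b.
Definition condC N (a b : int -> int) :=
  forall alpha beta : nat,
    (1 <= alpha)%N -> alpha%:Z <= wsum N a -> (1 <= beta)%N -> beta%:Z <= wsum N b ->
    (alpha <= beta)%N -> S1 N a alpha < S1 N b beta.

(* Modules with a minimal free resolution 0 -> F1 -> F0 -> M -> 0.         *)
(* F0 = (+)_alpha e_alpha A with deg e_alpha = da_alpha,                    *)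
(* F1 = (+)_beta  f_beta  A with deg f_beta  = db_beta,                     *)
(* phi(f_beta) = sum_alpha e_alpha * phi alpha beta (right A-modules).      *)
(* Elements of A are represented by elements of the free algebra modulo    *)
(* the ideal of relations.                                                 *)
Section Res.
Variables (k : nat) (rl : seq (fa k)) (da db : seq int).
Notation ma := (size da). Notation nb := (size db).
Variable phi : 'I_ma -> 'I_nb -> fa k.

Definition phi_app (v : 'I_nb -> fa k) (al : 'I_ma) : fa k :=
  fun w => \sum_(be < nb) fa_mul (phi al be) (v be) w.

Definition phi_graded_minimal :=
  forall al be, fa_fin (phi al be) /\
    forall w, phi al be w <> 0 ->
      (size w)%:Z = nth 0 db be - nth 0 da al /\ (0 < size w)%N.

Definition phi_injective :=
  forall v : 'I_nb -> fa k, (forall be, fa_fin (v be)) ->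
    (forall al, in_ideal rl (phi_app v al)) -> forall be, in_ideal rl (v be).

Definition in_image (x : 'I_ma -> fa k) :=
  exists2 v : 'I_nb -> fa k, (forall be, fa_fin (v be)) &
    forall al, in_ideal rl (fun w => x al w - phi_app v al w).

Definition coker_dim_ge (d r : nat) :=
  exists xs : 'I_r -> 'I_ma -> fa k,
    (forall i al w, xs i al w <> 0 -> (size w)%:Z + nth 0 da al <= d%:Z) /\
    (forall c : 'I_r -> C, in_image (fun al w => \sum_(i < r) c i * xs i al w) ->
       forall i, c i = 0).

Definition torsion_free (g : fa k) :=
  forall x : 'I_ma -> fa k, (forall al, fa_fin (x al)) ->
    in_image (fun al => fa_mul (x al) g) -> in_image x.
End Res.

(* Gelfand-Kirillov dimension t of a graded module whose dim_C M_{<=d} is  *)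
(* described by dimge d r <-> dim M_{<=d} >= r :                            *)
(*   limsup_d log(dim M_{<=d}) / log d = t, i.e. for every q >= 1,          *)
(*   eventually dim M_{<=d} <= d^(t+1/q), and infinitely often              *)
(*   dim M_{<=d} >= d^(t-1/q).                                              *)
Definition GKdim_eq (dimge : nat -> nat -> Prop) (t : nat) :=
  (forall q : nat, (0 < q)%N -> exists D : nat, forall d r : nat,
       (D <= d)%N -> dimge d r -> (r ^ q <= d ^ (t * q + 1))%N) /\
  (forall q : nat, (0 < q)%N -> forall D : nat, exists d r : nat,
       [/\ (D <= d)%N, dimge d r & (d ^ (t * q - 1) <= r ^ q)%N]).

Definition central_elt (A : ASalg) (g : fa (ngen A)) :=
  [/\ fa_fin g, fa_homog (gdeg A)%:Z g, ~ in_ideal (rels A) g &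
      forall j : 'I_(ngen A), in_ideal (rels A)
        (fun w => fa_mul (fa_word [:: j]) g w - fa_mul g (fa_word [:: j]) w)].

Definition betti_GK2_pd1 (A : ASalg) (N : nat) (a b : int -> int)
    (phi : 'I_(size (Sseq N a)) -> 'I_(size (Sseq N b)) -> fa (ngen A)) :=
  [/\ condA a b,
      (0 < size (Sseq N b))%N,
      phi_graded_minimal phi,
      phi_injective (rels A) phi &
      GKdim_eq (coker_dim_ge (rels A) phi) 2].

(* Main.v *)
Require Import Defs.

(** A chain of points [p_0, p_1, ...] annihilated by the multilinearized relations is a point
module of [A].  For a nonzero linear form [l], evaluation along a chain starting on the line
[l = 0] exhibits a shift of [A / l' A], for another linear form [l'], as the kernel of a map from
[A / l A] onto a point module; this bounds the Hilbert function of [A / l A] from above.  The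
relations are the derivatives of a cyclically invariant superpotential, and the resulting
complex bounds the Hilbert function of [A] from below.  The bounds agree, so [l] is left regular and
[dim A_n] is known.

The central element [g] vanishes along enough explicit chains starting on [l = 0], but does not lie
in [l A]; hence [g] is regular on [A / l A], and so on [A / l^n A].  Therefore the diagonal matrix
with entries [l^(S(b)_i - S(a)_i)] presents a [g]-torsion free module with the prescribed Betti
numbers.

Conversely [dim A_(<= n)] grows like [n^3], so injectivity and dimension two force [m = n].  If
[S(a)_alpha >= S(b)_beta] with [alpha <= beta], then by minimality the first [beta] generators of
the free module with degrees [S(b)] map into the first [alpha - 1] summands of the one with degrees
[S(a)], which contradicts injectivity by the same count. *)

From HB Require Import structures.
From mathcomp Require Import all_boot all_order all_algebra.
From mathcomp Require Import boolp zify ring.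
From mathcomp Require Import complex Rstruct.
Set Implicit Arguments. Unset Strict Implicit. Unset Printing Implicit Defensive.
Import Order.TTheory GRing.Theory Num.Theory.
Local Open Scope ring_scope.

(** * Dimensions of quotients *)

(** Regularity and the Hilbert function of [A] depend on each other: the complex given by the
    superpotential is injective on the left only if a generator is left regular, and regularity is
    read off from matching dimensions. Both are therefore obtained by a single induction on the
    degree ([hilbert]), each degree using regularity only in lower ones; all inequalities come from
    [exact_count].

    No formula for [g] is available, only its centrality. This already makes [g] vanish along any
    chain whose point number [deg g] is not proportional to the initial one, which is checked on
    explicit points. The chains through one line then factor multiplication by [g] on [A / l A], up
    to a scalar, into maps from line to line, each injective by the exact Hilbert function. If [g]
    were [l h], centrality would also give [g = h l], and [h] would vanish along so many chains that
    it would be a combination of the relations. *)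

Section QuotientDimension.
Variable K : fieldType.
Implicit Types E : lmodType K.

Definition subspace E (P : E -> Prop) :=
  P 0 /\ forall (a : K) u v, P u -> P v -> P (a *: u + v).

Lemma subspaceD E (P : E -> Prop) u v : subspace P -> P u -> P v -> P (u + v).
Proof. by move=> [_ PD] Pu Pv; rewrite -[u]scale1r; apply: PD. Qed.

Lemma subspaceZ E (P : E -> Prop) a u : subspace P -> P u -> P (a *: u).
Proof. by move=> [P0 PD] Pu; rewrite -[_ *: _]addr0; apply: PD. Qed.

Lemma subspaceN E (P : E -> Prop) u : subspace P -> P u -> P (- u).
Proof. by move=> sP Pu; rewrite -scaleN1r; apply: subspaceZ. Qed.

Lemma subspaceB E (P : E -> Prop) u v : subspace P -> P u -> P v -> P (u - v).
Proof. by move=> sP Pu Pv; apply: subspaceD => //; apply: subspaceN. Qed.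

Lemma subspace_sum E (P : E -> Prop) (I : Type) (r : seq I) (F : I -> E) :
  subspace P -> (forall i, P (F i)) -> P (\sum_(i <- r) F i).
Proof.
move=> sP PF; elim: r => [|i r IH]; first by rewrite big_nil; case: sP.
by rewrite big_cons; apply: subspaceD.
Qed.

Definition indep E (P : E -> Prop) n (b : 'I_n -> E) :=
  forall c : 'I_n -> K, P (\sum_i c i *: b i) -> forall i, c i = 0.

(* The quotient [Q / (P :&: Q)] has dimension [n]. *)
Definition qdim E (Q P : E -> Prop) n :=
  exists2 pi : E -> 'rV[K]_n, linear pi &
    (forall v, Q v -> (pi v = 0 <-> P v)) /\ (forall r, exists2 v, Q v & pi v = r).

Lemma linear_comb (E E' : lmodType K) (f : E -> E') : linear f -> forall n (c : 'I_n -> K) (b : 'I_n -> E),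
  f (\sum_i c i *: b i) = \sum_i c i *: f (b i).
Proof.
move=> lf n c b.
pose h : {linear E -> E'} := HB.pack f (GRing.isLinear.Build _ _ _ _ f lf).
by rewrite -[f]/(h : E -> E') linear_sum; apply: eq_bigr => i _; rewrite linearZ.
Qed.

Lemma linearB_fun (E E' : lmodType K) (f : E -> E') u v : linear f -> f (u - v) = f u - f v.
Proof. by move=> lf; rewrite addrC -scaleN1r lf scaleN1r addrC. Qed.

Lemma linear0_fun (E E' : lmodType K) (f : E -> E') : linear f -> f 0 = 0.
Proof. by move=> lf; rewrite -[0 in LHS](subrr (0 : E)) linearB_fun // subrr. Qed.

Lemma qdim_basis E (Q P : E -> Prop) n (pi : E -> 'rV[K]_n) :
  (forall r, exists2 v, Q v & pi v = r) ->
  exists b : 'I_n -> E, forall i, Q (b i) /\ pi (b i) = delta_mx 0 i.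
Proof.
move=> sur.
have /choice[b Hb] : forall i : 'I_n, exists v, Q v /\ pi v = delta_mx 0 i.
  by move=> i; have [v Qv <-] := sur (delta_mx 0 i); exists v.
by exists b.
Qed.

Lemma qdim_indep E (Q P : E -> Prop) n : qdim Q P n -> subspace Q ->
  exists2 b : 'I_n -> E, indep P b & forall i, Q (b i).
Proof.
move=> [pi lpi [ker sur]] sQ.
have [b Hb] := qdim_basis P sur; exists b => [c|i]; last by case: (Hb i).
move=> Pc i; have : pi (\sum_i c i *: b i) = 0.
  by apply/ker => //; apply: subspace_sum => // j; apply: subspaceZ => //; case: (Hb j).
rewrite linear_comb // => /matrixP/(_ 0 i); rewrite summxE mxE => <-.
rewrite (bigD1 i) //= big1 ?addr0 => [|j ji]; rewrite (Hb _).2 !mxE ?eqxx ?mulr1 //.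
by rewrite eq_sym (negPf ji) mulr0.
Qed.

Lemma qdim0 E (Q P : E -> Prop) n : subspace Q -> (forall v, Q v -> P v) ->
  qdim Q P n -> n = 0%N.
Proof.
move=> sQ QP /qdim_indep/(_ sQ)[b ib Qb]; apply/eqP; rewrite -leqn0 leqNgt; apply/negP => n0.
have /ib/(_ (Ordinal n0))/eqP : P (\sum_i 1 *: b i).
  by apply: QP; apply: subspace_sum => // i; apply: subspaceZ.
by rewrite oner_eq0.
Qed.

Lemma indep1 E (P : E -> Prop) v : subspace P -> ~ P v -> indep P (fun _ : 'I_1 => v).
Proof.
move=> subP nP c; rewrite big_ord1 => Pc i; rewrite ord1; apply/eqP/negPn/negP => c0.
by apply: nP; rewrite -[v]scale1r -(mulVf c0) -scalerA; apply: subspaceZ.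
Qed.

(** The rank of the map induced by [f] is at most [x - w], because of the independent classes [g i]
    in its kernel, and at least [y - z], because the kernel of [J] lies in its image. *)
Lemma exact_count (EX EY : lmodType K) (QX PX : EX -> Prop) (QY PY : EY -> Prop) x y z w
    (f : EX -> EY) (J : EY -> 'rV[K]_z) (g : 'I_w -> EX) :
  subspace QX -> subspace QY -> qdim QX PX x -> qdim QY PY y ->
  linear f -> linear J ->
  (forall u, QX u -> QY (f u)) -> (forall u, QX u -> PX u -> PY (f u)) ->
  (forall v, QY v -> J v = 0 -> exists2 u, QX u & PY (v - f u)) ->
  (forall i, QX (g i)) -> indep PX g -> (forall i, PY (f (g i))) ->
  (w + y <= x + z)%N.
Proof.
move=> sQX sQY [pX lpX [kX surX]] [pY lpY [kY surY]] lf lJ fQ fP exY gQ gi fg.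
have [b Hb] := qdim_basis PX surX; have [c Hc] := qdim_basis PY surY.
pose A : 'M[K]_(x, y) := \matrix_(i < x) pY (f (b i)).
pose JM : 'M[K]_(y, z) := \matrix_(i < y) J (c i).
pose G : 'M[K]_(w, x) := \matrix_(i < w) pX (g i).
have pA u : QX u -> pY (f u) = pX u *m A.
  move=> Qu; pose u' := \sum_i (pX u) 0 i *: b i.
  have Qu' : QX u' by apply: subspace_sum => // i; apply: subspaceZ => //; case: (Hb i).
  have pu' : pX u' = pX u.
    rewrite linear_comb // [RHS]row_sum_delta.
    by apply: eq_bigr => i _; rewrite (Hb i).2.
  have /kX Pd : QX (u - u') by apply: subspaceB.
  have {}Pd : PX (u - u') by apply/Pd; rewrite linearB_fun // pu' subrr.
  have Qd : QX (u - u') by apply: subspaceB.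
  have /kY : QY (f (u - u')) by apply: fQ.
  case=> _ /(_ (fP _ Qd Pd)); rewrite linearB_fun // linearB_fun // => /eqP.
  rewrite subr_eq0 => /eqP ->; rewrite linear_comb // linear_comb //.
  by rewrite mulmx_sum_row; apply: eq_bigr => i _; rewrite rowK.
have GA : G *m A = 0.
  apply/row_matrixP => i; rewrite row_mul rowK row0 -pA //.
  by apply/kY; [apply: fQ | apply: fg].
have Gfree : row_free G.
  rewrite -kermx_eq0 -submx0; apply/row_subP => i.
  rewrite submx0; apply/eqP; set r := row i _.
  have rG : r *m G = 0 by apply/sub_kermxP; apply: row_sub.
  apply/rowP => j; rewrite [RHS]mxE; apply: (gi (fun j => r 0 j)).
  have Qs : QX (\sum_j r 0 j *: g j) by apply: subspace_sum => // k; apply: subspaceZ.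
  apply/kX => //; rewrite linear_comb // -[RHS]rG mulmx_sum_row.
  by apply: eq_bigr => k _; rewrite rowK.
have JA : (kermx JM <= A)%MS.
  apply/row_subP => i; set r := row i _.
  have rJ : r *m JM = 0 by apply/sub_kermxP; apply: row_sub.
  pose v := \sum_j r 0 j *: c j.
  have Qv : QY v by apply: subspace_sum => // j; apply: subspaceZ => //; case: (Hc j).
  have pv : pY v = r.
    rewrite linear_comb // [RHS]row_sum_delta.
    by apply: eq_bigr => j _; rewrite (Hc j).2.
  have Jv : J v = 0.
    by rewrite linear_comb // -[RHS]rJ mulmx_sum_row; apply: eq_bigr => j _; rewrite rowK.
  have [u Qu Pu] := exY v Qv Jv.
  have /kY[_ /(_ Pu)] : QY (v - f u) by apply: subspaceB => //; apply: fQ.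
  rewrite linearB_fun // pv pA // => /eqP; rewrite subr_eq0 => /eqP ->.
  exact: submxMl.
have := mxrankS JA; have : (G <= kermx A)%MS by apply/sub_kermxP.
move/mxrankS; rewrite !mxrank_ker (eqP Gfree).
have := rank_leq_col JM; have := rank_leq_row A; have := rank_leq_row JM.
move: (\rank A) (\rank JM) => rA rJ h1 h2 h3 h4 h5.
lia.
Qed.

Lemma indep_le E (Q P : E -> Prop) n w (g : 'I_w -> E) : subspace Q -> qdim Q P n ->
  (forall i, Q (g i)) -> indep P g -> (w <= n)%N.
Proof.
move=> sQ qd gQ ig.
have q0 : qdim (fun v : E => v = 0) (fun=> True) 0.
  exists (fun=> 0); first by move=> a u v; rewrite scaler0 addr0.
  by split=> // r; exists 0 => //; apply/rowP => -[].
have s0 : subspace (fun v : E => v = 0).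
  by split=> // a u v -> ->; rewrite scaler0 addr0.
have := @exact_count E E Q P (fun v : E => v = 0) (fun=> True) n 0 0 w (fun=> 0) (fun=> 0) g
  sQ s0 qd q0; rewrite !addn0; apply=> //.
- by move=> a u v; rewrite scaler0 addr0.
- by move=> a u v; rewrite scaler0 addr0.
by move=> v _ _; exists 0 => //; case: sQ.
Qed.

(** [P] is an arbitrary predicate, so no basis is at hand; a row space of maximal rank inside [P]
    exhausts it, since a further vector of [P] would raise the rank. *)
Lemma subspace_mx N (P : 'rV[K]_N -> Prop) : subspace P ->
  exists U : 'M[K]_N, forall r, P r <-> (r <= U)%MS.
Proof.
move=> sP.
pose R n := `[< exists2 U : 'M[K]_N, (forall r, (r <= U)%MS -> P r) & \rank U = n >].
have exR : exists n, R n.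
  exists 0%N; apply/asboolP; exists 0; last by rewrite mxrank0.
  by move=> r; rewrite submx0 => /eqP ->; case: sP.
have bR n : R n -> (n <= N)%N by move/asboolP=> [U _ <-]; apply: rank_leq_row.
case: (ex_maxnP exR bR) => n /asboolP[U UP rU] maxn.
exists U => r; split=> [Pr|]; last exact: UP.
apply: contraT => nrU.
have : R (\rank (U + r)%MS).
  apply/asboolP; exists (U + r)%MS => // t /sub_addsmxP[[t1 t2] /= ->].
  apply: subspaceD => //; first by apply: UP; apply: submxMl.
  by rewrite [t2]mx11_scalar mul_scalar_mx; apply: subspaceZ.
move/maxn; rewrite -rU leqNgt => /negP[]; apply: rank_ltmx.
rewrite ltmxE addsmxSl /=; apply: contra nrU; apply: submx_trans; exact: addsmxSr.
Qed.

(** The part of [P] inside [Q] becomes a row space [U] in coordinates; [col_base (cokermx U)] kills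
    exactly [U] and has full column rank, so it gives surjective coordinates on the quotient. *)
Lemma qdim_exists E (Q P : E -> Prop) N (ka : E -> 'rV[K]_N) :
  linear ka -> subspace Q -> subspace P ->
  (forall v, Q v -> ka v = 0 -> P v) -> (forall r, exists2 v, Q v & ka v = r) ->
  exists n, qdim Q P n.
Proof.
move=> lk sQ sP inj sur.
have sP' : subspace (fun r => exists v, [/\ Q v, P v & ka v = r]).
  split; first by exists 0; split; [case: sQ | case: sP | apply: linear0_fun].
  move=> a r r' [v [Qv Pv <-]] [v' [Qv' Pv' <-]]; exists (a *: v + v').
  by split; [case: sQ => _; apply | case: sP => _; apply | rewrite lk].
have [U HU] := subspace_mx sP'.
exists (\rank (cokermx U)), (fun v => ka v *m col_base (cokermx U)).
  by move=> a u v; rewrite lk mulmxDl scalemxAl.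
have cE m (A : 'M[K]_(m, N)) : A *m col_base (cokermx U) = 0 <-> (A <= U)%MS.
  have AE : A *m cokermx U = A *m col_base (cokermx U) *m row_base (cokermx U).
    by rewrite -mulmxA mulmx_base.
  rewrite submxE AE; split=> [->|/eqP]; first by rewrite mul0mx.
  by rewrite -[X in _ = X -> _](mul0mx _ (row_base (cokermx U))); apply/row_free_inj/row_base_free.
split=> [v Qv|r]; last first.
  have /submxP[D rD] : (r <= col_base (cokermx U))%MS by apply: submx_full; apply: col_base_full.
  by have [v Qv vD] := sur D; exists v => //; rewrite vD.
rewrite cE -HU; split=> [[v' [Qv' Pv' kv]]|Pv]; last by exists v.
rewrite -[v](subrK v'); apply: subspaceD => //; apply: inj; first exact: subspaceB.
by rewrite linearB_fun // kv subrr.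
Qed.

(** The [c s] are the coordinates of a direct sum, kept abstract so that one lemma serves tuples,
    free modules and sums of homogeneous components. *)
Lemma qdim_family (S : finType) (E E' : lmodType K) (Q P : E -> Prop) (c : S -> E -> E')
    (Q' P' : S -> E' -> Prop) (n : S -> nat) :
  (forall s, qdim (Q' s) (P' s) (n s)) -> (forall s, linear (c s)) ->
  (forall s v, Q v -> Q' s (c s v)) ->
  (forall v, Q v -> (P v <-> forall s, P' s (c s v))) ->
  (forall F : S -> E', (forall s, Q' s (F s)) -> exists2 v, Q v & forall s, c s v = F s) ->
  qdim Q P (\sum_s n s).
Proof.
move=> dS lc cQ cP gl.
have pS s : {pr : E' -> 'rV[K]_(n s) | linear pr &
    (forall v, Q' s v -> (pr v = 0 <-> P' s v)) /\ (forall r, exists2 v, Q' s v & pr v = r)}.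
  by apply: cid2; apply: dS.
pose pi s := s2val (pS s).
have lpi s : linear (pi s) by rewrite /pi; case: (pS s).
have [kpi spi] : (forall s v, Q' s v -> (pi s v = 0 <-> P' s v)) /\
    (forall s r, exists2 v, Q' s v & pi s v = r).
  by split=> s; rewrite /pi; case: (pS s) => ? ? [].
have -> : (\sum_s n s = #|{: {s : S & 'I_(n s)}}|)%N.
  rewrite card_tagged sumnE big_map enumT; apply: eq_bigr => s _; by rewrite card_ord.
exists (fun v => \row_j pi (tag (enum_val j)) (c (tag (enum_val j)) v) 0 (tagged (enum_val j))).
  by move=> a u v; apply/rowP => j; rewrite !mxE lc lpi !mxE.
split=> [v Qv|r].
  rewrite cP //; split=> [/rowP H s|H].
    apply/kpi; first exact: cQ.
    apply/rowP => i; have := H (enum_rank (Tagged (fun s => 'I_(n s)) i)).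
    by rewrite !mxE enum_rankK.
  apply/rowP => j; rewrite !mxE.
  have -> : pi (tag (enum_val j)) (c (tag (enum_val j)) v) = 0 by apply/kpi => //; apply: cQ.
  by rewrite mxE.
have /choice[F HF] : forall s, exists v, Q' s v /\
    pi s v = \row_i r 0 (enum_rank (Tagged (fun s => 'I_(n s)) i)).
  by move=> s; have [v] := spi s (\row_i r 0 (enum_rank (Tagged (fun s => 'I_(n s)) i))); exists v.
have [v Qv cv] := gl F (fun s => (HF s).1); exists v => //.
by apply/rowP => j; rewrite !mxE cv (HF _).2 !mxE; case: (enum_val j) (enum_valK j) => s i /= ->.
Qed.

End QuotientDimension.

(** * Noncommutative power series *)

(* Without the finiteness condition, coefficient functions are noncommutative power series; they
   form a ring, in which [in_ideal] is stable only under multiplication by finite elements. *)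
Definition fser (k : nat) : Type := fa k.

HB.instance Definition _ k := gen_eqMixin (fser k).
HB.instance Definition _ k := gen_choiceMixin (fser k).

Section FreeAlgebra.
Variable k : nat.
Implicit Types (p q r : fser k) (w u v : word k) (i j : 'I_k).

Definition fs_add p q : fser k := fun w => p w + q w.
Definition fs_opp p : fser k := fun w => - p w.
Definition fs_scale (a : C) p : fser k := fun w => a * p w.

Let addA : associative fs_add.
Proof. by move=> p q r; apply/funext => w; rewrite /fs_add addrA. Qed.
Let addC : commutative fs_add.
Proof. by move=> p q; apply/funext => w; rewrite /fs_add addrC. Qed.
Let add0 : left_id (@fa0 k : fser k) fs_add.
Proof. by move=> p; apply/funext => w; rewrite /fs_add /fa0 add0r. Qed.
Let addN : left_inverse (@fa0 k : fser k) fs_opp fs_add.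
Proof. by move=> p; apply/funext => w; rewrite /fs_add /fs_opp addNr. Qed.
HB.instance Definition _ := GRing.isZmodule.Build (fser k) addA addC add0 addN.

Let scaleA a b p : fs_scale a (fs_scale b p) = fs_scale (a * b) p.
Proof. by apply/funext => w; rewrite /fs_scale mulrA. Qed.
Let scale1 : left_id 1 fs_scale.
Proof. by move=> p; apply/funext => w; rewrite /fs_scale mul1r. Qed.
Let scaleDr : right_distributive fs_scale +%R.
Proof. by move=> a p q; apply/funext => w; rewrite /fs_scale [LHS]mulrDr. Qed.
Let scaleDl p : {morph (fs_scale^~ p) : a b / a + b}.
Proof. by move=> a b; apply/funext => w; rewrite /fs_scale [LHS]mulrDl. Qed.
HB.instance Definition _ :=
  GRing.Zmodule_isLmodule.Build C (fser k) scaleA scale1 scaleDr scaleDl.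

Lemma fserD p q w : (p + q) w = p w + q w. Proof. by []. Qed.
Lemma fserN p w : (- p) w = - p w. Proof. by []. Qed.
Lemma fserB p q w : (p - q) w = p w - q w. Proof. by []. Qed.
Lemma fserZ (a : C) p w : (a *: p) w = a * p w. Proof. by []. Qed.
Lemma fser0 w : (0 : fser k) w = 0. Proof. by []. Qed.
Lemma fser_sum (I : Type) (s : seq I) (P : pred I) (G : I -> fser k) w :
  (\sum_(t <- s | P t) G t) w = \sum_(t <- s | P t) G t w.
Proof. by apply: (big_morph (fun p : fser k => p w)) => // p q; rewrite fserD. Qed.

(** The coefficient of [x i] in the expansion of [p] by first letters, see [fser_decomp]. *)
Definition lder i p : fser k := fun w => p (i :: w).

Lemma fa_mul_nil p q : fa_mul p q [::] = p [::] * q [::].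
Proof. by rewrite /fa_mul big_ord_recl big_ord0 addr0. Qed.

Lemma fa_mul_cons p q i w :
  fa_mul p q (i :: w) = p [::] * q (i :: w) + fa_mul (lder i p) q w.
Proof. by rewrite /fa_mul big_ord_recl. Qed.

Let mulDl p q r : fa_mul (p + q) r = (fa_mul p r : fser k) + fa_mul q r.
Proof.
by apply/funext => w; rewrite fserD /fa_mul -big_split; apply: eq_bigr => i _; rewrite mulrDl.
Qed.
Let mulDr p q r : fa_mul p (q + r) = (fa_mul p q : fser k) + fa_mul p r.
Proof.
by apply/funext => w; rewrite fserD /fa_mul -big_split; apply: eq_bigr => i _; rewrite mulrDr.
Qed.
Let mulZl a p q : fa_mul (a *: p) q = a *: (fa_mul p q : fser k).
Proof.
by apply/funext => w; rewrite fserZ /fa_mul mulr_sumr; apply: eq_bigr => i _; rewrite fserZ mulrA.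
Qed.
Let mulZr a p q : fa_mul p (a *: q) = a *: (fa_mul p q : fser k).
Proof.
by apply/funext => w; rewrite fserZ /fa_mul mulr_sumr; apply: eq_bigr => i _; rewrite fserZ mulrCA.
Qed.
Let lder_mul i p q : lder i (fa_mul p q) = p [::] *: lder i q + fa_mul (lder i p) q.
Proof. by apply/funext => w; rewrite /lder fa_mul_cons fserD fserZ. Qed.
Let mulA : associative (fun p q : fser k => fa_mul p q : fser k).
Proof.
move=> p q r; apply/funext => w; elim: w p q r => [|i w IH] p q r.
  by rewrite !fa_mul_nil mulrA.
rewrite !fa_mul_cons lder_mul mulDl fserD mulZl fserZ -IH fa_mul_nil mulrDr mulrA.
by rewrite addrA.
Qed.
Let mul1 : left_id (fa_word [::] : fser k) (fun p q : fser k => fa_mul p q : fser k).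
Proof.
move=> p; apply/funext => w; case: w => [|i w].
  by rewrite fa_mul_nil /fa_word eqxx mul1r.
rewrite fa_mul_cons {1}/fa_word eqxx mul1r /fa_mul big1 ?addr0 // => j _.
by rewrite /lder /fa_word mul0r.
Qed.
Let mulr1' : right_id (fa_word [::] : fser k) (fun p q : fser k => fa_mul p q : fser k).
Proof.
move=> p; apply/funext => w; elim: w p => [|i w IH] p.
  by rewrite fa_mul_nil /fa_word eqxx mulr1.
by rewrite fa_mul_cons IH /fa_word mulr0 add0r.
Qed.
Let one_neq0 : (fa_word [::] : fser k) != 0.
Proof.
by apply/eqP => /(congr1 (fun p : fser k => p [::])); rewrite /fa_word fser0 eqxx => /eqP; rewrite oner_eq0.
Qed.
HB.instance Definition _ :=
  GRing.Zmodule_isNzRing.Build (fser k) mulA mul1 mulr1' mulDl mulDr one_neq0.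
HB.instance Definition _ :=
  GRing.Lmodule_isLalgebra.Build C (fser k) (fun a p q => esym (mulZl a p q)).
HB.instance Definition _ :=
  GRing.Lalgebra_isAlgebra.Build C (fser k) (fun a p q => esym (mulZr a p q)).

Lemma fserM p q w : (p * q) w = fa_mul p q w. Proof. by []. Qed.
Lemma fserM_nil p q : (p * q) [::] = p [::] * q [::]. Proof. exact: fa_mul_nil. Qed.
Lemma fser1_nil : (1 : fser k) [::] = 1. Proof. by rewrite /GRing.one /= /fa_word eqxx. Qed.

Lemma lder_is_linear i : linear (lder i). Proof. by []. Qed.
HB.instance Definition _ i := GRing.isLinear.Build C (fser k) (fser k) _ (lder i) (lder_is_linear i).

Lemma lderM i p q : lder i (p * q) = p [::] *: lder i q + lder i p * q.
Proof. exact: lder_mul. Qed.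

Lemma lder1 i : lder i 1 = 0. Proof. by apply/funext. Qed.

Definition wd u : fser k := fa_word u.
Notation x i := (wd [:: i]).

Lemma lder_x i j : lder i (x j) = (i == j)%:R.
Proof.
apply/funext => w; rewrite /lder /wd /fa_word eqseq_cons; case: (i == j) => //.
Qed.

Lemma lder_xM i j q : lder i (x j * q) = (i == j)%:R * q.
Proof. by rewrite lderM lder_x /wd /fa_word /= scale0r add0r. Qed.

Lemma fser_decomp p : p = p [::] *: 1 + \sum_i x i * lder i p.
Proof.
apply/funext => -[|i w].
  rewrite fserD fserZ fser1_nil mulr1 fser_sum big1 ?addr0 // => i _.
  by rewrite fserM_nil /wd /fa_word mul0r.
rewrite -[RHS]/(lder i (p [::] *: 1 + \sum_j x j * lder j p) w).
rewrite linearD linearZ /= lder1 scaler0 add0r linear_sum fser_sum (bigD1 i) //=.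
rewrite lder_xM eqxx mul1r big1 ?addr0 // => j ji.
by rewrite lder_xM eq_sym (negPf ji) mul0r.
Qed.

Lemma wd_nil : wd [::] = 1. Proof. by []. Qed.

Lemma wd_cons i u : wd (i :: u) = x i * wd u.
Proof.
rewrite [LHS]fser_decomp [X in _ = X]fser_decomp !fserM_nil /wd {1 3}/fa_word /= mul0r.
congr (_ + _); apply: eq_bigr => j _; congr (_ * _); rewrite lder_xM.
apply/funext => w; rewrite /lder /fa_word eqseq_cons; case: (j == i); rewrite ?mul1r ?mul0r //.
Qed.

Lemma wd_cat u v : wd (u ++ v) = wd u * wd v.
Proof.
elim: u => [|i u IH]; first by rewrite [in RHS]wd_nil [RHS]mul1r.
by rewrite cat_cons [LHS]wd_cons IH [wd (i :: u)]wd_cons [LHS]mulrA.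
Qed.

(** Integer degrees make shifts free of side conditions; a negative degree forces zero. The
    inductive wrapper hides the quantifier of [fa_homog] from tactics. *)
Variant hom (d : int) p : Prop := Hom of fa_homog d p.

Lemma hom_size d p w : hom d p -> p w <> 0 -> (size w)%:Z = d.
Proof. by case=> hp; apply: hp. Qed.

Definition hcomp (d : int) p : fser k := fun w => if (size w)%:Z == d then p w else 0.

Lemma hcomp_is_linear d : linear (hcomp d).
Proof.
move=> a p q; apply/funext => w; rewrite fserD fserZ /hcomp fserD fserZ.
by case: ifP; rewrite ?mulr0 ?addr0.
Qed.
HB.instance Definition _ d :=
  GRing.isLinear.Build C (fser k) (fser k) _ (hcomp d) (hcomp_is_linear d).

Lemma hom_subspace d : subspace (hom d).
Proof.
split=> [|a p q hp hq]; split=> w; first by rewrite fser0 => /(_ erefl).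
rewrite fserD fserZ => nz; have [pw|] := eqVneq (p w) 0; last by move/eqP/(hom_size hp).
by apply: (hom_size hq) => qw; apply: nz; rewrite pw qw mulr0 addr0.
Qed.

Lemma hom0 d : hom d 0. Proof. by case: (hom_subspace d). Qed.
Lemma homD d p q : hom d p -> hom d q -> hom d (p + q).
Proof. exact: (subspaceD (hom_subspace d)). Qed.
Lemma homB d p q : hom d p -> hom d q -> hom d (p - q).
Proof. exact: (subspaceB (hom_subspace d)). Qed.
Lemma homZ d a p : hom d p -> hom d (a *: p).
Proof. exact: (subspaceZ _ (hom_subspace d)). Qed.
Lemma hom_sum d (I : Type) (s : seq I) (G : I -> fser k) :
  (forall t, hom d (G t)) -> hom d (\sum_(t <- s) G t).
Proof. exact: (subspace_sum _ (hom_subspace d)). Qed.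

Lemma hom_hcomp d p : hom d (hcomp d p).
Proof. by split=> w; rewrite /hcomp; case: eqP. Qed.

Lemma hcomp_id d p : hom d p -> hcomp d p = p.
Proof.
move=> hp; apply/funext => w; rewrite /hcomp; case: eqP => // ne.
by apply/esym/eqP/negP => /negP/eqP /(hom_size hp).
Qed.

Lemma hcomp_other d e p : hom e p -> d != e -> hcomp d p = 0.
Proof.
move=> hp ne; apply/funext => w; rewrite /hcomp; case: eqP => // sw.
by apply/eqP/negP => /negP/eqP /(hom_size hp) /eqP; rewrite sw (negPf ne).
Qed.

Lemma hom_lder d i p : hom d p -> hom (d - 1) (lder i p).
Proof. by move=> hp; split=> w /(hom_size hp) /= <-; lia. Qed.

Lemma hom_neg d p : hom d p -> d < 0 -> p = 0.
Proof.
move=> hp d0; apply/funext => w; apply/eqP/negP => /negP/eqP /(hom_size hp) sw.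
by move: d0; rewrite -sw ltNge.
Qed.

Lemma hom_nil d p : hom d p -> d != 0 -> p [::] = 0.
Proof. by move=> hp d0; apply/eqP/negP => /negP/eqP /(hom_size hp) /= /eqP; rewrite eq_sym (negPf d0). Qed.

Lemma hom_wd u : hom (size u)%:Z (wd u).
Proof. by split=> w; rewrite /wd /fa_word; case: eqP => // ->. Qed.

Lemma hom1 : hom 0 1. Proof. by rewrite -wd_nil; exact: (hom_wd [::]). Qed.

Lemma homM d e p q : hom d p -> hom e q -> hom (d + e) (p * q).
Proof.
move=> hp hq; split=> w; rewrite fserM /fa_mul => nz.
have [i nzi] : exists i : 'I_(size w).+1, p (take i w) * q (drop i w) != 0.
  apply/existsP; apply: contraT; rewrite negb_exists => /forallP H.
  by case: nz; rewrite big1 // => i _; apply/eqP; have := H i; rewrite negbK.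
move: nzi; rewrite mulf_eq0 negb_or => /andP[/eqP/(hom_size hp) <- /eqP/(hom_size hq) <-].
by rewrite -PoszD -size_cat cat_take_drop.
Qed.

Lemma homE d e p : hom d p -> d = e -> hom e p. Proof. by move=> hp <-. Qed.

Lemma size_take_drop w n : (size w)%:Z = (size (take n w))%:Z + (size (drop n w))%:Z.
Proof. by rewrite -PoszD -size_cat cat_take_drop. Qed.

Lemma hcomp_mull d e p q : hom e p -> hcomp d (p * q) = p * hcomp (d - e) q.
Proof.
move=> hp; apply/funext => w; rewrite /hcomp !fserM.
have [sw|ne] := eqVneq (size w)%:Z d; last rewrite /fa_mul big1 //; last move=> i _.
  apply: eq_bigr => i _; have [->|/eqP/(hom_size hp) sp] := eqVneq (p (take i w)) 0; first by rewrite !mul0r.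
  by rewrite -sp -sw (size_take_drop w i) ifT //; lia.
have [->|/eqP/(hom_size hp) sp] := eqVneq (p (take i w)) 0; first by rewrite !mul0r.
case: eqP => [sd|_]; last by rewrite mulr0.
by case/eqP: ne; rewrite (size_take_drop w i) sp sd addrC subrK.
Qed.

Lemma hcomp_mulr d e p q : hom e q -> hcomp d (p * q) = hcomp (d - e) p * q.
Proof.
move=> hq; apply/funext => w; rewrite /hcomp !fserM.
have [sw|ne] := eqVneq (size w)%:Z d; last rewrite /fa_mul big1 //; last move=> i _.
  apply: eq_bigr => i _; have [->|/eqP/(hom_size hq) sp] := eqVneq (q (drop i w)) 0; first by rewrite !mulr0.
  by rewrite -sp -sw (size_take_drop w i) ifT //; lia.
have [->|/eqP/(hom_size hq) sp] := eqVneq (q (drop i w)) 0; first by rewrite !mulr0.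
case: eqP => [sd|_]; last by rewrite mul0r.
by case/eqP: ne; rewrite (size_take_drop w i) sp sd subrK.
Qed.

Lemma fin_hcomp p : fa_fin p -> exists B : nat, p = \sum_(d < B) hcomp d%:Z p.
Proof.
move=> [B pB]; exists B.+1; apply/funext => w; rewrite fser_sum.
have [sw|sw] := ltnP B (size w).
  rewrite pB // big1 // => d _; rewrite /hcomp; case: eqP => // -[] sd.
  by have := ltn_ord d; rewrite -sd ltnS leqNgt sw.
rewrite (bigD1 (Ordinal (sw : (size w < B.+1)%N))) //= big1 ?addr0 /hcomp ?eqxx // => d dw.
by case: eqP => // -[] /esym dd; case/eqP: dw; apply: val_inj.
Qed.

Lemma hom_fin d p : hom d p -> fa_fin p.
Proof.
move=> hp; exists `|d|%N => w sw; apply/eqP/negP => /negP/eqP /(hom_size hp) E.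
by move: sw; rewrite -E absz_nat ltnn.
Qed.

Lemma fin_sum (I : Type) (s : seq I) (G : I -> fser k) :
  (forall t, fa_fin (G t)) -> fa_fin (\sum_(t <- s) G t).
Proof.
move=> fG; elim: s => [|t s IH]; first by rewrite big_nil; exists 0%N.
rewrite big_cons; have [B1 h1] := fG t; have [B2 h2] := IH; exists (maxn B1 B2) => w.
by rewrite gtn_max fserD => /andP[s1 s2]; rewrite h1 // h2 // addr0.
Qed.

Lemma hom_span d p : hom d%:Z p -> p = \sum_(t : d.-tuple 'I_k) p t *: wd t.
Proof.
move=> hp; apply/funext => w; rewrite fser_sum.
have [sw|sw] := eqVneq (size w) d.
  move/eqP: sw => sw; rewrite (bigD1 (Tuple sw)) //= fserZ /wd /fa_word eqxx mulr1 big1 ?addr0 // => t tw.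
  rewrite fserZ; case: (w =P t :> seq _) => [wt|_]; last by rewrite mulr0.
  by case/eqP: tw; apply: val_inj.
rewrite big1 => [|t _].
  by apply/eqP/negP => /negP/eqP /(hom_size hp) [] /eqP; rewrite (negPf sw).
rewrite fserZ /wd /fa_word; case: (w =P t :> seq _) => [wt|_]; last by rewrite mulr0.
by move: sw; rewrite wt size_tuple eqxx.
Qed.

End FreeAlgebra.
Notation x i := (wd [:: i]).

(** * The ideal of relations *)

Section Ideal.
Variables (k r : nat) (rl : seq (fa k)).
Implicit Types (p q u v : fser k) (i j : 'I_k).
Hypothesis rl_hom : forall n, hom r%:Z (nth (@fa0 k) rl n).
Hypothesis r_gt0 : (0 < r)%N.
Definition idl (p : fser k) : Prop := in_ideal rl p.
Notation Id := idl.
Notation rel n := (nth (@fa0 k) rl n : fser k).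

Definition iterm (t : C * word k * nat * word k) : fser k :=
  t.1.1.1 *: (wd t.1.1.2 * rel t.1.2 * wd t.2).

Lemma IdP p : Id p <-> exists s, p = \sum_(t <- s) iterm t.
Proof.
split=> -[s ps]; exists s; last by move=> w; rewrite ps fser_sum.
by apply/funext => w; rewrite ps fser_sum.
Qed.

Lemma Id_subspace : subspace Id.
Proof.
split; first by apply/IdP; exists [::]; rewrite big_nil.
move=> a p q /IdP[s ->] /IdP[s' ->]; apply/IdP.
exists ([seq (a * t.1.1.1, t.1.1.2, t.1.2, t.2) | t <- s] ++ s').
by rewrite big_cat big_map scaler_sumr; congr (_ + _); apply: eq_bigr => t _; rewrite scalerA.
Qed.

Lemma Id0 : Id (0 : fser k). Proof. by case: Id_subspace. Qed.
Lemma IdD p q : Id p -> Id q -> Id (p + q). Proof. exact: (subspaceD Id_subspace). Qed.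
Lemma IdB p q : Id p -> Id q -> Id (p - q). Proof. exact: (subspaceB Id_subspace). Qed.
Lemma IdN p : Id p -> Id (- p). Proof. exact: (subspaceN Id_subspace). Qed.
Lemma IdZ a p : Id p -> Id (a *: p). Proof. exact: (subspaceZ _ Id_subspace). Qed.
Lemma Id_sum (I : Type) (s : seq I) (G : I -> fser k) :
  (forall t, Id (G t)) -> Id (\sum_(t <- s) G t).
Proof. exact: (subspace_sum _ Id_subspace). Qed.
Lemma IdBC p q : Id (p - q) -> Id (q - p).
Proof. by move/IdN; rewrite opprB. Qed.
Lemma IdBD p q s : Id (p - q) -> Id (q - s) -> Id (p - s).
Proof. by move=> h1 h2; rewrite -[p](subrK q) -addrA; apply: IdD. Qed.

Lemma Id_wdl w p : Id p -> Id (wd w * p).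
Proof.
move=> /IdP[s ->]; apply/IdP; exists [seq (t.1.1.1, w ++ t.1.1.2, t.1.2, t.2) | t <- s].
rewrite big_map mulr_sumr; apply: eq_bigr => t _.
by rewrite /iterm /= wd_cat -scalerAr !mulrA.
Qed.

Lemma Id_wdr w p : Id p -> Id (p * wd w).
Proof.
move=> /IdP[s ->]; apply/IdP; exists [seq (t.1.1.1, t.1.1.2, t.1.2, t.2 ++ w) | t <- s].
rewrite big_map mulr_suml; apply: eq_bigr => t _.
by rewrite /iterm /= wd_cat -scalerAl !mulrA.
Qed.

Lemma Id_homl d u p : hom d u -> Id p -> Id (u * p).
Proof.
case: d => d hu Ip; last by rewrite (hom_neg hu) // mul0r; apply: Id0.
rewrite (hom_span hu) mulr_suml; apply: Id_sum => t.
by rewrite -scalerAl; apply: IdZ; apply: Id_wdl.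
Qed.

Lemma Id_homr d u p : hom d u -> Id p -> Id (p * u).
Proof.
case: d => d hu Ip; last by rewrite (hom_neg hu) // mulr0; apply: Id0.
rewrite (hom_span hu) mulr_sumr; apply: Id_sum => t.
by rewrite -scalerAr; apply: IdZ; apply: Id_wdr.
Qed.

Lemma Id_rel n : Id (rel n).
Proof.
apply/IdP; exists [:: (1, [::], n, [::])].
by rewrite big_seq1 /iterm /= scale1r wd_nil mul1r mulr1.
Qed.

Lemma hom_iterm t : hom ((size t.1.1.2)%:Z + r%:Z + (size t.2)%:Z) (iterm t).
Proof. exact: (homZ _ (homM (homM (hom_wd _) (rl_hom _)) (hom_wd _))). Qed.

Lemma Id_hcomp d p : Id p -> Id (hcomp d p).
Proof.
move=> /IdP[s ->]; rewrite linear_sum /=; apply: Id_sum => t.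
have [->|ne] := eqVneq d ((size t.1.1.2)%:Z + r%:Z + (size t.2)%:Z).
  rewrite hcomp_id; last exact: hom_iterm.
  by apply/IdP; exists [:: t]; rewrite big_seq1.
by rewrite (hcomp_other (hom_iterm t)) //; apply: Id0.
Qed.

Lemma Id_nil p : Id p -> p [::] = 0.
Proof.
move=> /IdP[s ->]; rewrite fser_sum big1 // => t _.
by apply: (hom_nil (hom_iterm t)); lia.
Qed.

Lemma Id_fin p : Id p -> fa_fin p.
Proof. by move=> /IdP[s ->]; apply: fin_sum => t; apply/hom_fin/hom_iterm. Qed.

Lemma Id_hcompP p : fa_fin p -> (forall d : nat, Id (hcomp d%:Z p)) -> Id p.
Proof. by move=> /fin_hcomp[B {2}->] H; apply: Id_sum. Qed.

Hypothesis rl_size : size rl = k.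

(* An element of the ideal is a sum of relations times elements, up to the left multiples
   [x_i I]. *)
Lemma Id_lder d p : Id p -> hom d p ->
  exists t : 'I_k -> fser k, (forall j, hom (d - r%:Z) (t j)) /\
    forall i, Id (lder i p - \sum_(j < k) lder i (rel j) * t j).
Proof.
move=> Ip hp.
have [t Ht] : exists t : 'I_k -> fser k, forall i, Id (lder i p - \sum_(j < k) lder i (rel j) * t j).
  move: Ip => /IdP[s ->]; elim: s => [|[[[c w] n] z] s [t Ht]].
    exists (fun=> 0) => i; rewrite big_nil linear0 big1 ?subrr; first exact: Id0.
    by move=> j _; rewrite mulr0.
  (* Only terms that begin with a relation matter: if the left word begins with [a], the term is
     [x a] times an element of the ideal, and so are its derivatives in the ideal. *)
  case: w => [|a w].
    have [nk|nk] := ltnP n k; last first.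
      exists t => i; rewrite big_cons /iterm /= (nth_default (@fa0 k)) ?rl_size //.
      by rewrite mulr0 mul0r scaler0 add0r.
    exists (fun j => (if j == Ordinal nk then c *: wd z else 0) + t j) => i.
    rewrite big_cons linearD /=.
    under [X in _ - X]eq_bigr => j _ do rewrite mulrDr.
    rewrite big_split /= opprD addrACA.
    apply: IdD => //; rewrite (bigD1 (Ordinal nk)) //= eqxx [X in _ - (_ + X)]big1 => [|j /negPf ->]; last by rewrite mulr0.
    rewrite addr0 /iterm /= wd_nil mul1r linearZ /= lderM.
    rewrite (hom_nil (rl_hom n)) ?scale0r ?add0r; last by lia.
    by rewrite -scalerAr subrr; apply: Id0.
  exists t => i; rewrite big_cons linearD /= -addrA; apply: IdD => //.
  rewrite /iterm /= wd_cons linearZ /= -!mulrA lder_xM; apply: IdZ.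
  case: (i == a); rewrite ?mul0r ?mul1r; last exact: Id0.
  by apply: Id_wdl; apply: Id_wdr; apply: Id_rel.
(* The coefficients found need not be homogeneous; their components of degree [d - r] still work,
   everything else being homogeneous. *)
exists (fun j => hcomp (d - r%:Z) (t j)); split=> [j|i]; first exact: hom_hcomp.
have := Id_hcomp (d - 1) (Ht i); rewrite linearB linear_sum /= hcomp_id; last exact: hom_lder.
congr (Id _); congr (_ - _); apply: eq_bigr => j _.
rewrite (hcomp_mull _ _ (hom_lder i (rl_hom j))); congr (_ * hcomp _ _); lia.
Qed.

End Ideal.

(** * Evaluation of noncommutative polynomials at sequences of points *)

Section Chains.
Variable k : nat.
Implicit Types (p q : point k) (u v : fser k) (ps : seq (point k)) (P : nat -> point k).

(** Evaluation of the first letter at [p]; it commutes with right multiplication on elements without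
    constant term. *)
Definition ctr p v : fser k := \sum_i p i *: lder i v.

Lemma ctr_is_linear p : linear (ctr p).
Proof.
move=> a u v; rewrite /ctr scaler_sumr -big_split; apply: eq_bigr => i _ /=.
by rewrite lder_is_linear scalerDr !scalerA [p i * a]mulrC.
Qed.
HB.instance Definition _ p := GRing.isLinear.Build C (fser k) (fser k) _ (ctr p) (ctr_is_linear p).

Lemma ctrM p u v : ctr p (u * v) = u [::] *: ctr p v + ctr p u * v.
Proof.
rewrite /ctr mulr_suml scaler_sumr -big_split; apply: eq_bigr => i _ /=.
by rewrite lderM scalerDr !scalerA mulrC scalerAl.
Qed.

Lemma hom_ctr d p v : hom d v -> hom (d - 1) (ctr p v).
Proof. by move=> hv; apply: hom_sum => i; apply/homZ/hom_lder. Qed.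

Fixpoint ctrs ps v := if ps is p :: ps' then ctrs ps' (ctr p v) else v.

Lemma ctrs_is_linear ps : linear (ctrs ps).
Proof. by elim: ps => //= p ps IH a u v; rewrite linearP IH. Qed.
HB.instance Definition _ ps := GRing.isLinear.Build C (fser k) (fser k) _ (ctrs ps) (ctrs_is_linear ps).

Lemma ctrs_cat ps qs v : ctrs (ps ++ qs) v = ctrs qs (ctrs ps v).
Proof. by elim: ps v => /=. Qed.

Lemma hom_ctrs d ps v : hom d v -> hom (d - (size ps)%:Z) (ctrs ps v).
Proof.
elim: ps d v => [|p ps IH] d v hv /=; first by rewrite subr0.
by apply: homE (IH _ _ (hom_ctr p hv)) _; lia.
Qed.

Definition ev ps v : C := ctrs ps v [::].

Lemma ev_linear ps a u v : ev ps (a *: u + v) = a * ev ps u + ev ps v.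
Proof. by rewrite /ev linearP. Qed.
Lemma evD ps u v : ev ps (u + v) = ev ps u + ev ps v.
Proof. by rewrite /ev linearD. Qed.
Lemma evB ps u v : ev ps (u - v) = ev ps u - ev ps v.
Proof. by rewrite /ev linearB. Qed.
Lemma evZ ps a u : ev ps (a *: u) = a * ev ps u.
Proof. by rewrite /ev linearZ. Qed.
Lemma ev_sum (I : Type) (s : seq I) ps (G : I -> fser k) :
  ev ps (\sum_(t <- s) G t) = \sum_(t <- s) ev ps (G t).
Proof. by rewrite /ev linear_sum fser_sum. Qed.

Lemma ctrs_mul ps u v : hom (size ps)%:Z u -> ctrs ps (u * v) = ev ps u *: v.
Proof.
elim: ps u => [|p ps IH] u hu /=.
  rewrite [in LHS](fser_decomp u) big1 ?addr0 => [|i _]; last first.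
    by rewrite (hom_neg (hom_lder i hu)) ?mulr0.
  by rewrite -scalerAl mul1r.
rewrite ctrM (hom_nil hu) // scale0r add0r IH //.
by apply: homE (hom_ctr p hu) _; rewrite /=; lia.
Qed.

Lemma ev_mul ps qs u v : hom (size ps)%:Z u -> ev (ps ++ qs) (u * v) = ev ps u * ev qs v.
Proof. by move=> hu; rewrite /ev ctrs_cat ctrs_mul // linearZ. Qed.

Lemma ctrs_app ps v w : ctrs ps v w = ctrs ps (fun z => v (z ++ w)) [::].
Proof.
elim: ps v => [//|p ps IH] v /=; rewrite IH.
congr (ctrs ps _ [::]); apply/funext => z; rewrite /ctr !fser_sum.
by apply: eq_bigr => i _.
Qed.

Definition seg P n := mkseq P n.
Definition shift m P : nat -> point k := fun i => P (m + i)%N.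

Lemma size_seg P n : size (seg P n) = n. Proof. exact: size_mkseq. Qed.

Lemma seg_cat P m n : seg P (m + n) = seg P m ++ seg (shift m P) n.
Proof.
rewrite /seg /mkseq iotaD map_cat; congr (_ ++ _).
by rewrite add0n -{1}[m]addn0 iotaDl -map_comp.
Qed.

Lemma segS P n : seg P n.+1 = P 0%N :: seg (shift 1 P) n.
Proof. by rewrite -add1n seg_cat. Qed.

Lemma segSr P n : seg P n.+1 = rcons (seg P n) (P n).
Proof. exact: mkseqS. Qed.

Lemma shift_shift m n P : shift m (shift n P) = shift (n + m) P.
Proof. by apply/funext => i; rewrite /shift addnA. Qed.

Lemma shift0 P : shift 0 P = P. Proof. by []. Qed.

End Chains.

(** If [th *m p = 1], the projector [1 - p *m th] kills [p], so its rows lie in [kermx p], which by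
    the rank hypothesis is the row space of [M]. Thus [B] inverts [M] up to multiples of [p]. *)
Lemma corank_one_inv (K : fieldType) n (M : 'M[K]_n) (p : 'cV[K]_n) :
  p != 0 -> M *m p = 0 -> (n - 1 <= \rank M)%N ->
  exists B : 'M[K]_n, exists th : 'rV[K]_n, 1%:M - B *m M = p *m th.
Proof.
move=> p0 Mp rM; have [i pi] : exists i, p i 0 != 0.
  apply/existsP; apply: contraNT p0; rewrite negb_exists => /forallP H.
  by apply/eqP/colP => i; have := H i; rewrite negbK mxE => /eqP.
pose th : 'rV[K]_n := (p i 0)^-1 *: delta_mx 0 i.
have thp : th *m p = 1%:M.
  rewrite -scalemxAl -rowE; apply/matrixP => a b; rewrite !ord1 !mxE eqxx.
  by rewrite mulVf.
have sMk : (M <= kermx p)%MS by apply/sub_kermxP.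
have rp : \rank p = 1%N.
  apply/eqP; rewrite eqn_leq rank_leq_col lt0n mxrank_eq0 //.
have kM : (kermx p <= M)%MS.
  by rewrite -(mxrank_leqif_sup sMk) eqn_leq mxrankS // mxrank_ker rp.
have : (1%:M - p *m th <= M)%MS.
  apply: submx_trans kM; apply/sub_kermxP.
  by rewrite mulmxBl mul1mx -mulmxA thp mulmx1 subrr.
move/submxP=> [B BE]; exists B, th; by rewrite -BE opprB addrC subrK.
Qed.

Definition nzp k (p : point k) := [exists j, p j != 0].

(** * Chains of points and steps between lines *)

Section Geometry.
Variables (k s : nat) (rl : seq (fa k)).
Implicit Types (p q : point k) (u v l : fser k) (ps : seq (point k)) (P : nat -> point k).
Notation r := s.+1.
Notation rel n := (nth (@fa0 k) rl n : fser k).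
Notation Id := (idl rl).

(** The relations with their first [s] letters evaluated, as linear forms in the last one. A kernel
    column is a possible next point and, by [rel_cyc], a kernel row a possible previous point. *)
Definition relmx ps : 'M[C]_k := \matrix_(i, j) ctrs ps (rel i) [:: j].

Definition chain P := (forall i, nzp (P i)) /\
  forall i (j : 'I_k), ev (seg (shift i P) r) (rel j) = 0.

(* [rel_cyc] says that the relations are the partial derivatives of a cyclically invariant
   superpotential; [line_decomp] describes the kernel of evaluation at [P 0, .., P (s - 1)]. *)
Record elliptic : Prop := Elliptic {
  s_gt0 : (0 < s)%N;
  rel_size : size rl = k;
  rel_hom : forall n, hom r%:Z (rel n);
  rel_cyc : forall (i j : 'I_k) w, rel i (rcons w j) = rel j (i :: w);
  rank_relmx : forall ps, size ps = s -> all (@nzp k) ps -> (k - 1 <= \rank (relmx ps))%N;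
  line_meets : forall l, hom 1 l -> l != 0 ->
    exists p ps, [/\ size (p :: ps) = s, all (@nzp k) (p :: ps),
                    \det (relmx (p :: ps)) = 0 & ev [:: p] l = 0];
  line_decomp : forall P l, (forall i, nzp (P i)) -> hom 1 l -> l != 0 -> ev [:: P 0%N] l = 0 ->
    exists2 u, hom s%:Z u & forall (n : nat) y, hom n%:Z y -> ctrs (seg P s) y = 0 ->
      ev (seg P n) y = 0 ->
      exists a b, [/\ hom (n%:Z - 1) a, hom (n%:Z - s%:Z) b & y = l * a + u * b];
  rel_indecomp : forall (c : 'I_k -> C) l a, hom 1 l -> hom s%:Z a ->
    \sum_(j < k) c j *: rel j = l * a -> forall j, c j = 0 }.

Hypothesis ell : elliptic.
Let rh := rel_hom ell.
Let rs := rel_size ell.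

Lemma hom0_scalar u : hom 0 u -> u = u [::] *: 1.
Proof.
move=> hu; rewrite [LHS]fser_decomp big1 ?addr0 // => i _.
by rewrite (hom_neg (hom_lder i hu)) ?mulr0.
Qed.

Lemma hom1_sum l : hom 1 l -> l = \sum_i l [:: i] *: x i.
Proof.
move=> hl; rewrite [LHS]fser_decomp (hom_nil hl) // scale0r add0r.
apply: eq_bigr => i _; rewrite [lder i l]hom0_scalar; last exact: hom_lder hl.
by rewrite -scalerAr mulr1.
Qed.

Lemma mulx_rcons u i j w : (u * x i) (rcons w j) = u w * (i == j)%:R.
Proof.
elim: w u => [|a w IH] u; rewrite /= fserM fa_mul_cons.
  by rewrite fa_mul_nil /wd /fa_word eqseq_cons andbT eq_sym mulr0 addr0.
rewrite -fserM IH /wd /fa_word; case: w {IH} => [|? ?]; by rewrite /= eqseq_cons andbF mulr0 add0r.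
Qed.

(** By [rel_cyc] the matrix of the [lder i (rel j)] produces the relations from the generators on
    either side; hence consecutive maps in [syzygy_count] compose to zero. *)
Lemma lder_rel_sum (i : 'I_k) : \sum_(j < k) lder i (rel j) * x j = rel i.
Proof.
apply/funext => w; rewrite fser_sum; case/lastP: w => [|w j].
  rewrite (hom_nil (rh i)) // big1 // => j _; by rewrite fserM_nil mulr0.
rewrite (rel_cyc ell) (bigD1 j) //= mulx_rcons eqxx mulr1 big1 ?addr0 // => a aj.
by rewrite mulx_rcons (negPf aj) mulr0.
Qed.

Lemma ev_rcons_rel ps p (i : 'I_k) : ev (rcons ps p) (rel i) = \sum_j relmx ps i j * p j
  :> C.
Proof.
rewrite /ev -cats1 ctrs_cat /= /ctr fser_sum; apply: eq_bigr => j _.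
by rewrite fserZ mxE mulrC.
Qed.

Lemma ev_cons_rel ps p (j : 'I_k) : ev (p :: ps) (rel j) = \sum_i p i * relmx ps i j.
Proof.
rewrite /ev /= /ctr linear_sum fser_sum; apply: eq_bigr => i _.
rewrite linearZ /= fserZ mxE [in RHS]ctrs_app; congr (_ * ctrs ps _ _).
by apply/funext => w; rewrite cats1 (rel_cyc ell).
Qed.

Definition colp p : 'cV[C]_k := \col_i p i.

Lemma colp_neq0 p : nzp p -> colp p != 0.
Proof.
by case/existsP=> j pj; apply: contraNneq pj => /colP/(_ j); rewrite !mxE => ->.
Qed.

Lemma relmx_ker ps p : (forall i : 'I_k, ev (rcons ps p) (rel i) = 0) -> relmx ps *m colp p = 0.
Proof.
move=> H; apply/colP => i; rewrite !mxE -[RHS](H i) ev_rcons_rel.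
by apply: eq_bigr => j _; rewrite [colp _ _ _]mxE.
Qed.

Lemma det_relmx_cons ps p : nzp p -> (forall j : 'I_k, ev (p :: ps) (rel j) = 0) ->
  \det (relmx ps) = 0.
Proof.
move=> np H; apply/eqP/det0P; exists (\row_i p i).
  by case/existsP: np => j pj; apply: contraNneq pj => /rowP/(_ j); rewrite !mxE => ->.
apply/rowP => j; rewrite !mxE -[RHS](H j) ev_cons_rel.
by apply: eq_bigr => i _; rewrite mxE.
Qed.

Lemma det_relmx_rcons ps p : nzp p -> (forall j : 'I_k, ev (rcons ps p) (rel j) = 0) ->
  \det (relmx ps) = 0.
Proof.
move=> np H; rewrite -det_tr; apply/eqP/det0P; exists (colp p)^T.
  by rewrite -(trmx0 _ _ 1) (inj_eq trmx_inj) colp_neq0.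
by rewrite -trmx_mul relmx_ker ?trmx0.
Qed.

Lemma shift_chain m P : chain P -> chain (shift m P).
Proof.
move=> [nP cP]; split=> [i|i j]; first exact: nP.
by rewrite shift_shift; apply: cP.
Qed.

Lemma chain_nz P n : chain P -> all (@nzp k) (seg P n).
Proof. by move=> [nP _]; apply/allP => p /mapP[i _ ->]. Qed.

Lemma ev_idl P n v : chain P -> Id v -> hom n%:Z v -> ev (seg P n) v = 0.
Proof.
move=> cP /IdP[t ->] hv; rewrite -(hcomp_id hv) linear_sum ev_sum big1 //= => {hv} -[[[c w] m] z] _.
have ht := hom_iterm rh (c, w, m, z).
have [en|ne] := eqVneq n%:Z ((size w)%:Z + r%:Z + (size z)%:Z); last first.
  by rewrite (hcomp_other ht) // /ev linear0.
rewrite hcomp_id; last by apply: homE ht _.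
have -> : n = ((size w + r) + size z)%N by lia.
rewrite evZ seg_cat ev_mul; last first.
  by rewrite size_seg PoszD; apply: homM (rh m); apply: hom_wd.
rewrite seg_cat ev_mul ?size_seg; last exact: hom_wd.
have [mk|mk] := ltnP m k; last first.
  by rewrite nth_default ?rs // [X in _ * X * _]/ev [ctrs _ (@fa0 k)]linear0 fser0 mulr0 mul0r mulr0.
by have /(_ (Ordinal mk)) /= -> := cP.2 (size w); rewrite mulr0 mul0r mulr0.
Qed.

Lemma ctrs_mul_le ps d u v : hom d u -> (size ps)%:Z <= d -> ctrs ps (u * v) = ctrs ps u * v.
Proof.
elim: ps d u => [//|p ps IH] d u hu /= sd.
rewrite ctrM (hom_nil hu) ?scale0r ?add0r; last by lia.
by apply: IH (hom_ctr p hu) _; lia.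
Qed.

Lemma ctrs_rel ps (i : 'I_k) : size ps = s -> ctrs ps (rel i) = \sum_j relmx ps i j *: x j.
Proof.
move=> sp; rewrite [LHS]hom1_sum; last first.
  by apply: homE (hom_ctrs ps (rh i)) _; rewrite sp; lia.
by apply: eq_bigr => j _; rewrite mxE.
Qed.

Lemma ctr_xM p i v : ctr p (x i * v) = p i *: v.
Proof.
rewrite /ctr (bigD1 i) //= lder_xM eqxx mul1r big1 ?addr0 // => j ji.
by rewrite lder_xM (negPf ji) mul0r scaler0.
Qed.

(** Vanishing at all [n] points becomes, modulo the ideal, a condition on the first [s] points only,
    to which [line_decomp] applies. The induction corrects the contraction with [P 0]; a combination
    of relations removes what remains. *)
Lemma ev_zero_mod_ideal P n v : chain P -> hom n%:Z v -> ev (seg P n) v = 0 ->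
  exists z, [/\ Id z, hom n%:Z z & ctrs (seg P s) (v - z) = 0].
Proof.
elim: n P v => [|n IH] P v cP hv v0.
  exists 0; split; [exact: Id0 | exact: hom0 | rewrite subr0].
  rewrite (hom_neg (hom_ctrs (seg P s) hv)) // size_seg; have := s_gt0 ell; lia.
have [ns|sn] := leqP n.+1 s.
  exists 0; split; [exact: Id0 | exact: hom0 | rewrite subr0].
  have hc := hom_ctrs (seg P s) hv; have [e|ne] := eqVneq n.+1 s.
    rewrite [LHS]hom0_scalar; last by apply: homE hc _; rewrite size_seg e subrr.
    by rewrite -/(ev (seg P s) v) -e v0 scale0r.
  by rewrite (hom_neg hc) // size_seg; lia.
have hv' : hom n%:Z (ctr (P 0%N) v) by apply: homE (hom_ctr _ hv) _; lia.
have v0' : ev (seg (shift 1 P) n) (ctr (P 0%N) v) = 0 by move: v0; rewrite segS.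
have [z' [Iz' hz' cz']] := IH _ _ (shift_chain 1 cP) hv' v0'.
have /existsP[a Pa] := cP.1 0%N.
(* A lift of [z']: contraction with [P 0] takes [z1] to [z']. *)
pose z1 := (P 0%N a)^-1 *: (x a * z').
have Iz1 : Id z1 by apply/IdZ/Id_wdl.
have hz1 : hom n.+1%:Z z1.
  by apply: homZ; apply: homE (homM (hom_wd _) hz') _; rewrite /=; lia.
pose Y := ctrs (seg P s) (v - z1).
have hY : hom (n.+1%:Z - s%:Z) Y.
  by rewrite -{1}(size_seg P s); apply/hom_ctrs/homB.
have ctY : ctr (P s) Y = 0.
  have : ctrs (seg P r) (v - z1) = 0.
    by rewrite segS /= linearB /= [ctr _ z1]linearZ /= ctr_xM scalerA mulVf // scale1r.
  by rewrite segSr -cats1 ctrs_cat.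
have Mp : relmx (seg P s) *m colp (P s) = 0.
  by apply: relmx_ker => i; rewrite -segSr; apply: (cP.2 0%N).
(* A combination [z2] of relations with [ctrs (seg P s) z2 = Y] is wanted. Contraction turns [rel j]
   into row [j] of [relmx]; [B] inverts this matrix up to multiples of [P s], which are harmless
   because [ctr (P s) Y = 0]. *)
have [B [th BE]] := corank_one_inv (colp_neq0 (cP.1 s)) Mp
  (rank_relmx ell (size_seg P s) (chain_nz s cP)).
pose t (j : 'I_k) := \sum_i B i j *: lder i Y.
have ht j : hom (n%:Z - s%:Z) (t j).
  by apply: hom_sum => i; apply: homZ; apply: homE (hom_lder i hY) _; lia.
pose z2 := \sum_(j < k) rel j * t j.
have Iz2 : Id z2 by apply: Id_sum => j; apply: Id_homr (ht j) _; apply: Id_rel.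
have hz2 : hom n.+1%:Z z2.
  by apply: hom_sum => j; apply: homE (homM (rh j) (ht j)) _; lia.
exists (z1 + z2); split; [exact: IdD | exact: homD |].
rewrite opprD addrA linearB /= -/Y; apply/eqP; rewrite subr_eq0; apply/eqP.
rewrite /z2 linear_sum /=.
transitivity (\sum_l x l * \sum_i (B *m relmx (seg P s)) i l *: lder i Y); last first.
  transitivity (\sum_(j < k) \sum_l x l * (relmx (seg P s) j l *: t j)).
    rewrite exchange_big; apply: eq_bigr => l _; rewrite -mulr_sumr; congr (_ * _).
    rewrite /t; under [RHS]eq_bigr => j _ do rewrite scaler_sumr.
    rewrite [RHS]exchange_big; apply: eq_bigr => i _; rewrite mxE scaler_suml.
    by apply: eq_bigr => j _; rewrite scalerA mulrC.
  apply: eq_bigr => j _; rewrite (ctrs_mul_le _ (rh j)) ?size_seg; last by lia.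
  rewrite ctrs_rel ?size_seg // mulr_suml; apply: eq_bigr => l _.
  by rewrite -scalerAl scalerAr.
rewrite [LHS]fser_decomp (hom_nil hY) ?scale0r ?add0r; last by lia.
apply: eq_bigr => l _; congr (_ * _).
have -> : B *m relmx (seg P s) = 1%:M - colp (P s) *m th by rewrite -BE opprB addrC subrK.
transitivity (\sum_i (((i == l)%:R : C) *: lder i Y - th 0 l *: (P s i *: lder i Y))).
  rewrite sumrB -scaler_sumr -/(ctr (P s) Y) ctY scaler0 subr0 (bigD1 l) //= eqxx scale1r.
  by rewrite big1 ?addr0 // => i il; rewrite (negPf il) scale0r.
apply: eq_bigr => i _; rewrite scalerA -scalerBl !mxE big_ord1 !mxE.
by rewrite [th 0 l * _]mulrC.
Qed.

Lemma chain_cons P p : chain P -> nzp p -> (forall j : 'I_k, ev (p :: seg P s) (rel j) = 0) ->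
  chain (fun i => if i is i'.+1 then P i' else p).
Proof.
move=> [nP cP] np H; split=> [[|i]|[|i] j] //; last exact: cP.
by rewrite segS; apply: H.
Qed.

(** A singular window has a kernel column, the next point. By [rel_cyc] the point dropped from the
    window gives a kernel row of the shifted one, which is therefore singular again, so the
    construction never stops. *)
Lemma chain_window ps : size ps = s -> all (@nzp k) ps -> \det (relmx ps) = 0 ->
  exists2 P, chain P & seg P s = ps.
Proof.
pose good ps := [/\ size ps = s, all (@nzp k) ps & \det (relmx ps) = 0].
have nxt qs : exists p, good qs ->
    (forall i : 'I_k, ev (rcons qs p) (rel i) = 0) /\ good (rcons (behead qs) p).
  have [[sq nq dq]|] := pselect (good qs); last by exists (fun=> 0).
  move/eqP: dq; rewrite -det_tr => /det0P[v v0 vM].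
  pose p i := v 0 i; exists p => _.
  have np : nzp p.
    apply: contraNT v0; rewrite negb_exists => /forallP H; apply/eqP/rowP => i.
    by have := H i; rewrite negbK mxE => /eqP.
  have Hp (i : 'I_k) : ev (rcons qs p) (rel i) = 0.
    rewrite ev_rcons_rel; move/rowP/(_ i): vM; rewrite !mxE => vM; rewrite -[RHS]vM.
    by apply: eq_bigr => j _; rewrite [in RHS]mxE mulrC.
  split=> //; case: qs sq nq Hp {vM} => [|q qs] /= sq nq Hp.
    by have := s_gt0 ell; rewrite -sq.
  split; first by rewrite size_rcons.
    by rewrite all_rcons np; case/andP: nq.
  by apply: det_relmx_cons Hp; case/andP: nq.
move: nxt => /choice[nxt Hn] sp np dp.
pose W i := iter i (fun qs => rcons (behead qs) (nxt qs)) ps.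
have gW i : good (W i).
  by elim: i => [|i IH] //=; case: (Hn _ IH).
have sW i : size (W i) = s by case: (gW i).
pose d0 : point k := fun=> 0.
pose P i := head d0 (W i).
have nW j i : (j < s)%N -> nth d0 (W i) j = P (i + j)%N.
  elim: j i => [|j IH] i js; first by rewrite addn0 nth0.
  rewrite -addSnnS -IH ?(ltnW js) // /W iterS -/(W i) nth_rcons nth_behead size_behead sW.
  by rewrite ifT //; have := s_gt0 ell; lia.
have segW i : seg (shift i P) s = W i.
  apply: (@eq_from_nth _ d0); rewrite size_seg ?sW // => j js.
  by rewrite nth_mkseq // nW.
exists P; last by rewrite -[P]shift0 segW.
split=> [i|i j].
  have := gW i; case=> sz + _; rewrite /P; case: (W i) sz => [/esym sz|p qs _ /andP[] //].
  by have := s_gt0 ell; rewrite sz.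
rewrite segS shift_shift addn1 segW /W iterS -/(W i) -[shift i P 0%N]/(P (i + 0)%N) addn0.
have [/(_ j) <- _] := Hn _ (gW i).
by rewrite /P; case: (W i) (sW i) => [sz|p qs]; first by have := s_gt0 ell; rewrite -sz.
Qed.

(** The last [s] points form a singular window, since the point before them is a kernel row; the
    others are prepended to the chain through that window. *)
Lemma chain_ext ps : (s < size ps)%N -> all (@nzp k) ps ->
  (forall i, (i + r <= size ps)%N -> forall j : 'I_k, ev (take r (drop i ps)) (rel j) = 0) ->
  exists2 P, chain P & seg P (size ps) = ps.
Proof.
elim: ps => [//|p ps IH] sp /andP[np nps] H.
have [P cP sP] : exists2 P, chain P & seg P (size ps) = ps.
  have [sps|] := ltnP s (size ps).
    by apply: IH => // i ir j; apply: (H i.+1).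
  move=> ps_s; have e : size ps = s by apply/eqP; rewrite eqn_leq ps_s.
  rewrite e; apply: chain_window => //; apply: (det_relmx_cons np) => j.
  by have := H 0%N sp j; rewrite drop0 take_oversize //= e.
exists (fun i => if i is i'.+1 then P i' else p); last by rewrite segS -[in RHS]sP.
apply: chain_cons => // j; have := H 0%N sp j; rewrite drop0 /= -[in take _ _]sP.
by rewrite -(subnK (sp : (s <= size ps)%N)) addnC seg_cat take_size_cat // size_seg.
Qed.

(** Left multiplication by [u] maps [A / l1 A], shifted by [s], to [A / l A]: [step_rel] makes it
    well defined, and by [step_decomp] its cokernel is at most one-dimensional in each degree,
    detected by evaluation along [P]. *)
Record step P l u l1 : Prop := Step {
  step_hom : hom 1 l; step_neq0 : l != 0;
  step_hom1 : hom 1 l1; step_neq01 : l1 != 0; step_homu : hom s%:Z u;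
  step_rel : exists2 a, hom s%:Z a & Id (u * l1 - l * a);
  step_decomp : forall (n : nat) v, hom n%:Z v -> ev (seg P n) v = 0 ->
    exists a b, [/\ hom (n%:Z - 1) a, hom (n%:Z - s%:Z) b & Id (v - (l * a + u * b))] }.

(** The window [seg P s] is singular because [P] continues; a kernel row gives a combination of
    relations killed by contraction, hence of the form [l * a + u * l1]. If [l1] were zero, the
    combination would be divisible by [l], against [rel_indecomp]. *)
Lemma step_exists P l : chain P -> hom 1 l -> l != 0 -> ev [:: P 0%N] l = 0 ->
  exists u l1, step P l u l1.
Proof.
move=> cP hl l0 lP.
have [u hu Hu] := line_decomp ell cP.1 hl l0 lP.
have /eqP/det0P[c c0 cM] : \det (relmx (seg P s)) = 0.
  by apply: det_relmx_rcons (cP.1 s) _ => j; rewrite -segSr; apply: (cP.2 0%N).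
pose t := \sum_(j < k) c 0 j *: rel j.
have ht : hom r%:Z t by apply: hom_sum => j; apply/homZ/rh.
have ct : ctrs (seg P s) t = 0.
  rewrite linear_sum /=; under eq_bigr => j _ do rewrite linearZ /= ctrs_rel ?size_seg // scaler_sumr.
  rewrite exchange_big big1 //= => l' _.
  under eq_bigr => j _ do rewrite scalerA.
  rewrite -scaler_suml; move/rowP/(_ l'): cM; rewrite !mxE => ->; exact: scale0r.
have et : ev (seg P r) t = 0.
  by rewrite ev_sum big1 // => j _; rewrite evZ (cP.2 0%N) mulr0.
have [a [b [ha hb tab]]] := Hu _ _ ht ct et.
have {}ha : hom s%:Z a by apply: homE ha _; lia.
have {}hb : hom 1 b by apply: homE hb _; lia.
exists u, b; split=> // [||n v hv v0].
- apply: contra_neq c0 => b0; apply/rowP => j; rewrite mxE.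
  by apply: (rel_indecomp ell hl ha _ j); rewrite -/t tab b0 mulr0 addr0.
- exists (- a); first by rewrite -[- a]add0r; apply: homB => //; apply: hom0.
  rewrite mulrN opprK addrC -tab; apply: Id_sum => j; exact/IdZ/Id_rel.
have [z [Iz hz cz]] := ev_zero_mod_ideal cP hv v0.
have [|a' [b' [ha' hb' E]]] := Hu n _ (homB hv hz) cz.
  by rewrite evB v0 (ev_idl cP) // subrr.
by exists a', b'; split=> //; rewrite -E opprB addrC subrK.
Qed.

Lemma chain_through l : hom 1 l -> l != 0 -> exists2 P, chain P & ev [:: P 0%N] l = 0.
Proof.
move=> hl l0; have [p [ps [sp np dp lp]]] := line_meets ell hl l0.
have [P cP sP] := chain_window sp np dp; exists P => //.
by move: sP; rewrite -sp /= segS => -[->].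
Qed.

End Geometry.

(** * Numerical Hilbert functions *)

Section Numerics.
Variable s : nat.

(* The Hilbert functions of [A / l A] and of [A]. *)
Definition lam (d : int) : nat := if d is Posz n then (n %/ s).+1 else 0%N.
Definition hilb (d : int) : nat := if d is Posz n then (\sum_(i < n.+1) lam i)%N else 0%N.

Lemma hilb_lam d : hilb d = (hilb (d - 1) + lam d)%N.
Proof.
case: d => [[|n]|n] //; first by rewrite /hilb /= big_ord_recl big_ord0 addn0.
have -> : n.+1%:Z - 1 = n%:Z by lia.
by rewrite /hilb big_ord_recr.
Qed.

Lemma lam_step d : (0 < s)%N -> 0 <= d -> lam d = (lam (d - s%:Z)).+1.
Proof.
move=> s0; case: d => [n|n] // _; have [sn|ns] := leqP s n.
  rewrite (_ : n%:Z - s%:Z = (n - s)%N%:Z) /=; last by lia.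
  by rewrite -{1}(subnK sn) divnDr // divnn s0 addn1.
rewrite /lam divn_small // (_ : n%:Z - s%:Z = Negz (s - n).-1) //; lia.
Qed.

End Numerics.

(** The coefficient of [t^d] in [H(t) (1 - k t + k t^r - t^(r+1)) = 1] with [r = s + 1], the Euler
    characteristic of the complex in [syzygy_count]. In small degrees some arguments are negative,
    hence the separate cases. *)
Lemma hilb_rec k s d : (k, s) = (3, 1)%N \/ (k, s) = (2, 2)%N -> 0 < d ->
  (hilb s (d - s.+1%:Z - 1) + k * hilb s (d - 1) = k * hilb s (d - s.+1%:Z) + hilb s d)%N.
Proof.
move=> + d0; have [->|[->|[->|d3]]] : d = 1 \/ d = 2 \/ d = 3 \/ 4 <= d by lia.
- by case=> [] [-> ->] /=; rewrite !big_ord_recl !big_ord0.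
- by case=> [] [-> ->] /=; rewrite !big_ord_recl !big_ord0.
- by case=> [] [-> ->] /=; rewrite !big_ord_recl !big_ord0.
case: d d3 {d0} => // -[|[|[|[|n]]]] // _.
case=> -[-> ->].
- have -> : n.+4%:Z - 2%:Z - 1 = n.+1%:Z by lia.
  have -> : n.+4%:Z - 1 = n.+3%:Z by lia.
  have -> : n.+4%:Z - 2%:Z = n.+2%:Z by lia.
  rewrite /hilb !big_ord_recr /lam /= !divn1; lia.
- have -> : n.+4%:Z - 3%:Z - 1 = n%:Z by lia.
  have -> : n.+4%:Z - 1 = n.+3%:Z by lia.
  have -> : n.+4%:Z - 3%:Z = n.+1%:Z by lia.
  rewrite /hilb !big_ord_recr /lam /=; lia.
Qed.

(** * Hilbert function *)

Section Hilbert.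
Variables (k s : nat) (rl : seq (fa k)).
Implicit Types (u v l : fser k) (P : nat -> point k) (d : int).
Notation r := s.+1.
Notation rel n := (nth (@fa0 k) rl n : fser k).
Notation Id := (idl rl).
Hypothesis ell : elliptic s rl.
Hypothesis ks : (k, s) = (3, 1)%N \/ (k, s) = (2, 2)%N.
Let rh := rel_hom ell.
Let sP := @Id_subspace k rl.
Notation lam := (lam s).
Notation hilb := (hilb s).

Lemma hom_qdim (P : fser k -> Prop) d : subspace P -> exists n, qdim (hom d) P n.
Proof.
move=> subP; case: d => d.
  apply: (@qdim_exists _ _ (hom d%:Z) P _
    (fun v => \row_(j < #|{: d.-tuple 'I_k}|) v (tval (enum_val j)))) => //.
  - by move=> a u v; apply/rowP => j; rewrite !mxE.
  - exact: hom_subspace.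
  - move=> v hv /rowP H; rewrite (hom_span hv) big1; first by case: subP.
    move=> t _; by have := H (enum_rank t); rewrite !mxE enum_rankK => ->; rewrite scale0r.
  move=> w; exists (\sum_(t : d.-tuple 'I_k) w 0 (enum_rank t) *: wd t).
    by apply: hom_sum => t; apply: homZ; apply: homE (hom_wd _) _; rewrite size_tuple.
  apply/rowP => j; rewrite mxE fser_sum (bigD1 (enum_val j)) //= enum_valK fserZ.
  rewrite /wd /fa_word eqxx mulr1 big1 ?addr0 // => t tj.
  rewrite fserZ; case: eqP => [e|]; last by rewrite mulr0.
  by case/eqP: tj; apply/val_inj.
apply: (@qdim_exists _ _ (hom (Negz d)) P 0 (fun v => 0)) => //.
- by move=> a u v; rewrite scaler0 addr0.
- exact: hom_subspace.
- by move=> v hv _; rewrite (hom_neg hv) //; case: subP.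
by move=> w; exists 0; [apply: hom0 | apply/rowP => -[]].
Qed.

Definition lineI l d v := exists2 a, hom (d - 1) a & Id (v - l * a).

Lemma lineI_subspace l d : subspace (lineI l d).
Proof.
split; first by exists 0; [apply: hom0 | rewrite mulr0 subrr; apply: Id0].
move=> c u v [a ha Ia] [b hb Ib]; exists (c *: a + b); first by apply/homD/hb/homZ.
by rewrite mulrDr -scalerAr opprD addrACA -scalerBr; apply/IdD/Ib/IdZ.
Qed.

Lemma Id_lineI l d v : Id v -> lineI l d v.
Proof. by exists 0; [apply: hom0 | rewrite mulr0 subr0]. Qed.

Lemma mul_linear u : linear (fun v : fser k => u * v).
Proof. by move=> a v w; rewrite mulrDr -scalerAr. Qed.

Lemma homMd d e u v : hom d u -> hom (e - d) v -> hom e (u * v).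
Proof. by move=> hu hv; apply: homE (homM hu hv) _; lia. Qed.

Lemma step_lineI P l u l1 d v : step s rl P l u l1 -> lineI l1 (d - s%:Z) v -> lineI l d (u * v).
Proof.
case=> hl l0 h1 l10 hu [a0 ha0 I0] _ [a ha Ia].
exists (a0 * a); first by apply: homMd ha0 _; apply: homE ha _; lia.
have -> : u * v - l * (a0 * a) = u * (v - l1 * a) + (u * l1 - l * a0) * a.
  by rewrite mulrBr mulrBl !mulrA addrA subrK.
by apply: IdD; [apply: Id_homl hu Ia | apply: Id_homr ha I0].
Qed.

(** [exact_count] with the single functional [ev (seg P d)], which accounts for the cokernel. *)
Lemma step_count P l u l1 d n n1 w (g : 'I_w -> fser k) : step s rl P l u l1 -> 0 <= d ->
  qdim (hom d) (lineI l d) n -> qdim (hom (d - s%:Z)) (lineI l1 (d - s%:Z)) n1 ->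
  (forall i, hom (d - s%:Z) (g i)) -> indep (lineI l1 (d - s%:Z)) g ->
  (forall i, lineI l d (u * g i)) -> (w + n <= n1 + 1)%N.
Proof.
move=> st d0 qd qd1 hg ig lg; have [hl l0 h1 l10 hu _ dec] := st.
apply: (exact_count (f := fun v => u * v) (J := fun v => \row_(_ < 1) ev (seg P `|d|%N) v)
  (hom_subspace _ _) (hom_subspace _ d) qd1 qd _ _ _ _ _ hg ig lg) => //.
- exact: mul_linear.
- by move=> a v w'; apply/rowP => j; rewrite !mxE ev_linear.
- by move=> v; apply: homMd.
- by move=> v _; apply: step_lineI st.
move=> v hv /rowP/(_ 0); rewrite !mxE => v0.
have [|a [b [ha hb Iab]]] := dec `|d|%N v _ v0; first by apply: homE hv _; lia.
exists b; first by apply: homE hb _; lia.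
by exists a; [apply: homE ha _; lia | rewrite -addrA -opprD [u * b + _]addrC].
Qed.

(** A step leads from [l] to another linear form, so the induction on the degree runs over all
    linear forms at once. *)
Lemma line_dim_le l d n : hom 1 l -> l != 0 -> qdim (hom d) (lineI l d) n -> (n <= lam d)%N.
Proof.
have [m] : exists m : nat, d < m%:Z by exists (`|d|.+1)%N; lia.
elim: m d l n => [|m IH] d l n dm hl l0 qd.
  rewrite (qdim0 (hom_subspace _ d) _ qd) // => v hv; rewrite (hom_neg hv dm).
  by apply/Id_lineI/Id0.
have [dn|d0] := ltrP d 0; first by apply: IH qd => //; lia.
have [P cP Pl] := chain_through ell hl l0.
have [u [l1 st]] := step_exists ell cP hl l0 Pl.
have [n1 qd1] := hom_qdim (d - s%:Z) (lineI_subspace l1 (d - s%:Z)).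
have s0 := s_gt0 ell.
have l1n1 : (n1 <= lam (d - s%:Z))%N.
  by case: st => _ _ h1 l10 _ _ _; apply: IH qd1 => //; lia.
rewrite lam_step // -addn1; apply: leq_trans (_ : n1 + 1 <= _)%N; last by rewrite leq_add2r.
by apply: (@step_count P l u l1 d n n1 0 (fun i => 0) st d0 qd qd1) => [[]//|c _ []//|[]//].
Qed.

Lemma ideal_count l d n n' w (g : 'I_w -> fser k) : hom 1 l -> l != 0 ->
  qdim (hom d) Id n -> qdim (hom (d - 1)) Id n' ->
  (forall i, hom (d - 1) (g i)) -> indep Id g -> (forall i, Id (l * g i)) ->
  exists2 z, qdim (hom d) (lineI l d) z & (w + n <= n' + z)%N.
Proof.
move=> hl l0 qd qd' hg ig Ig; have [z qz] := hom_qdim d (lineI_subspace l d).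
exists z => //; case: (qz) => J lJ [kJ _].
apply: (exact_count (f := fun v => l * v) (J := J) (hom_subspace _ _) (hom_subspace _ d) qd' qd _ _ _ _ _ hg ig Ig) => //.
- exact: mul_linear.
- by move=> v; apply: homMd.
- by move=> v _; apply: Id_homl hl.
by move=> v hv /kJ -/(_ hv)[a ha Ia]; exists a.
Qed.

Lemma ideal_count0 l d n n' : hom 1 l -> l != 0 ->
  qdim (hom d) Id n -> qdim (hom (d - 1)) Id n' ->
  exists2 z, qdim (hom d) (lineI l d) z & (n <= n' + z)%N.
Proof.
move=> hl l0 qd qd'; have e (T : 'I_0 -> Prop) i : T i by case: i.
have i0 : indep Id (fun _ : 'I_0 => 0) by move=> c _; apply: e.
exact: (@ideal_count l d n n' 0 (fun=> 0) hl l0 qd qd' (e _) i0 (e _)).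
Qed.

(** The bound [lam d] on [A / l A] is exactly the increment of [hilb], so the count leaves no room
    for a kernel. *)
Lemma regular_from_dim l d v : hom 1 l -> l != 0 ->
  qdim (hom d) Id (hilb d) -> qdim (hom (d - 1)) Id (hilb (d - 1)) ->
  hom (d - 1) v -> Id (l * v) -> Id v.
Proof.
move=> hl l0 qd qd' hv Iv; apply: contrapT => nI.
have [z qz] := @ideal_count l d _ _ 1 (fun=> v) hl l0 qd qd' (fun=> hv) (indep1 sP nI) (fun=> Iv).
rewrite hilb_lam; have := line_dim_le hl l0 qz; lia.
Qed.

Lemma k_gt0 : (0 < k)%N. Proof. by case: ks => -[-> _]. Qed.

Lemma x_neq0 (i : 'I_k) : x i != 0 :> fser k.
Proof.
apply/eqP => /(congr1 (fun p : fser k => p [:: i])); rewrite /wd /fa_word eqxx fser0.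
by move/eqP; rewrite oner_eq0.
Qed.

Lemma qdim_tuple d (n : nat) : qdim (hom d) Id n ->
  qdim (fun v : {ffun 'I_k -> fser k} => forall j, hom d (v j))
       (fun v : {ffun 'I_k -> fser k} => forall j, Id (v j)) (k * n)%N.
Proof.
move=> qd; have -> : (k * n = \sum_(j < k) n)%N by rewrite sum_nat_const card_ord.
apply: (@qdim_family _ _ _ _ _ _ (fun (j : 'I_k) (v : {ffun 'I_k -> fser k}) => v j)
  (fun=> hom d) (fun=> Id) (fun=> n)) => //.
- by move=> j a u v; rewrite !ffunE.
by move=> F hF; exists (finfun F) => [j|j]; rewrite ffunE.
Qed.

(** Count in degree [d] for the complex [A(-r-1) -> A(-r)^k -> A(-1)^k -> A], with middle map the
    matrix [lder i (rel j)] and outer maps given by the generators. Exactness at [A(-1)^k] is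
    [Id_lder]; the last hypothesis gives injectivity on the left. *)
Lemma syzygy_count d n n1 nr w (b : 'I_w -> fser k) : 0 < d ->
  qdim (hom d) Id n -> qdim (hom (d - 1)) Id n1 -> qdim (hom (d - r%:Z)) Id nr ->
  (forall i, hom (d - r%:Z - 1) (b i)) -> indep Id b ->
  (forall j v, hom (d - r%:Z - 1) v -> Id (x j * v) -> Id v) ->
  (w + k * n1 <= k * nr + n)%N.
Proof.
move=> d0 [pi lpi [kpi _]] q1 qr hb ib inj.
pose E := {ffun 'I_k -> fser k}.
pose Q e (v : E) := forall j, hom e (v j).
pose PE (v : E) := forall j, Id (v j).
have subQ e : subspace (Q e).
  split=> [j|a u v hu hv j]; first by rewrite ffunE; apply: hom0.
  by rewrite !ffunE; apply: homD (hv j); apply: homZ.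
pose f (t : E) : E := [ffun i => \sum_(j < k) lder i (rel j) * t j].
pose J (v : E) := pi (\sum_i x i * v i).
apply: (@exact_count _ E E (Q (d - r%:Z)) PE (Q (d - 1)) PE _ _ _ _ f J
  (fun i => [ffun j => x j * b i])) => //.
- exact: qdim_tuple.
- exact: qdim_tuple.
- move=> a u v; apply/ffunP => i; rewrite !ffunE scaler_sumr -big_split /=.
  by apply: eq_bigr => j _; rewrite !ffunE mulrDr -scalerAr.
- move=> a u v; rewrite /J -lpi scaler_sumr -big_split; congr pi.
  by apply: eq_bigr => j _; rewrite !ffunE mulrDr -scalerAr.
- move=> t ht i; rewrite ffunE; apply: hom_sum => j.
  by apply: homMd (hom_lder i (rh j)) _; apply: homE (ht j) _; lia.
- move=> t _ It i; rewrite ffunE; apply: Id_sum => j.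
  exact: Id_homl (hom_lder i (rh j)) (It j).
- move=> v hv Jv; pose p := \sum_i x i * v i.
  have hp : hom d p by apply: hom_sum => i; apply: homMd (hom_wd _) _; apply: homE (hv i) _.
  have Ip : Id p by apply/kpi.
  have [t [ht It]] := Id_lder rh isT (rel_size ell) Ip hp.
  exists (finfun t) => [j|i]; first by rewrite ffunE.
  rewrite !ffunE; under eq_bigr => j _ do rewrite ffunE.
  have := It i; rewrite {1}/p linear_sum (bigD1 i) //= lder_xM eqxx mul1r big1 ?addr0 // => j ji.
  by rewrite lder_xM eq_sym (negPf ji) mul0r.
- by move=> i j; rewrite ffunE; apply: homMd (hom_wd _) _; apply: homE (hb i) _; rewrite /=; lia.
- move=> c Pc; apply: ib; apply: (inj (Ordinal k_gt0)).
    by apply: hom_sum => i; apply: homZ.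
  have := Pc (Ordinal k_gt0); rewrite sum_ffunE mulr_sumr; congr Id.
  by apply: eq_bigr => i _; rewrite !ffunE -scalerAr.
move=> i a; rewrite ffunE.
under eq_bigr => j _ do rewrite ffunE mulrA.
rewrite -mulr_suml (lder_rel_sum ell); apply: Id_homr (hb i) _; exact: Id_rel.
Qed.

(** The upper bound is [hilb (d - 1) + lam d]. The lower bound asks for regularity of generators in
    degree [d - r - 1] only, where the induction hypothesis supplies it through
    [regular_from_dim]. *)
Theorem hilbert d : qdim (hom d) Id (hilb d).
Proof.
have [m] : exists m : nat, d < m%:Z by exists (`|d|.+1)%N; lia.
elim: m d => [|m IH] d dm.
  have [n qn] := hom_qdim d sP.
  have n0 : n = 0%N.
    apply: qdim0 (hom_subspace _ _) _ qn => v hv; rewrite (hom_neg hv) //; exact: Id0.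
  by move: dm qn; rewrite n0; case: d.
have [dn|d0] := ltrP d 0; first by apply: IH; lia.
have [n qn] := hom_qdim d sP.
have q1 : qdim (hom (d - 1)) Id (hilb (d - 1)) by apply: IH; lia.
pose i0 := Ordinal k_gt0; have hx i : hom 1 (x i : fser k) by apply: (hom_wd [:: i]).
have up : (n <= hilb d)%N.
  have [z qz] := ideal_count0 (hx i0) (x_neq0 i0) qn q1.
  by rewrite (hilb_lam s d) => H; apply: leq_trans H _; rewrite leq_add2l (line_dim_le _ _ qz) ?x_neq0.
suff lo : (hilb d <= n)%N by rewrite (_ : hilb d = n) //; apply/eqP; rewrite eqn_leq lo up.
have [d1|] := ltrP 0 d; last first.
  move=> d0'; have {d0 d0'} dE : d = 0 by lia.
  rewrite dE /= big_ord_recl big_ord0 addn0 div0n lt0n; apply/eqP => n0.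
  move: qn; rewrite n0 dE => -[pi _ [kpi _]].
  have /(Id_nil rh isT)/eqP : Id 1 by apply/(kpi _ (hom1 k)); apply/rowP => -[].
  by rewrite fser1_nil oner_eq0.
have qr : qdim (hom (d - r%:Z)) Id (hilb (d - r%:Z)) by apply: IH; lia.
have qr1 : qdim (hom (d - r%:Z - 1)) Id (hilb (d - r%:Z - 1)) by apply: IH; lia.
have [b ib hb] := qdim_indep qr1 (hom_subspace _ _).
have := syzygy_count d1 qn q1 qr hb ib; rewrite (hilb_rec ks d1) => H.
rewrite -(leq_add2l (k * hilb (d - r%:Z))); apply: H => j v hv.
exact: (regular_from_dim (hx j) (x_neq0 j) qr qr1 hv).
Qed.

Lemma line_regular l d v : hom 1 l -> l != 0 -> hom d v -> Id (l * v) -> Id v.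
Proof.
move=> hl l0 hv; apply: (@regular_from_dim l (d + 1)) => //; try exact: hilbert.
by rewrite addrK.
Qed.

Lemma line_dim l d : hom 1 l -> l != 0 -> qdim (hom d) (lineI l d) (lam d).
Proof.
move=> hl l0.
have [z qz] := ideal_count0 hl l0 (hilbert d) (hilbert (d - 1)).
rewrite hilb_lam leq_add2l => lz.
by rewrite (_ : lam d = z) //; apply/eqP; rewrite eqn_leq lz (line_dim_le _ _ qz).
Qed.

(** A kernel element would sharpen [step_count] to [1 + lam (d + s) <= lam d + 1], whereas
    [lam (d + s) = lam d + 1]. *)
Lemma step_exact P l u l1 d v : step s rl P l u l1 -> hom d v ->
  lineI l (d + s%:Z) (u * v) -> lineI l1 d v.
Proof.
move=> st hv Lv; have [d0|dn] := lerP 0 d; last first.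
  by rewrite (hom_neg hv dn); apply/Id_lineI/Id0.
apply: contrapT => nL.
have e : d + s%:Z - s%:Z = d by rewrite addrK.
have [hl l0 h1 l10 _ _ _] := st.
have := @step_count P l u l1 (d + s%:Z) _ _ 1 (fun=> v) st _ (line_dim _ hl l0)
  (line_dim _ h1 l10); rewrite e => /(_ _ (fun=> hv) (indep1 (lineI_subspace _ _) nL) (fun=> Lv)).
rewrite lam_step ?(s_gt0 ell) //; last by lia.
by rewrite e => /(_ _); lia.
Qed.

End Hilbert.

(** Since [ring] needs commutativity, products are expanded into noncommutative monomials and
    coefficients at an arbitrary word are compared; [ring] in [C] then sees the monomials as
    atoms. *)
Ltac fser_ring := rewrite ?(mulrDr, mulrDl, mulrBr, mulrBl, mulrN, mulNr, mulrA, mulr1, mul1r);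
  rewrite -?(scalerAl, scalerAr); apply/funext => ?; rewrite ?(fserD, fserN, fserZ, fser0).

(** * Central elements modulo a linear form *)

Section Torsion.
Variables (k s : nat) (rl : seq (fa k)).
Implicit Types (u v l : fser k) (P Q : nat -> point k) (d : int).
Notation r := s.+1.
Notation rel n := (nth (@fa0 k) rl n : fser k).
Notation Id := (idl rl).
Hypothesis ell : elliptic s rl.
Hypothesis ks : (k, s) = (3, 1)%N \/ (k, s) = (2, 2)%N.
Let rh := rel_hom ell.
Notation lineI := (lineI rl).
Notation chain := (chain s rl).

Definition separated P Q := exists y, [/\ hom s%:Z y, ev (seg P s) y = 0 & ev (seg Q s) y <> 0].

Lemma ev_lmul P l n a : hom 1 l -> ev [:: P 0%N] l = 0 -> ev (seg P n.+1) (l * a) = 0.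
Proof.
move=> hl l0; rewrite segS -[_ :: _]/([:: P 0%N] ++ _) /ev ctrs_cat ctrs_mul //.
by rewrite /ev in l0; rewrite /ev l0 scale0r linear0 fser0.
Qed.

Lemma ev_mod P n v w : chain P -> hom n%:Z v -> hom n%:Z w -> Id (v - w) ->
  ev (seg P n) v = ev (seg P n) w.
Proof.
move=> cP hv hw I; apply/eqP; rewrite -subr_eq0 -evB; apply/eqP.
exact: (ev_idl ell cP I (homB hv hw)).
Qed.

(** The separating form vanishes along [P], so it lies in [l A + u A]; along [Q] its [l]-part
    vanishes, hence [u] cannot. *)
Lemma ev_step_neq0 P Q l u l1 : step s rl P l u l1 -> chain Q -> ev [:: Q 0%N] l = 0 ->
  separated P Q -> ev (seg Q s) u <> 0.
Proof.
move=> [hl l0 _ _ hu _ dec] cQ lQ [y [hy yP yQ]] u0; apply: yQ.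
have [a [b [ha hb I]]] := dec s y hy yP.
have {}ha : hom (s%:Z - 1) a by [].
have hla : hom s%:Z (l * a) by apply: homMd ha.
have hub : hom s%:Z (u * b) by apply: homMd hb.
rewrite (ev_mod cQ hy (homD hla hub) I) evD.
have s0 := s_gt0 ell; rewrite -{1}(prednK s0) ev_lmul // add0r.
rewrite -[seg Q s]cats0 ev_mul ?size_seg // u0 mul0r //.
Qed.

(** [u * l1] lies in [l A] and so vanishes along [Q]; thus [Q], shifted by [s], starts on the line
    [l1] and can serve in the next step. *)
Lemma ev_step_next P Q l u l1 : step s rl P l u l1 -> chain Q -> ev [:: Q 0%N] l = 0 ->
  ev (seg Q s) u <> 0 -> ev [:: Q s] l1 = 0.
Proof.
move=> [hl l0 h1 _ hu [a ha I] _] cQ lQ /eqP u0.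
have E : ev (seg Q r) (u * l1) = ev (seg Q r) (l * a).
  by apply: (ev_mod cQ) I; [apply: homMd hu _ | apply: homMd hl _];
     [apply: homE h1 _ | apply: homE ha _]; lia.
move: E; rewrite [RHS]ev_lmul // segSr -cats1 ev_mul ?size_seg // => /eqP.
by rewrite mulf_eq0 (negPf u0) => /eqP.
Qed.

(** Each step consumes one chain: [u] accounts for the vanishing of [v] along [P 0], and the
    cofactor vanishes along the remaining chains shifted by [s]. After [T] steps the cofactor is a
    scalar, and multiplication by [U] is injective as a composite of steps. *)
Lemma tower T (P : nat -> nat -> point k) l v :
  (forall i, (i < T)%N -> chain (P i) /\ ev [:: P i 0%N] l = 0) ->
  (forall i j, (i < j < T)%N -> separated (shift (i * s)%N (P i)) (shift (i * s)%N (P j))) ->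
  hom 1 l -> l != 0 -> hom (T * s)%:Z v -> (forall i, (i < T)%N -> ev (seg (P i) (T * s)) v = 0) ->
  exists U l' a b, [/\ hom (T * s)%:Z U, hom 1 l' /\ l' != 0, hom ((T * s)%:Z - 1) a /\ hom 0 b,
    Id (v - (l * a + U * b)) &
    forall d w, hom d w -> lineI l (d + (T * s)%:Z) (U * w) -> lineI l' d w].
Proof.
elim: T P l v => [|T IH] P l v cP sP hl l0 hv vP.
  exists 1, l, 0, v; split=> //; first exact: hom1.
  - by split=> //; apply: hom0.
  - by rewrite mulr0 add0r mul1r subrr; apply: Id0.
  by move=> d w _; rewrite mul1r addr0.
have [cP0 lP0] := cP 0%N isT.
have [u [l1 st]] := step_exists ell cP0 hl l0 lP0.
have [_ _ h1 l10 hu [a0 ha0 I0] dec] := st.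
have [a [b [ha hb I]]] := dec _ _ hv (vP 0%N isT).
have {}hb : hom (T * s)%:Z b by apply: homE hb _; rewrite mulSn; lia.
have uP i : (i < T)%N -> ev (seg (P i.+1) s) u <> 0.
  move=> iT; have [cPi lPi] := cP i.+1 iT.
  by apply: ev_step_neq0 st cPi lPi _; apply: (sP 0%N i.+1).
have [||||||U [l' [a1 [b1 [hU hl' [ha1 hb1] I1 ex]]]]] := IH (fun i => shift s (P i.+1)) l1 b.
- move=> i iT; have [cPi lPi] := cP i.+1 iT; split; first exact: shift_chain.
  by rewrite /shift addn0; apply: ev_step_next st cPi lPi (uP i iT).
- by move=> i j ij; rewrite !shift_shift -mulSn; apply: (sP i.+1 j.+1).
- exact: h1.
- exact: l10.
- exact: hb.
- move=> i iT; have [cPi lPi] := cP i.+1 iT; have := vP i.+1 iT.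
  rewrite (ev_mod cPi hv _ I); last first.
    apply: homD; first by apply: homMd ha.
    by apply: homMd hu _; apply: homE hb _; rewrite mulSn; lia.
  rewrite evD mulSn; have s0 := s_gt0 ell; rewrite -{1}(prednK s0) addSn ev_lmul // add0r.
  rewrite seg_cat ev_mul ?size_seg // => /eqP; rewrite mulf_eq0 => /orP[/eqP/(uP i iT)//|/eqP//].
exists (u * U), l', (a + a0 * a1), b1; split=> //.
- by apply: homMd hu _; apply: homE hU _; rewrite mulSn; lia.
- split=> //; apply: homD; first exact: ha.
  by apply: homMd ha0 _; apply: homE ha1 _; rewrite mulSn; lia.
- have -> : v - (l * (a + a0 * a1) + u * U * b1) =
      (v - (l * a + u * b)) + (u * (b - (l1 * a1 + U * b1)) + (u * l1 - l * a0) * a1).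
    by fser_ring; ring.
  apply: IdD => //; apply: IdD; first exact: Id_homl hu _.
  exact: Id_homr ha1 _.
move=> d w hw L; apply: ex => //; apply: (step_exact ell ks st).
  by apply: homE (homM hU hw) _; rewrite addrC.
rewrite mulrA; move: L; rewrite (_ : d + _ = d + (T * s)%:Z + s%:Z) //.
by rewrite mulSn; lia.
Qed.

Section Central.
Variables (G : nat) (g : fser k).
Hypothesis hg : hom G%:Z g.
Hypothesis gx : forall i : 'I_k, Id (x i * g - g * x i).

Lemma central_wd w : Id (wd w * g - g * wd w).
Proof.
elim: w => [|i w IH]; first by rewrite wd_nil mul1r mulr1 subrr; apply: Id0.
rewrite wd_cons.
have -> : x i * wd w * g - g * (x i * wd w) =
    x i * (wd w * g - g * wd w) + (x i * g - g * x i) * wd w.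
  by rewrite mulrBr mulrBl !mulrA addrA subrK.
by apply: IdD; [apply: Id_wdl | apply: Id_wdr].
Qed.

Lemma central_hom d v : hom d v -> Id (v * g - g * v).
Proof.
case: d => d hv; last by rewrite (hom_neg hv) // mul0r mulr0 subrr; apply: Id0.
rewrite (hom_span hv) mulr_suml mulr_sumr -sumrB; apply: Id_sum => t.
by rewrite -scalerAl -scalerAr -scalerBr; apply/IdZ/central_wd.
Qed.

(** Evaluating [x i * g = g * x i] at [G + 1] points shows that [P 0] times one value of [g] equals
    [P G] times the other. *)
Lemma central_vanish P : chain P -> ~ (exists c, forall i, P G i = c * P 0%N i) ->
  ev (seg P G) g = 0 /\ ev (seg (shift 1 P) G) g = 0.
Proof.
move=> cP np.
have E i : P 0%N i * ev (seg (shift 1 P) G) g = ev (seg P G) g * P G i.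
  have evx p : ev [:: p] (x i : fser k) = p i.
    by rewrite /ev /= -[x i]mulr1 ctr_xM fserZ fser1_nil mulr1.
  transitivity (ev (seg P G.+1) (x i * g)).
    by rewrite segS -[_ :: _]/([:: P 0%N] ++ _) ev_mul ?evx //; apply: (hom_wd [:: i]).
  rewrite (ev_mod cP (w := g * x i)) //.
  - by rewrite segSr -cats1 ev_mul ?size_seg ?evx.
  - by apply: homE (homM (hom_wd [:: i]) hg) _; rewrite /=; lia.
  by apply: homE (homM hg (hom_wd [:: i])) _; rewrite /=; lia.
have e0 : ev (seg P G) g = 0.
  apply/eqP; apply: contra_notT np => e0; exists (ev (seg (shift 1 P) G) g / ev (seg P G) g) => i.
  by rewrite mulrAC [_ * P 0%N i]mulrC E mulrAC mulfV // mul1r.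
split=> //; have /existsP[i Pi] := cP.1 0%N.
by have /eqP := E i; rewrite e0 mul0r mulf_eq0 (negPf Pi) => /eqP.
Qed.

(** Modulo [l A] the tower writes [g] as [U] times a scalar, nonzero because [g] is not in [l A]; so
    left multiplication by [g] from [A / l' A] to [A / l A] is injective. It sends [l] to zero by
    centrality, which makes [l] a multiple of [l'], so the two lines coincide. *)
Lemma line_torsion_free l T (P : nat -> nat -> point k) : G = (T * s)%N ->
  (forall i, (i < T)%N -> chain (P i) /\ ev [:: P i 0%N] l = 0) ->
  (forall i j, (i < j < T)%N -> separated (shift (i * s)%N (P i)) (shift (i * s)%N (P j))) ->
  hom 1 l -> l != 0 -> (forall i, (i < T)%N -> ev (seg (P i) G) g = 0) ->
  ~ lineI l G%:Z g ->
  forall d v, hom d v -> lineI l (d + G%:Z) (v * g) -> lineI l d v.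
Proof.
move=> GT cP sP hl l0 gP ng.
move: (hg) gP ng; rewrite GT => hg' gP ng.
have [U [l' [a [b [hU [hl' l'0] [ha hb] I ex]]]]] := tower cP sP hl l0 hg' gP.
have bE : b = b [::] *: 1 by apply: hom0_scalar.
have b0 : b [::] != 0.
  apply: contra_notN ng => /eqP b0; exists a => //.
  by move: I; rewrite bE b0 scale0r mulr0 addr0.
have exg d v : hom d v -> lineI l (d + G%:Z) (g * v) -> lineI l' d v.
  move=> hv [c hc Ic]; apply: ex => //; rewrite -GT.
  exists ((b [::])^-1 *: (c - a * v)).
    apply: homZ; apply: homB hc _; apply: homMd ha _; apply: homE hv _; rewrite GT; lia.
  have -> : U * v = (b [::])^-1 *: (U * b * v).
    by rewrite {2}bE -scalerAr mulr1 -scalerAl scalerA mulVf // scale1r.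
  rewrite -scalerAr -scalerBr; apply: IdZ.
  have -> : U * b * v - l * (c - a * v) = (g * v - l * c) - (g - (l * a + U * b)) * v.
    by fser_ring; ring.
  by apply: IdB => //; apply: Id_homr hv I.
have [c hc Ic] : lineI l' 1 l.
  apply: exg => //; exists g; first by apply: homE hg _; lia.
  exact: (IdBC (central_hom hl)).
have cE : c = c [::] *: 1 by apply: hom0_scalar.
(* Otherwise [l] would lie in the ideal and, by regularity of [l], so would [1]. *)
have c0 : c [::] != 0.
  apply/eqP => c0; move: Ic; rewrite cE c0 scale0r mulr0 subr0 -[l]mulr1.
  move/(line_regular ell ks hl l0 (hom1 k))/(Id_nil rh isT)/eqP.
  by rewrite fser1_nil oner_eq0.
move=> d v hv [e he Ie].
have [w hw Iw] : lineI l' d v.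
  apply: exg => //; exists e; first by rewrite GT.
  by apply: (IdBD _ Ie); exact: (IdBC (central_hom hv)).
exists ((c [::])^-1 *: w); first exact: homZ.
have -> : v - l * ((c [::])^-1 *: w) =
    (v - l' * w) - (c [::])^-1 *: ((l - l' * c) * w).
  have -> : l' * w = (c [::])^-1 *: (l' * c * w).
    by rewrite {2}cE -scalerAr mulr1 -scalerAl scalerA mulVf // scale1r.
  by fser_ring; ring.
by apply: IdB => //; apply/IdZ/(Id_homr hw).
Qed.

(** [l * (l * h - h * l)] is zero modulo the ideal because [g] is central, and [l] is left regular.
    With [l] on either side, a chain constrains [h] from both ends. *)
Lemma central_cofactor l : hom 1 l -> l != 0 -> lineI l G%:Z g ->
  exists h, [/\ hom (G%:Z - 1) h, Id (g - l * h) & Id (g - h * l)].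
Proof.
move=> hl l0 [h hh Ih]; exists h; split=> //.
apply: (IdBD Ih); apply: (line_regular ell ks hl l0 (d := G%:Z)).
  by apply: homB; [apply: homMd hl _ | apply: homMd hh _; apply: homE hl _; lia].
have -> : l * (l * h - h * l) = (l * g - g * l) - l * (g - l * h) + (g - l * h) * l.
  by fser_ring; ring.
apply: IdD; last exact: (Id_homr hl Ih).
by apply: IdB; [exact: (central_hom hl) | exact: (Id_homl hl Ih)].
Qed.

Section Powers.
Variable l : fser k.
Hypothesis hl : hom 1 l.

Lemma hom_exp n : hom n%:Z (l ^+ n).
Proof.
elim: n => [|n IH]; first by rewrite expr0; apply: hom1.
by rewrite exprS; apply: homE (homM hl IH) _; lia.
Qed.

Hypothesis l0 : l != 0.

Lemma pow_regular_hom n d v : hom d v -> Id (l ^+ n * v) -> Id v.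
Proof.
elim: n d v => [|n IH] d v hv; first by rewrite expr0 mul1r.
rewrite exprS -mulrA => /(line_regular ell ks hl l0 (homM (hom_exp n) hv)); exact: (IH d v hv).
Qed.

Lemma pow_regular n v : fa_fin v -> Id (l ^+ n * v) -> Id v.
Proof.
move=> fv I; apply: Id_hcompP => // d; apply: (pow_regular_hom (n := n) (hom_hcomp d%:Z v)).
have := Id_hcomp rh (n%:Z + d%:Z) I; rewrite (hcomp_mull _ _ (hom_exp n)).
by rewrite [n%:Z + _]addrC addrK.
Qed.

Hypothesis tf : forall d v, hom d v -> lineI l (d + G%:Z) (v * g) -> lineI l d v.

(** Torsion freeness of [A / l A] splits one factor [l] off [v], and left regularity cancels it. *)
Lemma pow_torsion_hom n d v a : hom d v -> hom (d + G%:Z - n%:Z) a -> Id (v * g - l ^+ n * a) ->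
  exists2 b, hom (d - n%:Z) b & Id (v - l ^+ n * b).
Proof.
elim: n d v a => [|n IH] d v a hv ha I.
  exists v; first by rewrite subr0.
  by rewrite expr0 mul1r subrr; apply: Id0.
have hla : hom (d + G%:Z - 1) (l ^+ n * a).
  by apply: homMd (hom_exp n) _; apply: homE ha _; lia.
have [w hw Iw] : lineI l d v.
  by apply: tf => //; exists (l ^+ n * a) => //; rewrite mulrA -exprS.
have [b hb Ib] : exists2 b, hom (d - 1 - n%:Z) b & Id (w - l ^+ n * b).
  apply: (IH _ _ a) => //; first by apply: homE ha _; lia.
  apply: (line_regular ell ks hl l0 (d := d + G%:Z - 1)).
    by apply: homB hla; apply: homMd hw _; apply: homE hg _; lia.
  have -> : l * (w * g - l ^+ n * a) = (v * g - l ^+ n.+1 * a) - (v - l * w) * g.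
    by rewrite exprS; fser_ring; ring.
  by apply: IdB => //; apply: Id_homr hg Iw.
exists b; first by apply: homE hb _; lia.
have -> : v - l ^+ n.+1 * b = (v - l * w) + l * (w - l ^+ n * b).
  by rewrite exprS; fser_ring; ring.
by apply: IdD => //; apply: Id_homl hl Ib.
Qed.

Lemma pow_torsion n v a : fa_fin v -> fa_fin a -> Id (v * g - l ^+ n * a) ->
  exists2 b, fa_fin b & Id (v - l ^+ n * b).
Proof.
move=> /fin_hcomp[B vE] fa I.
have comp (d : nat) : exists b : fser k, fa_fin b /\ Id (hcomp d%:Z v - l ^+ n * b).
  have [|||b hb Ib] := @pow_torsion_hom n d%:Z (hcomp d%:Z v) (hcomp (d%:Z + G%:Z - n%:Z) a).
  - exact: hom_hcomp.
  - exact: hom_hcomp.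
  - have := Id_hcomp rh (d%:Z + G%:Z) I.
    by rewrite linearB /= (hcomp_mulr _ _ hg) (hcomp_mull _ _ (hom_exp n)) addrK.
  by exists b; split=> //; apply: hom_fin hb.
move: comp => /choice[b Hb]; exists (\sum_(d < B) b d).
  by apply: fin_sum => d; case: (Hb d).
rewrite {1}vE mulr_sumr -sumrB; apply: Id_sum => d; by case: (Hb d).
Qed.

End Powers.
End Central.
End Torsion.

(** * Linear algebra, roots in [C] and linear forms in three variables *)

Lemma minor2_eq (K : fieldType) m n (M : 'M[K]_(m, n)) : (\rank M < 2)%N ->
  forall i i' j j', M i j * M i' j' = M i j' * M i' j.
Proof.
rewrite -[in X in _ -> X](mulmx_base M).
move: (\rank M) (col_base M) (row_base M) => [|[|//]] A B _ i i' j j'; rewrite !mxE.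
  by rewrite !big_ord0.
by rewrite !big_ord1; ring.
Qed.

Lemma monic_root (n : nat) (P : nat -> C) : (0 < n)%N ->
  exists t : C, t ^+ n = \sum_(i < n) P i * t ^+ i.
Proof. exact: (@solve_monicpoly (Rdefinitions.R[i] : closedFieldType)). Qed.

Lemma natr_neq0 (n : nat) : (0 < n)%N -> n%:R != 0 :> C.
Proof. by case: n => // n _; exact: (negbT (@pnatr_eq0 (Rdefinitions.R[i] : numDomainType) n.+1)). Qed.

Section Hyperplane.
Variable k : nat.

Lemma ev1 (p : point k) (l : fser k) : ev [:: p] l = \sum_i p i * l [:: i].
Proof. by rewrite /ev /= /ctr fser_sum. Qed.

Lemma hom1_neq0 (l : fser k) : hom 1 l -> l != 0 -> exists i, l [:: i] != 0.
Proof.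
move=> hl l0; apply/existsP; apply: contraNT l0; rewrite negb_exists => /forallP H.
rewrite (hom1_sum hl) big1 // => i _; have := H i; rewrite negbK => /eqP ->.
by rewrite scale0r.
Qed.

Lemma hom1_mul_cons (l a : fser k) i w : hom 1 l -> (l * a) (i :: w) = l [:: i] * a w.
Proof.
move=> hl; rewrite -[LHS]/(lder i (l * a) w) lderM (hom_nil hl) // scale0r add0r.
by rewrite (hom0_scalar (hom_lder i hl)) -scalerAl mul1r fserZ.
Qed.

End Hyperplane.

(** The linear forms vanishing at [p] form a plane; [m'] spans a complement of [m] in it. *)
Lemma perp3_span (p : 'cV[C]_3) (m : 'rV[C]_3) : p != 0 -> m != 0 -> m *m p = 0 ->
  exists m' : 'rV[C]_3, (kermx p <= m + m')%MS.
Proof.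
move=> p0 m0 mp; pose W := (kermx p :\: m)%MS; exists (nz_row W).
have mk : (m <= kermx p)%MS by apply/sub_kermxP.
have rp : \rank p = 1%N.
  by apply/eqP; rewrite eqn_leq rank_leq_col lt0n mxrank_eq0.
have rm : \rank m = 1%N.
  by apply/eqP; rewrite eqn_leq rank_leq_row lt0n mxrank_eq0.
have cap : (kermx p :&: m :=: m)%MS by apply/capmx_idPr.
have rW : \rank W = 1%N.
  have := mxrank_cap_compl (kermx p) m.
  by rewrite cap rm mxrank_ker rp -/W => -[].
have Wn : (W <= nz_row W)%MS.
  rewrite -(mxrank_leqif_sup (nz_row_sub W)) rW eqn_leq rank_leq_row lt0n mxrank_eq0.
  by rewrite nz_row_eq0 -mxrank_eq0 rW.
rewrite -(addsmx_diff_cap_eq (kermx p) m) addsmxC.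
by apply: addsmxS => //; rewrite cap.
Qed.

(** [u] is a second linear form through [p], so [x i] is [p i] times the fixed form [x a / p a] plus
    a combination of [l] and [u]. In the expansion of [y] by first letters the fixed form is
    multiplied by [ctr p y], which is zero. *)
Lemma line_decomp3 (P : nat -> point 3) (l : fser 3) : (forall i, nzp (P i)) ->
  hom 1 l -> l != 0 -> ev [:: P 0%N] l = 0 ->
  exists2 u, hom 1%:Z u & forall (n : nat) y, hom n%:Z y -> ctrs (seg P 1) y = 0 ->
    ev (seg P n) y = 0 ->
    exists a b, [/\ hom (n%:Z - 1) a, hom (n%:Z - 1%:Z) b & y = l * a + u * b].
Proof.
move=> nP hl l0 lP; set p := P 0%N in lP *; have np : nzp p by apply: nP.
pose m : 'rV[C]_3 := \row_i l [:: i].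
have m0 : m != 0.
  by have [i li] := hom1_neq0 hl l0; apply: contraNneq li => /rowP/(_ i); rewrite !mxE => ->.
have mp : m *m colp p = 0.
  apply/rowP => j; rewrite !mxE -[RHS]lP ev1; apply: eq_bigr => i _.
  by rewrite !mxE mulrC.
have [m' sub] := perp3_span (colp_neq0 np) m0 mp.
pose u : fser 3 := \sum_i m' 0 i *: x i.
have hx i : hom 1 (x i : fser 3) by apply: (hom_wd [:: i]).
have hu : hom 1 u by apply: hom_sum => i; apply/homZ/hx.
exists u => // n y hy cy ey.
(* In degree zero the contraction carries no information; the evaluation forces [y = 0]. *)
case: n hy ey => [|n] hy ey.
  exists 0, 0; split; try exact: hom0.
  rewrite (hom0_scalar hy); move: ey; rewrite /ev /= => ->.
  by rewrite scale0r !mulr0 addr0.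
have /existsP[a pa] := np.
pose th : 'rV[C]_3 := (p a)^-1 *: delta_mx 0 a.
have : (1%:M - colp p *m th <= kermx (colp p))%MS.
  apply/sub_kermxP; rewrite mulmxBl mul1mx -mulmxA -scalemxAl -rowE.
  have -> : (p a)^-1 *: row a (colp p) = 1%:M.
    by apply/matrixP => i j; rewrite !ord1 !mxE eqxx mulVf.
  by rewrite mulmx1 subrr.
move/submx_trans/(_ sub)/sub_addsmxP => [[A B] /= E].
have xE i : x i = p i *: ((p a)^-1 *: x a) + A i 0 *: l + B i 0 *: u :> fser 3.
  rewrite {1}(hom1_sum hl) /u !scaler_sumr.
  rewrite -addrA -big_split /=.
  have -> : x i = p i *: ((p a)^-1 *: x a) + \sum_j (1%:M - colp p *m th) i j *: x j :> fser 3.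
    have NE j : (1%:M - colp p *m th) i j = (i == j)%:R - p i * ((p a)^-1 * (j == a)%:R).
      by rewrite !mxE big_ord1 !mxE eqxx.
    under eq_bigr => j _ do rewrite NE scalerBl.
    rewrite sumrB (bigD1 i) //= eqxx scale1r big1 ?addr0 => [|j ji]; last first.
      by rewrite eq_sym (negPf ji) scale0r.
    rewrite (bigD1 a) //= eqxx mulr1 big1 ?addr0 => [|j ja]; last first.
      by rewrite (negPf ja) mulr0 mulr0 scale0r.
    by rewrite scalerA addrC subrK.
  congr (_ + _); apply: eq_bigr => j _; rewrite E !mxE !big_ord1 !scalerA scalerDl.
  by rewrite !mxE.
exists (\sum_i A i 0 *: lder i y), (\sum_i B i 0 *: lder i y); split.
- by apply: hom_sum => i; apply/homZ/hom_lder.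
- by apply: hom_sum => i; apply/homZ/hom_lder.
rewrite [LHS]fser_decomp (hom_nil hy) // scale0r add0r.
under eq_bigr => i _ do rewrite xE !mulrDl -!scalerAl.
have S0 : \sum_i p i *: ((p a)^-1 *: (x a * lder i y)) = 0.
  transitivity ((p a)^-1 *: (x a * ctr p y)); last by rewrite [ctr p y]cy mulr0 scaler0.
  rewrite /ctr mulr_sumr scaler_sumr; apply: eq_bigr => i _.
  by rewrite -scalerAr !scalerA mulrC.
rewrite !big_split /= S0 add0r !mulr_sumr.
by congr (_ + _); apply: eq_bigr => i _; rewrite scalerAr.
Qed.

(** With [c] read as a point, cyclic invariance identifies [relmx rl [:: c]] with the transposed
    coefficient matrix of the combination; for a product [l * a] its rank is at most one, less than
    [k - 1]. *)
Lemma relmx_indecomp1 k (rl : seq (fa k)) :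
  (forall (i j : 'I_k) w, nth (@fa0 k) rl i (rcons w j) = nth (@fa0 k) rl j (i :: w)) ->
  (1 < k - 1)%N ->
  (forall p, nzp p -> (k - 1 <= \rank (relmx rl [:: p]))%N) ->
  forall (c : 'I_k -> C) (l a : fser k), hom 1 l -> hom 1%:Z a ->
    \sum_(j < k) c j *: (nth (@fa0 k) rl j : fser k) = l * a -> forall j, c j = 0.
Proof.
move=> cyc k2 nd c l a hl ha E j; apply/eqP; apply: contraT => cj.
have /nd : nzp c by apply/existsP; exists j.
have -> : relmx rl [:: c] = (\col_i a [:: i]) *m (\row_i l [:: i]).
  apply/matrixP => i i'; rewrite !mxE big_ord1 !mxE /= /ctr fser_sum.
  have /(congr1 (fun p : fser k => p [:: i'; i])) := E.
  rewrite hom1_mul_cons // fser_sum mulrC => <-; apply: eq_bigr => t _.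
  rewrite !fserZ /lder; congr (_ * _).
  by have := cyc i i' [:: t]; have := cyc i' t [:: i]; rewrite /= => -> ->.
move/leq_trans/(_ (mxrankM_maxl _ _)) => /leq_trans/(_ (rank_leq_col _)).
by rewrite leqNgt k2.
Qed.

Lemma ev2 k (p q : point k) (h : fser k) : ev [:: p; q] h = \sum_i \sum_j p i * q j * h [:: i; j].
Proof.
rewrite /ev /= /ctr fser_sum exchange_big; apply: eq_bigr => j _.
rewrite fserZ /lder fser_sum mulr_sumr; apply: eq_bigr => i _.
by rewrite fserZ mulrCA mulrA.
Qed.

Lemma hom2_ext k (p q : fser k) : hom 2 p -> hom 2 q -> (forall i j, p [:: i; j] = q [:: i; j]) -> p = q.
Proof.
move=> hp hq E; apply/funext => w; have [sw|sw] := eqVneq (size w) 2%N.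
  by case: w sw => [|i [|j []]].
transitivity (0 : C); first by apply/eqP; apply: contraT => /eqP/(hom_size hp) [] /eqP; rewrite (negPf sw).
by apply/esym/eqP; apply: contraT => /eqP/(hom_size hq) [] /eqP; rewrite (negPf sw).
Qed.

Lemma X3E : X3 = Ordinal (isT : (0 < 3)%N). Proof. by apply: val_inj; rewrite /= inordK. Qed.
Lemma Y3E : Y3 = Ordinal (isT : (1 < 3)%N). Proof. by apply: val_inj; rewrite /= inordK. Qed.
Lemma Z3E : Z3 = Ordinal (isT : (2 < 3)%N). Proof. by apply: val_inj; rewrite /= inordK. Qed.

Lemma ord3P (T : 'I_3 -> Prop) : T X3 -> T Y3 -> T Z3 -> forall i, T i.
Proof.
rewrite X3E Y3E Z3E => tx ty tz [[|[|[|//]]] lt].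
- by rewrite (_ : Ordinal lt = Ordinal (isT : (0 < 3)%N)) //; apply: val_inj.
- by rewrite (_ : Ordinal lt = Ordinal (isT : (1 < 3)%N)) //; apply: val_inj.
- by rewrite (_ : Ordinal lt = Ordinal (isT : (2 < 3)%N)) //; apply: val_inj.
Qed.

Lemma sum3 (V : nmodType) (F : 'I_3 -> V) : \sum_i F i = F X3 + F Y3 + F Z3.
Proof.
rewrite !big_ord_recl big_ord0 addr0 addrA X3E Y3E Z3E.
by congr (F _ + F _ + F _); apply: val_inj.
Qed.

Lemma det3 (R : comNzRingType) (M : 'M[R]_3) : \det M =
  M X3 X3 * (M Y3 Y3 * M Z3 Z3 - M Y3 Z3 * M Z3 Y3) -
  M X3 Y3 * (M Y3 X3 * M Z3 Z3 - M Y3 Z3 * M Z3 X3) +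
  M X3 Z3 * (M Y3 X3 * M Z3 Y3 - M Y3 Y3 * M Z3 X3).
Proof.
pose F i j := M (inord i) (inord j).
have ME i j : M i j = F i j by rewrite /F !inord_val.
rewrite (expand_det_row _ ord0) /cofactor !big_ord_recl big_ord0.
rewrite !(expand_det_row _ ord0) /cofactor !big_ord_recl !big_ord0 !det_mx11 !mxE !ME.
rewrite X3E Y3E Z3E /= /bump /=; ring.
Qed.

(** * Quadratic algebras *)

Section Quadratic.
Variables a b c : C.
Notation rq := (rels (Quad a b c) : seq (fa 3)).

Definition qmat (x y z : C) (i j : 'I_3) : C :=
  nth 0 (nth [::] [:: [:: c * x; b * z; a * y]; [:: a * z; c * y; b * x];
                      [:: b * y; a * x; c * z]] i) j.

Lemma qmatE x y z : (qmat x y z X3 X3 = c * x) * (qmat x y z X3 Y3 = b * z) *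
  (qmat x y z X3 Z3 = a * y) * (qmat x y z Y3 X3 = a * z) * (qmat x y z Y3 Y3 = c * y) *
  (qmat x y z Y3 Z3 = b * x) * (qmat x y z Z3 X3 = b * y) * (qmat x y z Z3 Y3 = a * x) *
  (qmat x y z Z3 Z3 = c * z).
Proof. by rewrite /qmat X3E Y3E Z3E. Qed.

Lemma quad_val (i j t : 'I_3) :
  nth (@fa0 3) rq i [:: t; j] = qmat (t == X3)%:R (t == Y3)%:R (t == Z3)%:R i j.
Proof.
rewrite /rels /fa_add3 /mon /qmat; elim/ord3P: i; elim/ord3P: j; elim/ord3P: t;
  rewrite X3E Y3E Z3E /= ?eqE /= ?mulr1 ?mulr0 ?addr0 ?add0r /=; ring.
Qed.

Lemma quad_hom n : hom 2%:Z (nth (@fa0 3) rq n : fser 3).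
Proof.
have hm (e : C) (w : word 3) : size w = 2%N -> hom 2%:Z (mon e w : fser 3).
  move=> sw; have -> : (mon e w : fser 3) = e *: wd w by [].
  by apply: homZ; apply: homE (hom_wd w) _; rewrite sw.
have h3 (p q r : fser 3) : hom 2%:Z p -> hom 2%:Z q -> hom 2%:Z r -> hom 2%:Z (fa_add3 p q r : fser 3).
  by move=> hp hq hr; apply: homD hr; apply: homD.
case: n => [|[|[|n]]]; try by apply: h3; apply: hm.
by rewrite nth_default //; apply: hom0.
Qed.

Lemma quad_cyc (i j : 'I_3) w :
  nth (@fa0 3) rq i (rcons w j) = nth (@fa0 3) rq j (i :: w).
Proof.
have [sw|sw] := eqVneq (size w) 1%N; last first.
  transitivity (0 : C).
    apply/eqP; apply: contraT => /eqP/(hom_size (quad_hom i)); rewrite size_rcons => -[e].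
    by rewrite e in sw.
  apply/esym/eqP; apply: contraT => /eqP/(hom_size (quad_hom j)) -[e].
  by rewrite e in sw.
case: w sw => [//|t [|//]] _; rewrite [LHS]quad_val [RHS]quad_val /qmat.
elim/ord3P: i; elim/ord3P: j; elim/ord3P: t;
  rewrite X3E Y3E Z3E /= ?eqE /=; ring.
Qed.

Lemma relmx_quad p i j : relmx rq [:: p] i j = qmat (p X3) (p Y3) (p Z3) i j.
Proof.
rewrite mxE /= /ctr fser_sum sum3 !fserZ /lder !quad_val /qmat.
elim/ord3P: i; elim/ord3P: j; rewrite X3E Y3E Z3E /= ?eqE /=; ring.
Qed.

Hypothesis gen : generic (Quad a b c).

Lemma quad_neq0 : [/\ a != 0, b != 0 & c != 0].
Proof.
case: gen => /eqP; rewrite !mulf_eq0 !negb_or => /andP[/andP[-> ->] ->] _; by [].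
Qed.

(** If the three cubes agree, both sides of the excluded equation are [27 a^9]. *)
Lemma quad_cubes : ~ (a ^+ 3 = b ^+ 3 /\ b ^+ 3 = c ^+ 3).
Proof.
move=> [ab bc]; case: gen => _; apply; rewrite !exprMn ab bc; ring.
Qed.

Lemma nzp3 (p : point 3) : nzp p -> ~ [/\ p X3 = 0, p Y3 = 0 & p Z3 = 0].
Proof.
by case/existsP; elim/ord3P => /eqP p0 [px py pz]; apply: p0.
Qed.

(** If all 2 by 2 minors vanish, [x = 0] forces [y = z = 0]; otherwise combining minors and
    cancelling [x ^+ 2] makes the three cubes equal, against [quad_cubes]. *)
Lemma quad_rank p : nzp p -> (2 <= \rank (relmx rq [:: p]))%N.
Proof.
move=> np; rewrite ltnNge -ltnS; apply/negP => /minor2_eq; move: (nzp3 np) => + M0; apply.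
have [a0 b0 c0] := quad_neq0.
have {M0} M i i' j j' : qmat (p X3) (p Y3) (p Z3) i j * qmat (p X3) (p Y3) (p Z3) i' j' =
    qmat (p X3) (p Y3) (p Z3) i j' * qmat (p X3) (p Y3) (p Z3) i' j.
  by rewrite -!relmx_quad.
move: (p X3) (p Y3) (p Z3) M => x y z M.
have := M X3 Y3 X3 Y3; rewrite !qmatE => e1; have := M Y3 Z3 Y3 Z3; rewrite !qmatE => e2.
have := M X3 Z3 X3 Z3; rewrite !qmatE => e3; have := M X3 Z3 Y3 X3; rewrite !qmatE => e4.
have := M X3 Y3 Z3 X3; rewrite !qmatE => e5.
have [x0|x0] := eqVneq x 0.
  have z0 : z = 0.
    apply/eqP; have : b * a * z ^+ 2 == 0 by rewrite (_ : _ * _ = b * z * (a * z)); [rewrite -e1 x0; apply/eqP; ring | ring].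
    by rewrite !mulf_eq0 (negPf a0) (negPf b0) /= ?orbb.
  have y0 : y = 0.
    apply/eqP; have : b * a * y ^+ 2 == 0 by rewrite (_ : _ * _ = a * y * (b * y)); [rewrite -e3 x0; apply/eqP; ring | ring].
    by rewrite !mulf_eq0 (negPf a0) (negPf b0) /= ?orbb.
  by rewrite x0 y0 z0.
case: quad_cubes.
have X2 : x ^+ 2 != 0 by rewrite expf_neq0.
have cb : c ^+ 3 = b ^+ 3.
  apply: (mulIf (mulf_neq0 a0 X2)).
  have -> : c ^+ 3 * (a * x ^+ 2) = c ^+ 2 * (c * x * (a * x)) by ring.
  rewrite -e4; have -> : c ^+ 2 * (b * z * (b * y)) = b ^+ 2 * (c * y * (c * z)) by ring.
  rewrite e2; ring.
have ac : a ^+ 3 = c ^+ 3.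
  apply: (mulIf (mulf_neq0 b0 X2)).
  have -> : a ^+ 3 * (b * x ^+ 2) = a ^+ 2 * (b * x * (a * x)) by ring.
  rewrite -e2; have -> : a ^+ 2 * (c * y * (c * z)) = c ^+ 2 * (a * y * (a * z)) by ring.
  rewrite e5; ring.
by rewrite ac cb.
Qed.

(** The equation of the point scheme [E], a cubic in Hesse form. *)
Lemma det_quad p : \det (relmx rq [:: p]) =
  (a ^+ 3 + b ^+ 3 + c ^+ 3) * (p X3 * p Y3 * p Z3) - a * b * c * (p X3 ^+ 3 + p Y3 ^+ 3 + p Z3 ^+ 3).
Proof.
rewrite det3 !relmx_quad !qmatE; ring.
Qed.

(** On the line through two points the cubic becomes a polynomial in [t] whose leading coefficient
    is its value at the first point: this value is zero or there is a root. *)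
Lemma quad_pencil (x1 y1 z1 x2 y2 z2 A B : C) :
  let D x y z := A * (x * y * z) - B * (x ^+ 3 + y ^+ 3 + z ^+ 3) in
  D x1 y1 z1 = 0 \/ exists t, D (t * x1 + x2) (t * y1 + y2) (t * z1 + z2) = 0.
Proof.
move=> D; have [d0|d0] := eqVneq (D x1 y1 z1) 0; [by left | right].
(* [d1] and [d2] are the coefficients of [t] and [t ^+ 2] in this polynomial. *)
pose d1 := A * (x2 * y2 * z1 + x2 * y1 * z2 + x1 * y2 * z2)
  - 3%:R * B * (x1 * x2 ^+ 2 + y1 * y2 ^+ 2 + z1 * z2 ^+ 2).
pose d2 := A * (x1 * y1 * z2 + x1 * y2 * z1 + x2 * y1 * z1)
  - 3%:R * B * (x2 * x1 ^+ 2 + y2 * y1 ^+ 2 + z2 * z1 ^+ 2).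
have [t tE] := @monic_root 3 (fun i => - (nth 0 [:: D x2 y2 z2; d1; d2] i) / D x1 y1 z1) isT.
exists t; move: tE; rewrite !big_ord_recl big_ord0 /= /bump /= expr0 mulr1 addr0.
move/(congr1 (fun e => D x1 y1 z1 * e)).
have -> : D x1 y1 z1 * (- D x2 y2 z2 / D x1 y1 z1 + (- d1 / D x1 y1 z1 * t ^+ (1 + 0) +
    - d2 / D x1 y1 z1 * t ^+ (1 + (1 + 0)))) = - (D x2 y2 z2 + d1 * t + d2 * t ^+ 2).
  by rewrite !addn0; field.
move=> E; transitivity (D x1 y1 z1 * t ^+ 3 + (D x2 y2 z2 + d1 * t + d2 * t ^+ 2)).
  by rewrite /D /d1 /d2; ring.
by rewrite E addNr.
Qed.

Definition pt3 (x y z : C) : point 3 := fun i => nth 0 [:: x; y; z] i.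

Lemma pt3E x y z : (pt3 x y z X3 = x) * (pt3 x y z Y3 = y) * (pt3 x y z Z3 = z).
Proof. by rewrite /pt3 X3E Y3E Z3E. Qed.

Lemma nzp_pt3 x y z : [|| x != 0, y != 0 | z != 0] -> nzp (pt3 x y z).
Proof.
by case/or3P => h; apply/existsP; [exists X3 | exists Y3 | exists Z3]; rewrite pt3E.
Qed.

Lemma line_points (lx ly lz : C) : [|| lx != 0, ly != 0 | lz != 0] ->
  exists x1 y1 z1 x2 y2 z2, [/\ [|| x1 != 0, y1 != 0 | z1 != 0],
    lx * x1 + ly * y1 + lz * z1 = 0, lx * x2 + ly * y2 + lz * z2 = 0 &
    forall t, [|| t * x1 + x2 != 0, t * y1 + y2 != 0 | t * z1 + z2 != 0]].
Proof.
have [->|lx0 _] := eqVneq lx 0; last first.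
  exists (- ly), lx, 0, (- lz), 0, lx; rewrite lx0 orbT; split=> //; try ring.
  by move=> t; rewrite !mulr0 !add0r lx0 !orbT.
have [->|ly0 _] := eqVneq ly 0; last first.
  exists 1, 0, 0, 0, (- lz), ly; rewrite oner_eq0; split=> //; try ring.
  by move=> t; rewrite !mulr0 !add0r ly0 !orbT.
move=> /= lz0; exists 1, 0, 0, 0, 1, 0; rewrite oner_eq0; split=> //; try ring.
by move=> t; rewrite !mulr0 !add0r oner_eq0 !orbT.
Qed.

Lemma quad_line_meets (l : fser 3) : hom 1 l -> l != 0 ->
  exists p ps, [/\ size (p :: ps) = 1%N, all (@nzp 3) (p :: ps),
                    \det (relmx rq (p :: ps)) = 0 & ev [:: p] l = 0].
Proof.
move=> hl l0.
have : [|| l [:: X3] != 0, l [:: Y3] != 0 | l [:: Z3] != 0].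
  have [t] := hom1_neq0 hl l0.
  by elim/ord3P: t => ->; rewrite ?orbT.
case/line_points => x1 [y1 [z1 [x2 [y2 [z2 [n1 e1 e2 n2]]]]]].
have [d0|[t dt]] := quad_pencil x1 y1 z1 x2 y2 z2 (a ^+ 3 + b ^+ 3 + c ^+ 3) (a * b * c).
  exists (pt3 x1 y1 z1), [::]; split=> //; first by rewrite /= andbT nzp_pt3.
    by rewrite det_quad !pt3E.
  by rewrite ev1 sum3 !pt3E -[RHS]e1; ring.
exists (pt3 (t * x1 + x2) (t * y1 + y2) (t * z1 + z2)), [::]; split=> //.
- by rewrite /= andbT nzp_pt3.
- by rewrite det_quad !pt3E.
rewrite ev1 sum3 !pt3E.
transitivity (t * (l [:: X3] * x1 + l [:: Y3] * y1 + l [:: Z3] * z1) +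
  (l [:: X3] * x2 + l [:: Y3] * y2 + l [:: Z3] * z2)); first by ring.
by rewrite e1 e2 mulr0 addr0.
Qed.

Lemma quad_elliptic : elliptic 1 rq.
Proof.
split=> //.
- exact: quad_hom.
- exact: quad_cyc.
- by move=> [|p [|//]] //= _; rewrite andbT => /quad_rank.
- exact: quad_line_meets.
- exact: line_decomp3.
by apply: relmx_indecomp1 => //; [exact: quad_cyc | exact: quad_rank].
Qed.

End Quadratic.

(** * Inflection points and central elements of quadratic algebras *)

Lemma cube_root_unity : exists w : C, [/\ w ^+ 3 = 1, w != 1, w ^+ 2 != 1 & w ^+ 2 != w].
Proof.
have [w] := @monic_root 2 (fun=> -1) isT.
rewrite !big_ord_recl big_ord0 /bump /= expr0 mulr1 addr0 ?addn0 expr1 => w2.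
have w3 : w ^+ 3 = 1 by rewrite exprS w2; transitivity (- w - w ^+ 2); [ring | rewrite w2; ring].
have w1 : w != 1.
  apply/eqP => e; move: w2; rewrite e => e2.
  have : (3%:R : C) == 0 by apply/eqP; transitivity (1 ^+ 2 - (-1 + -1 * 1) : C); [ring | rewrite e2; ring].
  by rewrite (negPf (natr_neq0 _)).
exists w; split=> //.
  by apply: contraNneq w1 => e; rewrite -w3 exprS e mulr1.
apply: contraNneq w1 => e; have w0 : w != 0.
  by apply: contra_eqN w3 => /eqP ->; rewrite expr0n /= eq_sym oner_eq0.
by apply/eqP; apply: (mulfI w0); rewrite mulr1 -[RHS]e.
Qed.

(** Inversion of the Vandermonde matrix of the cube roots of unity; since [1 + w + w ^+ 2 = 0],
    suitable combinations of the three values leave [3 u], [3 v] or [3 t]. *)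
Lemma fourier3 (u v t : C) : (forall z : C, z ^+ 3 = 1 -> u + z * v + z ^+ 2 * t = 0) ->
  [/\ u = 0, v = 0 & t = 0].
Proof.
have [w [w3 w1 w2 _]] := cube_root_unity; move=> H.
have h1 := H 1 (expr1n _ _); have hw := H w w3.
have hw2 : u + w ^+ 2 * v + w * t = 0.
  have := H (w ^+ 2); rewrite -exprM mulnC exprM w3 expr1n => /(_ erefl).
  by rewrite -exprM (exprD w 3 1) w3 mul1r expr1.
have sw : 1 + w + w ^+ 2 = 0.
  have w10 : w - 1 != 0 by rewrite subr_eq0.
  apply: (mulfI w10); rewrite mulr0; transitivity (w ^+ 3 - 1); first by ring.
  by rewrite w3 subrr.
have n3 := @natr_neq0 3 isT.
have three e : 3%:R * e = 0 -> e = 0 :> C by move/eqP; rewrite mulf_eq0 (negPf n3) => /eqP.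
split; apply: three.
- transitivity ((u + 1 * v + 1 ^+ 2 * t) + (u + w * v + w ^+ 2 * t) + (u + w ^+ 2 * v + w * t)
    - (1 + w + w ^+ 2) * (v + t)); first by ring.
  by rewrite h1 hw hw2 sw; ring.
- transitivity ((u + 1 * v + 1 ^+ 2 * t) + w ^+ 2 * (u + w * v + w ^+ 2 * t) + w * (u + w ^+ 2 * v + w * t)
    - (1 + w + w ^+ 2) * (u + t) - (w ^+ 3 - 1) * (2%:R * v + w * t)); first by ring.
  by rewrite h1 hw hw2 sw w3; ring.
transitivity ((u + 1 * v + 1 ^+ 2 * t) + w * (u + w * v + w ^+ 2 * t) + w ^+ 2 * (u + w ^+ 2 * v + w * t)
    - (1 + w + w ^+ 2) * (u + v) - (w ^+ 3 - 1) * (2%:R * t + w * v)); first by ring.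
by rewrite h1 hw hw2 sw w3; ring.
Qed.

Section QuadTorsion.
Variables a b c : C.
Hypothesis gen : generic (Quad a b c).
Notation rq := (rels (Quad a b c) : seq (fa 3)).
Notation Id := (idl rq).
Let ell := quad_elliptic gen.
Let ks : (3, 1)%N = (3, 1)%N \/ (3, 1)%N = (2, 2)%N := or_introl erefl.

Definition qwin (p q : point 3) :=
  [/\ c * p X3 * q X3 + b * p Z3 * q Y3 + a * p Y3 * q Z3 = 0,
      a * p Z3 * q X3 + c * p Y3 * q Y3 + b * p X3 * q Z3 = 0 &
      b * p Y3 * q X3 + a * p X3 * q Y3 + c * p Z3 * q Z3 = 0].

Lemma qwinP p q : qwin p q <-> forall j : 'I_3, ev [:: p; q] (nth (@fa0 3) rq j : fser 3) = 0.
Proof.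
have E (j : 'I_3) : ev [:: p; q] (nth (@fa0 3) rq j : fser 3) =
    qmat a b c (p X3) (p Y3) (p Z3) j X3 * q X3 + qmat a b c (p X3) (p Y3) (p Z3) j Y3 * q Y3
    + qmat a b c (p X3) (p Y3) (p Z3) j Z3 * q Z3.
  by rewrite -[[:: p; q]]/(rcons [:: p] q) ev_rcons_rel sum3 !relmx_quad.
split=> [[e1 e2 e3]|H]; first by elim/ord3P; rewrite E !qmatE.
by split; [have := H X3 | have := H Y3 | have := H Z3]; rewrite E !qmatE.
Qed.

(** The cyclic symmetry of the relations; it carries chains starting on [x = 0] to chains starting
    on the other coordinate lines. *)
Definition rot3 (p : point 3) := pt3 (p Z3) (p X3) (p Y3).

Lemma qwin_rot p q : qwin p q -> qwin (rot3 p) (rot3 q).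
Proof.
move=> [e1 e2 e3]; split; rewrite /rot3 !pt3E; [rewrite -[RHS]e3 | rewrite -[RHS]e1 | rewrite -[RHS]e2]; ring.
Qed.

Lemma qwin_rotV p q : qwin (rot3 p) (rot3 q) -> qwin p q.
Proof.
rewrite /qwin /rot3 !pt3E => -[e1 e2 e3].
by split; [rewrite -[RHS]e2 | rewrite -[RHS]e3 | rewrite -[RHS]e1]; ring.
Qed.

Lemma nzp_rot p : nzp p -> nzp (rot3 p).
Proof.
by case/existsP; elim/ord3P => h; apply: nzp_pt3; rewrite h ?orbT.
Qed.

Lemma nzp_rotn n p : nzp p -> nzp (iter n rot3 p).
Proof. by move=> np; elim: n => //= n; apply: nzp_rot. Qed.

Lemma qwin_rotn n p q : qwin p q -> qwin (iter n rot3 p) (iter n rot3 q).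
Proof. by move=> w; elim: n => //= n; apply: qwin_rot. Qed.

Lemma qwin_rotnV n p q : qwin (iter n rot3 p) (iter n rot3 q) -> qwin p q.
Proof. by elim: n => //= n IH /qwin_rotV. Qed.

Variable g : fser 3.
Hypothesis cg : @central_elt (Quad a b c) g.

Lemma quad_g_hom : hom 3%:Z g. Proof. by case: cg => _ hg _ _. Qed.
Lemma quad_g_nId : ~ Id g. Proof. by case: cg. Qed.
Lemma quad_g_central (i : 'I_3) : Id (x i * g - g * x i). Proof. by case: cg => _ _ _; apply. Qed.

(** If [P 3] were proportional to [q0], the pair [q2, q0] would satisfy the relations; so the last
    condition is what [central_vanish] asks for. *)
Lemma quad_chain q0 q1 q2 : nzp q0 -> nzp q1 -> nzp q2 -> qwin q0 q1 -> qwin q1 q2 -> ~ qwin q2 q0 ->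
  exists P, [/\ chain 1 rq P, P 0%N = q0, P 1%N = q1, P 2%N = q2 & ev (seg P 3) g = 0].
Proof.
move=> n0 n1 n2 w01 w12 w20.
have W i : (i + 2 <= 3)%N -> forall j : 'I_3,
    ev (take 2 (drop i [:: q0; q1; q2])) (nth (@fa0 3) rq j : fser 3) = 0.
  case: i => [|[|i]]; [by move=> _; apply/qwinP | by move=> _; apply/qwinP | lia].
have [|P cP] := @chain_ext 3 1 rq ell [:: q0; q1; q2] isT _ W; first by rewrite /= n0 n1 n2.
move=> -[e0 e1 e2]; exists P; split=> //.
have [] // := central_vanish ell quad_g_hom quad_g_central cP.
move=> [ka ke]; apply: w20.
have w23 : qwin (P 2%N) (P 3) by apply/qwinP => j; apply: (cP.2 2%N).
have ka0 : ka != 0.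
  by have /existsP[t] := cP.1 3%N; apply: contraNneq => k0; rewrite ke k0 mul0r.
move: w23; rewrite /qwin !ke e0 e2 => -[h1 h2 h3]; split; apply: (mulfI ka0); rewrite mulr0.
- by rewrite -[RHS]h1; ring.
- by rewrite -[RHS]h2; ring.
- by rewrite -[RHS]h3; ring.
Qed.

(** For [z ^+ 3 = 1] the [qp0 z] are the three points of [E] on [x = 0], inflection points of the
    Hesse cubic; [qp1 z] and [qp2 z] are their images under [sigma] and its square. *)
Definition qp0 z := pt3 0 z (- z ^+ 2).
Definition qp1 z := pt3 c (z * a) (z ^+ 2 * b).
Definition qp2 z := pt3 (c * (b ^+ 3 - a ^+ 3)) (z * b * (a ^+ 3 - c ^+ 3)) (z ^+ 2 * a * (c ^+ 3 - b ^+ 3)).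

Lemma quad_flex_chain n z : z ^+ 3 = 1 ->
  exists P, [/\ chain 1 rq P, P 0%N = iter n rot3 (qp0 z), P 1%N = iter n rot3 (qp1 z),
    P 2%N = iter n rot3 (qp2 z) & ev (seg P 3) g = 0].
Proof.
move=> z3; have [a0 b0 c0] := quad_neq0 gen.
have z0 : z != 0 by apply: contra_eqN z3 => /eqP ->; rewrite expr0n /= eq_sym oner_eq0.
have nrot := @nzp_rotn n; have wrot := @qwin_rotn n; have wrotV := @qwin_rotnV n.
have nall : b ^+ 3 - a ^+ 3 = 0 -> a ^+ 3 - c ^+ 3 = 0 -> False.
  move=> /subr0_eq h1 /subr0_eq h2; apply: (quad_cubes gen).
  by split; [rewrite h1 | rewrite h1 h2].
apply: quad_chain.
- by apply/nrot/nzp_pt3; rewrite z0 orbT.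
- by apply/nrot/nzp_pt3; rewrite c0.
- apply/nrot/nzp_pt3; apply: contraT; rewrite !negb_or !negbK => /and3P[].
  rewrite !mulf_eq0 (negPf a0) (negPf b0) (negPf c0) (negPf z0) /= => /eqP e1 /eqP e2 _.
  by case: (nall e1 e2).
- apply: wrot; split; rewrite /qp0 /qp1 !pt3E; [by ring | by ring |].
  by transitivity (- (b * c * z) * (z ^+ 3 - 1)); [ring | rewrite z3 subrr mulr0].
- apply: wrot; split; rewrite /qp1 /qp2 !pt3E.
  + transitivity ((b ^+ 3 * (a ^+ 3 - c ^+ 3) + a ^+ 3 * (c ^+ 3 - b ^+ 3)) * (z ^+ 3 - 1)); first by ring.
    by rewrite z3 subrr mulr0.
  + by ring.
  transitivity (a * b * c * z * (c ^+ 3 - b ^+ 3) * (z ^+ 3 - 1)); first by ring.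
  by rewrite z3 subrr mulr0.
move=> /wrotV[]; rewrite /qp0 /qp2 !pt3E => h1 h2 _.
(* The three cyclic differences of cubes would be equal; as their sum is zero, all would vanish,
   against [quad_cubes]. *)
have e1 : c ^+ 3 - b ^+ 3 = a ^+ 3 - c ^+ 3.
  apply: (mulfI (mulf_neq0 (mulf_neq0 a0 b0) (expf_neq0 3 z0))); apply/eqP; rewrite -subr_eq0; apply/eqP.
  by rewrite -[RHS]h1; ring.
have e2 : a ^+ 3 - c ^+ 3 = b ^+ 3 - a ^+ 3.
  apply: (mulfI (mulf_neq0 (mulf_neq0 c0 b0) (expf_neq0 2 z0))); apply/eqP; rewrite -subr_eq0; apply/eqP.
  by rewrite -[RHS]h2; ring.
have n3 := @natr_neq0 3 isT.
have e3 : b ^+ 3 - a ^+ 3 = 0.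
  apply: (mulfI n3); rewrite mulr0.
  transitivity ((b ^+ 3 - a ^+ 3) - (a ^+ 3 - c ^+ 3) +
    ((b ^+ 3 - a ^+ 3) - (c ^+ 3 - b ^+ 3))); first by ring.
  by rewrite e1 e2 subrr addr0.
by apply: nall; rewrite // e2.
Qed.

(** Reduced by [z ^+ 3 = 1], the expression is quadratic in [z] and vanishes at three cube roots, so
    [fourier3] applies. *)
Lemma flex_fourier (hyx hyy hyz hzx hzy hzz : C) :
  (forall z : C, z ^+ 3 = 1 -> z * (c * hyx + z * a * hyy + z ^+ 2 * b * hyz)
    - z ^+ 2 * (c * hzx + z * a * hzy + z ^+ 2 * b * hzz) = 0) ->
  [/\ c * hyx = b * hzz, a * hyy = c * hzx & b * hyz = a * hzy].
Proof.
move=> H.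
have [z|/subr0_eq e1 /subr0_eq e2 /subr0_eq e3] :=
  @fourier3 (b * hyz - a * hzy) (c * hyx - b * hzz) (a * hyy - c * hzx); last by [].
move=> z3; rewrite -[RHS](H z z3); apply/eqP; rewrite -subr_eq0; apply/eqP.
transitivity ((1 - z ^+ 3) * (b * hyz - a * hzy - z * b * hzz)); first by ring.
by rewrite z3 subrr mul0r.
Qed.

(* The equations expressing that [h] vanishes along the chains starting on the line [x_u = 0]. *)
Definition flex_eqs (h : fser 3) (u v w : 'I_3) :=
  [/\ c * h [:: v; u] = b * h [:: w; w], a * h [:: v; v] = c * h [:: w; u] &
      b * h [:: v; w] = a * h [:: w; v]].

Lemma quad_rel_comb (h : fser 3) : hom 2 h ->
  c * h [:: Y3; Z3] = a * h [:: X3; X3] -> c * h [:: Z3; Y3] = b * h [:: X3; X3] ->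
  c * h [:: Z3; X3] = a * h [:: Y3; Y3] -> c * h [:: X3; Z3] = b * h [:: Y3; Y3] ->
  c * h [:: X3; Y3] = a * h [:: Z3; Z3] -> c * h [:: Y3; X3] = b * h [:: Z3; Z3] -> Id h.
Proof.
move=> hh e1 e2 e3 e4 e5 e6; have [a0 b0 c0] := quad_neq0 gen.
pose f n : fser 3 := nth (@fa0 3) rq n.
have -> : h = c^-1 *: (h [:: X3; X3] *: f X3 + h [:: Y3; Y3] *: f Y3 + h [:: Z3; Z3] *: f Z3).
  apply: hom2_ext => //.
    by apply: homZ; apply: homD; [apply: homD|]; apply: homZ; apply: quad_hom.
  move=> i j; apply: (mulfI c0); rewrite fserZ !fserD !fserZ mulVKf // /f !quad_val.
  elim/ord3P: i; elim/ord3P: j; rewrite !qmatE ?e1 ?e2 ?e3 ?e4 ?e5 ?e6 ?eqxx;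
    rewrite X3E Y3E Z3E /= ?eqE /=; ring.
apply: IdZ; apply: IdD; [apply: IdD|]; apply: IdZ; exact: Id_rel.
Qed.

Lemma flex_eqs2 (h : fser 3) (T : Prop) u v w :
  (c * h [:: v; w] = a * h [:: u; u] -> c * h [:: w; v] = b * h [:: u; u] ->
   c * h [:: w; u] = a * h [:: v; v] -> c * h [:: u; w] = b * h [:: v; v] ->
   c * h [:: u; v] = a * h [:: w; w] -> c * h [:: v; u] = b * h [:: w; w] -> T) ->
  flex_eqs h u v w -> flex_eqs h v w u -> T.
Proof.
have [a0 b0 c0] := quad_neq0 gen.
move=> H [e1 e2 e3] [e4 e5 e6]; apply: H => //.
- by apply: (mulfI b0); rewrite mulrCA e3 mulrCA e4 mulrCA.
- by apply: (mulfI a0); rewrite mulrCA -e6 mulrCA -e2 mulrCA.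
Qed.

(** Each system is available only if two particular cubes differ. By [quad_cubes] at least two
    systems are, and by [flex_eqs2] two suffice. *)
Lemma quad_two_lines (h : fser 3) : hom 2 h ->
  (a ^+ 3 <> b ^+ 3 -> flex_eqs h X3 Y3 Z3) -> (b ^+ 3 <> c ^+ 3 -> flex_eqs h Y3 Z3 X3) ->
  (c ^+ 3 <> a ^+ 3 -> flex_eqs h Z3 X3 Y3) -> Id h.
Proof.
move=> hh fx fy fz.
have [ab|/eqP ab] := eqVneq (a ^+ 3) (b ^+ 3).
  have bc : b ^+ 3 <> c ^+ 3 by move=> bc; case: (quad_cubes gen).
  have ca : c ^+ 3 <> a ^+ 3 by move=> ca; apply: bc; rewrite -ab.
  by apply: flex_eqs2 (fy bc) (fz ca) => *; apply: quad_rel_comb.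
have [bc|/eqP bc] := eqVneq (b ^+ 3) (c ^+ 3).
  have ca : c ^+ 3 <> a ^+ 3 by move=> ca; apply: ab; rewrite bc.
  by apply: flex_eqs2 (fz ca) (fx ab) => *; apply: quad_rel_comb.
by apply: flex_eqs2 (fx ab) (fy bc) => *; apply: quad_rel_comb.
Qed.

(** The cofactor [h] satisfies [g = h x], so along the chains from the three coordinate lines it
    vanishes at the first two points whenever the third lies off [x = 0]. The resulting equations
    put [h], hence [g], in the ideal. *)
Lemma quad_not_divisible : ~ lineI rq (x X3) 3%:Z g.
Proof.
have hx : hom 1 (x X3 : fser 3) by apply: (hom_wd [:: X3]).
have [a0 b0 c0] := quad_neq0 gen.
move/(central_cofactor ell ks quad_g_central hx (x_neq0 X3)) => [h [hh _ Ih]].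
have {}hh : hom 2 h by apply: homE hh _.
apply: quad_g_nId.
suff Ihh : Id h by rewrite -[g](subrK (h * x X3)); apply: (IdD Ih); apply: Id_homr hx Ihh.
have vanish n z : z ^+ 3 = 1 -> iter n rot3 (qp2 z) X3 != 0 ->
    ev [:: iter n rot3 (qp0 z); iter n rot3 (qp1 z)] h = 0.
  move=> z3 n0; have [P [cP e0 e1 e2 gP]] := quad_flex_chain n z3.
  move: gP; rewrite (ev_mod ell cP (w := h * x X3) quad_g_hom) //; last first.
    by apply: homE (homM hh hx) _.
  rewrite segSr -cats1 ev_mul ?size_seg // e2 ev1 (bigD1 X3) //= big1 => [|j jx]; last first.
    by rewrite /wd /fa_word eqseq_cons (negPf jx) mulr0.
  rewrite /wd /fa_word eqxx mulr1 addr0 => /eqP.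
  by rewrite mulf_eq0 (negPf n0) orbF -e0 -e1 => /eqP.
have nz z : z ^+ 3 = 1 -> z != 0 :> C.
  by move=> z3; apply: contra_eqN z3 => /eqP ->; rewrite expr0n /= eq_sym oner_eq0.
have eC (e1 e2 : C) : e1 <> e2 -> e2 - e1 != 0 by move=> ne; rewrite subr_eq0 eq_sym; apply/eqP.
(* The rotations bring each coordinate of [qp2 z], a nonzero multiple of a difference of cubes, into
   first place. *)
apply: quad_two_lines => // ne; apply: flex_fourier => z z3; have z0 := nz z z3.
- rewrite -[RHS](vanish 0%N z z3) /= /qp2 ?pt3E; last by rewrite mulf_neq0 ?eC.
  rewrite ev2 !sum3 /qp0 /qp1 !pt3E; ring.
- rewrite -[RHS](vanish 1%N z z3) /= /rot3 /qp2 ?pt3E; last first.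
    by rewrite !mulf_neq0 ?eC // expf_neq0.
  rewrite ev2 !sum3 /qp0 /qp1 !pt3E; ring.
rewrite -[RHS](vanish 2%N z z3) /= /rot3 /qp2 ?pt3E; last first.
  by rewrite !mulf_neq0 ?eC.
rewrite ev2 !sum3 /qp0 /qp1 !pt3E; ring.
Qed.

Theorem quad_line_torsion_free d v : hom d v -> lineI rq (x X3) (d + 3%:Z) (v * g) ->
  lineI rq (x X3) d v.
Proof.
have hx : hom 1 (x X3 : fser 3) by apply: (hom_wd [:: X3]).
have [a0 b0 c0] := quad_neq0 gen.
have [w [w3 w1 w2 ww]] := cube_root_unity.
have w23 : (w ^+ 2) ^+ 3 = 1 by rewrite -exprM mulnC exprM w3 expr1n.
pose zs i := nth 1 [:: 1; w; w ^+ 2] i : C.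
have zs3 i : zs i ^+ 3 = 1 by case: i => [|[|[|i]]]; rewrite /zs /= ?nth_default ?expr1n.
have zsD i j : (i < j < 3)%N -> zs i - zs j != 0.
  by case: i j => [|[|[|i]]] [|[|[|j]]] //=; rewrite ?andbF // => _; rewrite subr_eq0 /zs eq_sym.
have /choice[P HP] : forall i, exists P, [/\ chain 1 rq P, P 0%N = qp0 (zs i), P 1%N = qp1 (zs i)
    & ev (seg P 3) g = 0].
  by move=> i; have [P [? ? ? _ ?]] := quad_flex_chain 0 (zs3 i); exists P.
have nz i : zs i != 0.
  by apply: contra_eqN (zs3 i) => /eqP ->; rewrite expr0n /= eq_sym oner_eq0.
have hx3 i : hom 1 (x i : fser 3) by apply: (hom_wd [:: i]).
have evx p i : ev [:: p] (x i : fser 3) = p i by rewrite /ev /= -[x i]mulr1 ctr_xM fserZ fser1_nil mulr1.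
apply: (line_torsion_free ell ks quad_g_hom quad_g_central (T := 3) (P := P)) => //.
- move=> i _; have [cP e0 _ _] := HP i; split=> //; by rewrite e0 evx /qp0 pt3E.
- have seg1 m (Q : nat -> point 3) : seg (shift m Q) 1 = [:: Q m].
    by rewrite /seg /mkseq /= /shift addn0.
  move=> i j ij; have [_ e0 e1 _] := HP i; have [_ f0 f1 _] := HP j.
  have zz := zsD i j ij.
  case: i ij e0 e1 zz => [|[|i]] ij e0 e1 zz; last by lia.
    (* A linear form through one initial point that misses the other two; the next witness does the
       same for second points. *)
    exists (zs 0%N *: x Y3 + x Z3); split; first by apply: homD => //; apply: homZ.
      by rewrite !seg1 mul0n e0 evD evZ !evx /qp0 !pt3E; ring.
    rewrite !seg1 mul0n f0 evD evZ !evx /qp0 !pt3E; apply/eqP.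
    by rewrite (_ : _ + _ = zs j * (zs 0%N - zs j)) ?mulf_neq0 //; ring.
  exists (zs 1%N * a *: x X3 - c *: x Y3); split; first by apply: homB; apply: homZ.
    by rewrite !seg1 mul1n e1 evB !evZ !evx /qp1 !pt3E; ring.
  rewrite !seg1 mul1n f1 evB !evZ !evx /qp1 !pt3E; apply/eqP.
  by rewrite (_ : _ - _ = a * c * (zs 1%N - zs j)) ?mulf_neq0 //; ring.
- exact: x_neq0.
- by move=> i _; case: (HP i).
exact: quad_not_divisible.
Qed.

End QuadTorsion.

(** * Linear forms in two variables *)

Lemma X2E : X2 = Ordinal (isT : (0 < 2)%N). Proof. by apply: val_inj; rewrite /= inordK. Qed.
Lemma Y2E : Y2 = Ordinal (isT : (1 < 2)%N). Proof. by apply: val_inj; rewrite /= inordK. Qed.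

Lemma ord2P (T : 'I_2 -> Prop) : T X2 -> T Y2 -> forall i, T i.
Proof.
rewrite X2E Y2E => tx ty [[|[|//]] lt].
- by rewrite (_ : Ordinal lt = Ordinal (isT : (0 < 2)%N)) //; apply: val_inj.
- by rewrite (_ : Ordinal lt = Ordinal (isT : (1 < 2)%N)) //; apply: val_inj.
Qed.

Lemma sum2 (V : nmodType) (F : 'I_2 -> V) : \sum_i F i = F X2 + F Y2.
Proof.
rewrite !big_ord_recl big_ord0 addr0 X2E Y2E.
by congr (F _ + F _); apply: val_inj.
Qed.

Lemma det2 (R : comNzRingType) (M : 'M[R]_2) :
  \det M = M X2 X2 * M Y2 Y2 - M X2 Y2 * M Y2 X2.
Proof.
pose F i j := M (inord i) (inord j).
have ME i j : M i j = F i j by rewrite /F !inord_val.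
rewrite (expand_det_row _ ord0) /cofactor !big_ord_recl big_ord0 !det_mx11 !mxE !ME.
rewrite X2E Y2E /= /bump /=; ring.
Qed.

Definition pt2 (x y : C) : point 2 := fun i => nth 0 [:: x; y] i.

Lemma pt2E x y : (pt2 x y X2 = x) * (pt2 x y Y2 = y).
Proof. by rewrite /pt2 X2E Y2E. Qed.

Lemma nzp_pt2 x y : (x != 0) || (y != 0) -> nzp (pt2 x y).
Proof. by case/orP => h; apply/existsP; [exists X2 | exists Y2]; rewrite pt2E. Qed.

Lemma nzp2 (p : point 2) : nzp p -> (p X2 != 0) || (p Y2 != 0).
Proof. by case/existsP; elim/ord2P => ->; rewrite ?orbT. Qed.

Lemma hom1_lder_decomp k (p : point k) (phi m : fser k) (A : 'I_k -> C) d (y : fser k) :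
  (forall i, x i = p i *: phi + A i *: m) -> hom d y -> 0 < d ->
  y = phi * ctr p y + m * \sum_i A i *: lder i y.
Proof.
move=> xE hy d0; rewrite [LHS]fser_decomp (hom_nil hy) ?lt0r_neq0 // scale0r add0r.
rewrite /ctr !mulr_sumr -big_split; apply: eq_bigr => i _ /=.
by rewrite {1}xE mulrDl -!scalerAl -!scalerAr.
Qed.

(** In two variables the forms vanishing at [p] are the multiples of [m]; [phi] is a form with value
    one at [p]. *)
Lemma perp2_span (p : point 2) (m : fser 2) : nzp p -> hom 1 m -> m != 0 -> ev [:: p] m = 0 ->
  exists phi A, hom 1 phi /\ forall i, x i = p i *: phi + A i *: m.
Proof.
move=> np hm m0; rewrite ev1 sum2 => mp.
have mE := hom1_sum hm; rewrite sum2 in mE.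
have [px|px] := eqVneq (p X2) 0.
  have py : p Y2 != 0 by have := nzp2 np; rewrite px eqxx.
  have my : m [:: Y2] = 0.
    by apply/eqP; move/eqP: mp; rewrite px mul0r add0r mulf_eq0 (negPf py).
  have mx : m [:: X2] != 0.
    by apply: contraNneq m0 => mx; rewrite mE mx my !scale0r addr0.
  exists ((p Y2)^-1 *: x Y2), (fun i => if i == X2 then (m [:: X2])^-1 else 0).
  split; first by apply/homZ/(hom_wd [:: Y2]).
  elim/ord2P; rewrite ?eqxx.
    by rewrite px scale0r add0r mE my scale0r addr0 fserZ /wd /fa_word eqxx mulr1 scalerA mulVf ?scale1r.
  by rewrite scalerA mulfV // scale1r (_ : Y2 == X2 = false) ?scale0r ?addr0 // X2E Y2E.
have my : m [:: Y2] != 0.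
  apply: contraNneq m0 => my; move/eqP: mp; rewrite my mulr0 addr0 mulf_eq0 (negPf px) /= => /eqP mx.
  by rewrite mE mx my !scale0r addr0.
exists ((p X2)^-1 *: x X2), (fun i => if i == Y2 then (m [:: Y2])^-1 else 0).
split; first by apply/homZ/(hom_wd [:: X2]).
elim/ord2P; rewrite ?eqxx.
  by rewrite scalerA mulfV // scale1r (_ : X2 == Y2 = false) ?scale0r ?addr0 // X2E Y2E.
have mxE' : m [:: X2] = - (p Y2 / p X2) * m [:: Y2].
  apply: (mulfI px); apply/eqP; rewrite -subr_eq0; apply/eqP.
  by rewrite -[RHS]mp; field.
have -> : (m [:: Y2])^-1 *: m = x Y2 - (p Y2 / p X2) *: x X2.
  rewrite {2}mE mxE' scalerDr !scalerA mulVf // scale1r addrC; congr (_ + _).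
  rewrite -[RHS]scaleNr; congr (_ *: _).
  by field; rewrite px my.
by rewrite scalerA addrCA subrr addr0.
Qed.

(** The generators are split twice, at [P 0] with [l] and at [P 1] with a form [m] vanishing there,
    whence [u = phi * m]; the term left over contains [ctrs (seg P 2) y], which is zero. *)
Lemma line_decomp2 (P : nat -> point 2) (l : fser 2) : (forall i, nzp (P i)) ->
  hom 1 l -> l != 0 -> ev [:: P 0%N] l = 0 ->
  exists2 u, hom 2%:Z u & forall (n : nat) y, hom n%:Z y -> ctrs (seg P 2) y = 0 ->
    ev (seg P n) y = 0 ->
    exists a b, [/\ hom (n%:Z - 1) a, hom (n%:Z - 2%:Z) b & y = l * a + u * b].
Proof.
move=> nP hl l0 lP.
have [phi [A [hphi xE]]] := perp2_span (nP 0%N) hl l0 lP.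
pose m : fser 2 := P 1%N Y2 *: x X2 - P 1%N X2 *: x Y2.
have hx i : hom 1 (x i : fser 2) by apply: (hom_wd [:: i]).
have hm : hom 1 m by apply: homB; apply: homZ.
have mE : (m [:: X2] = P 1%N Y2) * (m [:: Y2] = - P 1%N X2).
  by rewrite /m !fserB !fserZ /wd /fa_word X2E Y2E /= ?eqE /= !mulr1 !mulr0 subr0 sub0r.
have m0 : m != 0.
  apply/eqP => e; have := nzp2 (nP 1%N); rewrite -[P 1%N X2]opprK -!mE e.
  by rewrite !fser0 oppr0 eqxx.
have mP : ev [:: P 1%N] m = 0 by rewrite ev1 sum2 !mE; ring.
have [psi [B [hpsi xE']]] := perp2_span (nP 1%N) hm m0 mP.
exists (phi * m) => [|n y hy cy ey]; first by apply: homE (homM hphi hm) _.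
have hsum d (D : 'I_2 -> C) (z : fser 2) : hom d z -> hom (d - 1) (\sum_i D i *: lder i z).
  by move=> hz; apply: hom_sum => i; apply/homZ/hom_lder.
case: n hy ey => [|n] hy ey.
  exists 0, 0; split; try exact: hom0.
  rewrite (hom0_scalar hy); move: ey; rewrite /ev /= => ->.
  by rewrite scale0r !mulr0 addr0.
pose Y := ctr (P 0%N) y; have hY : hom n%:Z Y by apply: homE (hom_ctr _ hy) _; lia.
exists (\sum_i A i *: lder i y), (\sum_i B i *: lder i Y); split.
- exact: hsum.
- by apply: homE (hsum _ _ _ hY) _; lia.
rewrite [LHS](hom1_lder_decomp xE hy) // addrC -/Y; congr (_ + _); rewrite -mulrA; congr (_ * _).
(* In degree one [Y] is a scalar, and it is the evaluation that makes it zero. *)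
case: n hy ey hY => [|n] hy ey hY.
  have -> : Y = 0 by rewrite (hom0_scalar hY) -[Y [::]]/(ev (seg P 1) y) ey scale0r.
  by rewrite big1 ?mulr0 // => i _; rewrite [lder i 0]linear0 scaler0.
rewrite [LHS](hom1_lder_decomp xE' hY) //.
by rewrite (_ : ctr (P 1%N) Y = 0) ?mulr0 ?add0r // -cy.
Qed.

(** * Cubic algebras *)

Section CubicAlg.
Variables a b c : C.
Notation rc := (rels (Cubic a b c) : seq (fa 2)).

Definition cmat (x0 y0 x1 y1 : C) (i j : 'I_2) : C :=
  nth 0 (nth [::] [:: [:: a * y0 * y1 + c * x0 * x1; b * y0 * x1 + a * x0 * y1];
                      [:: b * x0 * y1 + a * y0 * x1; a * x0 * x1 + c * y0 * y1]] i) j.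

Lemma cmatE x0 y0 x1 y1 : (cmat x0 y0 x1 y1 X2 X2 = a * y0 * y1 + c * x0 * x1) *
  (cmat x0 y0 x1 y1 X2 Y2 = b * y0 * x1 + a * x0 * y1) *
  (cmat x0 y0 x1 y1 Y2 X2 = b * x0 * y1 + a * y0 * x1) *
  (cmat x0 y0 x1 y1 Y2 Y2 = a * x0 * x1 + c * y0 * y1).
Proof. by rewrite /cmat X2E Y2E. Qed.

Lemma cubic_val (i j t t' : 'I_2) : nth (@fa0 2) rc i [:: t; t'; j] =
  cmat (t == X2)%:R (t == Y2)%:R (t' == X2)%:R (t' == Y2)%:R i j.
Proof.
rewrite /rels /fa_add4 /mon /cmat; elim/ord2P: i; elim/ord2P: j; elim/ord2P: t; elim/ord2P: t';
  rewrite X2E Y2E /= ?eqE /=; ring.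
Qed.

Lemma cubic_hom n : hom 3%:Z (nth (@fa0 2) rc n : fser 2).
Proof.
have hm (e : C) (w : word 2) : size w = 3%N -> hom 3%:Z (mon e w : fser 2).
  move=> sw; have -> : (mon e w : fser 2) = e *: wd w by [].
  by apply: homZ; apply: homE (hom_wd w) _; rewrite sw.
have h4 (p q r t : fser 2) : hom 3%:Z p -> hom 3%:Z q -> hom 3%:Z r -> hom 3%:Z t ->
    hom 3%:Z (fa_add4 p q r t : fser 2).
  by move=> hp hq hr ht; apply: homD ht; apply: homD hr; apply: homD.
case: n => [|[|n]]; try by apply: h4; apply: hm.
by rewrite nth_default //; apply: hom0.
Qed.

Lemma cubic_cyc (i j : 'I_2) w :
  nth (@fa0 2) rc i (rcons w j) = nth (@fa0 2) rc j (i :: w).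
Proof.
have [sw|sw] := eqVneq (size w) 2%N; last first.
  transitivity (0 : C).
    apply/eqP; apply: contraT => /eqP/(hom_size (cubic_hom i)); rewrite size_rcons => -[e].
    by rewrite e in sw.
  apply/esym/eqP; apply: contraT => /eqP/(hom_size (cubic_hom j)) -[e].
  by rewrite e in sw.
case: w sw => [//|t [//|t' [|//]]] _; rewrite [LHS]cubic_val [RHS]cubic_val /cmat.
elim/ord2P: i; elim/ord2P: j; elim/ord2P: t; elim/ord2P: t';
  rewrite X2E Y2E /= ?eqE /=; ring.
Qed.

Lemma relmx_cubic p q i j : relmx rc [:: p; q] i j = cmat (p X2) (p Y2) (q X2) (q Y2) i j.
Proof.
rewrite mxE /= /ctr fser_sum sum2 !fserZ /lder !fser_sum !sum2 !fserZ !cubic_val /cmat.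
elim/ord2P: i; elim/ord2P: j; rewrite X2E Y2E /= ?eqE /=; ring.
Qed.

Hypothesis gen : generic (Cubic a b c).

Lemma cubic_neq0 : [/\ a != 0, b != 0 & c != 0].
Proof.
by case: gen => /eqP; rewrite !mulf_eq0 !negb_or => /andP[/andP[-> ->] ->] _.
Qed.

Lemma cubic_bc : b ^+ 2 != c ^+ 2. Proof. by case: gen => _ [/eqP]. Qed.

(** The entries form two linear systems, in [x0 x1, y0 y1] and in [x0 y1, y0 x1], with determinants
    [a^2 - c^2] and [a^2 - b^2] up to sign; as [b^2] and [c^2] differ, one is nonsingular. Both
    points are then coordinate points, and the other system contradicts [b] or [c] being nonzero. *)
Lemma cubic_rank p q : nzp p -> nzp q -> (1 <= \rank (relmx rc [:: p; q]))%N.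
Proof.
move=> np nq; rewrite lt0n mxrank_eq0; apply/negP => /eqP M0.
have [a0 b0 c0] := cubic_neq0.
have M i j : cmat (p X2) (p Y2) (q X2) (q Y2) i j = 0 by rewrite -relmx_cubic M0 mxE.
move: (nzp2 np) (nzp2 nq) M; move: (p X2) (p Y2) (q X2) (q Y2) => x0 y0 x1 y1 n0 n1 M.
have := M X2 X2; have := M X2 Y2; have := M Y2 X2; have := M Y2 Y2.
rewrite !cmatE => {M} e4 e3 e2 e1.
have m0 (e f : C) : e != 0 -> e * f = 0 -> f = 0.
  by move=> e0 /eqP; rewrite mulf_eq0 (negPf e0) => /eqP.
have xor (u v : C) : u * v = 0 -> u != 0 -> v = 0.
  by move=> + u0; apply: m0.
have [ac|ac] := eqVneq (a ^+ 2) (c ^+ 2).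
  have ab : a ^+ 2 - b ^+ 2 != 0 by rewrite subr_eq0 ac eq_sym cubic_bc.
  have f1 : y0 * x1 = 0.
    apply: (m0 _ _ ab); transitivity (a * (b * x0 * y1 + a * y0 * x1) - b * (b * y0 * x1 + a * x0 * y1)); first by ring.
    by rewrite e3 e2; ring.
  have f2 : x0 * y1 = 0.
    apply: (m0 _ _ ab); transitivity (a * (b * y0 * x1 + a * x0 * y1) - b * (b * x0 * y1 + a * y0 * x1)); first by ring.
    by rewrite e3 e2; ring.
  have [x00|x00] := eqVneq x0 0.
    have y00 : y0 != 0 by move: n0; rewrite x00 eqxx.
    have x10 := xor _ _ f1 y00.
    have y10 : y1 != 0 by move: n1; rewrite x10 eqxx.
    by move: e4; rewrite x00 mulr0 mul0r add0r => /eqP; rewrite !mulf_eq0 (negPf c0) (negPf y00) (negPf y10).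
  have y10 := xor _ _ f2 x00.
  have x10 : x1 != 0 by move: n1; rewrite y10 eqxx orbF.
  by move: e1; rewrite y10 mulr0 add0r => /eqP; rewrite !mulf_eq0 (negPf c0) (negPf x00) (negPf x10).
have {}ac : a ^+ 2 - c ^+ 2 != 0 by rewrite subr_eq0.
have f1 : x0 * x1 = 0.
  apply: (m0 _ _ ac); transitivity (a * (a * x0 * x1 + c * y0 * y1) - c * (a * y0 * y1 + c * x0 * x1)); first by ring.
  by rewrite e4 e1; ring.
have f2 : y0 * y1 = 0.
  apply: (m0 _ _ ac); transitivity (a * (a * y0 * y1 + c * x0 * x1) - c * (a * x0 * x1 + c * y0 * y1)); first by ring.
  by rewrite e4 e1; ring.
have [x00|x00] := eqVneq x0 0.
  have y00 : y0 != 0 by move: n0; rewrite x00 eqxx.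
  have y10 := xor _ _ f2 y00.
  have x10 : x1 != 0 by move: n1; rewrite y10 eqxx orbF.
  by move: e2; rewrite x00 mulr0 mul0r addr0 => /eqP; rewrite !mulf_eq0 (negPf b0) (negPf y00) (negPf x10).
have x10 := xor _ _ f1 x00.
have y10 : y1 != 0 by move: n1; rewrite x10 eqxx.
by move: e3; rewrite x10 mulr0 addr0 => /eqP; rewrite !mulf_eq0 (negPf b0) (negPf x00) (negPf y10).
Qed.

(** The equation of the point scheme [E], a curve of bidegree [(2, 2)] in the product of two
    projective lines. *)
Lemma det_cubic p q : \det (relmx rc [:: p; q]) =
  a * c * ((p X2 * q X2) ^+ 2 + (p Y2 * q Y2) ^+ 2) - a * b * ((p X2 * q Y2) ^+ 2 + (p Y2 * q X2) ^+ 2)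
  + (c ^+ 2 - b ^+ 2) * (p X2 * p Y2 * q X2 * q Y2).
Proof. rewrite det2 !relmx_cubic !cmatE; ring. Qed.

Lemma point_on_line (l : fser 2) : exists2 p, nzp p & ev [:: p] l = 0.
Proof.
have [lx|lx] := eqVneq (l [:: X2]) 0.
  exists (pt2 1 0); first by rewrite nzp_pt2 ?oner_eq0.
  by rewrite ev1 sum2 !pt2E lx; ring.
exists (pt2 (- l [:: Y2]) (l [:: X2])); first by rewrite nzp_pt2 // lx orbT.
by rewrite ev1 sum2 !pt2E; ring.
Qed.

Lemma cubic_line_meets (l : fser 2) : hom 1 l -> l != 0 ->
  exists p ps, [/\ size (p :: ps) = 2%N, all (@nzp 2) (p :: ps),
                    \det (relmx rc (p :: ps)) = 0 & ev [:: p] l = 0].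
Proof.
move=> hl l0; have [p np lp] := point_on_line l.
suff [q nq dq] : exists2 q, nzp q & \det (relmx rc [:: p; q]) = 0.
  by exists p, [:: q]; rewrite /= np nq.
pose d2 := a * c * p X2 ^+ 2 - a * b * p Y2 ^+ 2.
have [d0|d0] := eqVneq d2 0.
  exists (pt2 1 0); first by rewrite nzp_pt2 ?oner_eq0.
  by rewrite det_cubic !pt2E -[RHS]d0 /d2; ring.
pose d1 := (c ^+ 2 - b ^+ 2) * (p X2 * p Y2).
pose e0 := a * c * p Y2 ^+ 2 - a * b * p X2 ^+ 2.
have [t tE] := @monic_root 2 (fun i => - (nth 0 [:: e0; d1] i) / d2) isT.
exists (pt2 t 1); first by rewrite nzp_pt2 ?oner_eq0 ?orbT.
transitivity (d2 * t ^+ 2 + d1 * t + e0); first by rewrite det_cubic !pt2E /d2 /d1 /e0; ring.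
rewrite tE !big_ord_recl big_ord0 /= /bump /= ?addn0 expr0 expr1 mulr1 addr0.
by field.
Qed.

(** Contraction with a zero [q] of [l] kills the product; by cyclic invariance the contracted
    combination has the entries of [relmx rc [:: e; q]] as coefficients, with [e] read as a point,
    and this matrix is nonzero. *)
Lemma cubic_indecomp (e : 'I_2 -> C) (l v : fser 2) : hom 1 l -> hom 2%:Z v ->
  \sum_(j < 2) e j *: (nth (@fa0 2) rc j : fser 2) = l * v -> forall j, e j = 0.
Proof.
move=> hl hv E j; apply/eqP; apply: contraT => ej.
have [q nq lq] := point_on_line l.
have ne : nzp e by apply/existsP; exists j.
have := cubic_rank ne nq; rewrite lt0n mxrank_eq0 => /eqP[]; apply/matrixP => i i'.
rewrite [RHS]mxE.
have /(congr1 (fun p : fser 2 => ctr q p [:: i'; i])) := E.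
rewrite ctrM (hom_nil hl) // scale0r add0r.
have -> : ctr q l = 0.
  by rewrite (hom0_scalar (hom_ctr q hl)) -[ctr q l [::]]/(ev [:: q] l) lq scale0r.
rewrite mul0r fser0 => <-; rewrite relmx_cubic.
rewrite /ctr fser_sum sum2 !fserZ /lder !sum2 !fserD !fserZ !cubic_val /cmat.
elim/ord2P: i; elim/ord2P: i'; rewrite X2E Y2E /= ?eqE /=; ring.
Qed.

Lemma cubic_elliptic : elliptic 2 rc.
Proof.
split=> //.
- exact: cubic_hom.
- exact: cubic_cyc.
- by move=> [|p [|q [|//]]] //= _; rewrite andbT => /andP[np nq]; apply: cubic_rank.
- exact: cubic_line_meets.
- exact: line_decomp2.
exact: cubic_indecomp.
Qed.

End CubicAlg.

(** * Explicit orbits and central elements of cubic algebras *)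

Lemma sqrt_exists (b : C) : exists B : C, B ^+ 2 = b.
Proof.
have [t] := @monic_root 2 (fun i => nth 0 [:: b] i) isT.
rewrite !big_ord_recl big_ord0 /bump /= => E; exists t; rewrite E expr0; ring.
Qed.

Lemma ev3 k (p q r : point k) (h : fser k) :
  ev [:: p; q; r] h = \sum_i \sum_j \sum_t p i * q j * r t * h [:: i; j; t].
Proof.
rewrite -[LHS]/(ev [:: q; r] (ctr p h)) ev2.
transitivity (\sum_j \sum_i \sum_t p i * q j * r t * h [:: i; j; t]); last by rewrite exchange_big.
apply: eq_bigr => j _; rewrite exchange_big; apply: eq_bigr => t _.
rewrite /ctr fser_sum mulr_sumr; apply: eq_bigr => i _; rewrite fserZ /lder; ring.
Qed.

Lemma hom3_ext k (p q : fser k) : hom 3 p -> hom 3 q ->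
  (forall i j t, p [:: i; j; t] = q [:: i; j; t]) -> p = q.
Proof.
move=> hp hq E; apply/funext => w; have [sw|sw] := eqVneq (size w) 3%N.
  by case: w sw => [|i [|j [|t []]]].
transitivity (0 : C); first by apply/eqP; apply: contraT => /eqP/(hom_size hp) [] /eqP; rewrite (negPf sw).
by apply/esym/eqP; apply: contraT => /eqP/(hom_size hq) [] /eqP; rewrite (negPf sw).
Qed.

Section CubicTorsion.
Variables a b c : C.
Hypothesis gen : generic (Cubic a b c).
Notation rc := (rels (Cubic a b c) : seq (fa 2)).
Notation Id := (idl rc).
Let ell := cubic_elliptic gen.
Let ks : (2, 2)%N = (3, 1)%N \/ (2, 2)%N = (2, 2)%N := or_intror erefl.

Definition cwin (p q r : point 2) :=
  (a * p Y2 * q Y2 + c * p X2 * q X2) * r X2 + (b * p Y2 * q X2 + a * p X2 * q Y2) * r Y2 = 0 /\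
  (b * p X2 * q Y2 + a * p Y2 * q X2) * r X2 + (a * p X2 * q X2 + c * p Y2 * q Y2) * r Y2 = 0.

Lemma cwinP p q r : cwin p q r <-> forall j : 'I_2, ev [:: p; q; r] (nth (@fa0 2) rc j : fser 2) = 0.
Proof.
have E (j : 'I_2) : ev [:: p; q; r] (nth (@fa0 2) rc j : fser 2) =
    cmat a b c (p X2) (p Y2) (q X2) (q Y2) j X2 * r X2 + cmat a b c (p X2) (p Y2) (q X2) (q Y2) j Y2 * r Y2.
  by rewrite -[[:: p; q; r]]/(rcons [:: p; q] r) ev_rcons_rel sum2 !relmx_cubic.
split=> [[e1 e2]|H]; first by elim/ord2P; rewrite E !cmatE.
by split; [have := H X2 | have := H Y2]; rewrite E !cmatE.
Qed.

Variable g : fser 2.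
Hypothesis cg : @central_elt (Cubic a b c) g.

Lemma cubic_g_hom : hom 4%:Z g. Proof. by case: cg => _ hg _ _. Qed.
Lemma cubic_g_nId : ~ Id g. Proof. by case: cg. Qed.
Lemma cubic_g_central (i : 'I_2) : Id (x i * g - g * x i). Proof. by case: cg => _ _ _; apply. Qed.

Lemma cubic_chain q0 q1 q2 q3 q4 : all (@nzp 2) [:: q0; q1; q2; q3; q4] ->
  cwin q0 q1 q2 -> cwin q1 q2 q3 -> cwin q2 q3 q4 -> q4 X2 * q0 Y2 - q4 Y2 * q0 X2 != 0 ->
  exists P, [/\ chain 2 rc P, seg P 5 = [:: q0; q1; q2; q3; q4], ev (seg P 4) g = 0 &
    ev (seg (shift 1 P) 4) g = 0].
Proof.
move=> nq w0 w1 w2 np.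
have W i : (i + 3 <= 5)%N -> forall j : 'I_2,
    ev (take 3 (drop i [:: q0; q1; q2; q3; q4])) (nth (@fa0 2) rc j : fser 2) = 0.
  by case: i => [|[|[|i]]]; [move=> _; apply/cwinP | move=> _; apply/cwinP | move=> _; apply/cwinP | lia].
have [P cP sP] := @chain_ext 2 2 rc ell [:: q0; q1; q2; q3; q4] isT nq W.
have [|g0 g1] := central_vanish ell cubic_g_hom cubic_g_central cP; last by exists P.
have [e0 e4] : P 0%N = q0 /\ P 4%N = q4 by case: sP.
by move=> [ka ke]; case/eqP: np; rewrite -e4 -e0 !ke; ring.
Qed.

(** The points that can follow [(1 : 0)] in a chain are [(B : G)] and [(B : -G)], whence the square
    roots. *)
Variables B G : C.
Hypotheses (Bb : B ^+ 2 = b) (Gc : G ^+ 2 = c).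

(* Five consecutive points of the orbit through [(1 : 0)]; changing the sign of [e] reverses
   the orbit. *)
Definition cp (e : C) (n : nat) : point 2 :=
  match n with
  | 0 => pt2 1 0
  | 1 => pt2 B (e * G)
  | 2 => pt2 a (- (e * B * G))
  | _ => pt2 (B * (a ^+ 2 - c ^+ 2)) (e * G * (b ^+ 2 - a ^+ 2))
  end.

Arguments cp : simpl never.

Definition swp (p : point 2) := pt2 (p Y2) (p X2).

Lemma cwin_swp p q r : cwin p q r -> cwin (swp p) (swp q) (swp r).
Proof. by rewrite /cwin /swp !pt2E => -[e1 e2]; split; [rewrite -[RHS]e2 | rewrite -[RHS]e1]; ring. Qed.

Lemma nzp_swp p : nzp p -> nzp (swp p).
Proof. by move/nzp2 => h; apply: nzp_pt2; rewrite orbC. Qed.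

Lemma BG_neq0 : B != 0 /\ G != 0.
Proof.
have [_ b0 c0] := cubic_neq0 gen; split; [apply: contraNneq b0 => e | apply: contraNneq c0 => e].
  by rewrite -Bb e expr0n.
by rewrite -Gc e expr0n.
Qed.

Section Sign.
Variable e : C.
Hypothesis e1 : e = 1 \/ e = -1.

Lemma sign_neq0 : e != 0.
Proof. by case: e1 => ->; rewrite ?oppr_eq0 oner_eq0. Qed.

Lemma cp_nz n : nzp (cp e n).
Proof.
have [a0 b0 c0] := cubic_neq0 gen; have [B0 G0] := BG_neq0.
case: n => [|[|[|n]]]; apply: nzp_pt2; rewrite ?oner_eq0 ?B0 ?a0 //.
rewrite -negb_and !mulf_eq0 (negPf B0) (negPf G0) (negPf sign_neq0) /=.
apply/negP => /andP[/eqP/subr0_eq h1 /eqP/subr0_eq h2].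
by have := cubic_bc gen; rewrite h2 h1 eqxx.
Qed.

Lemma cwin_m101 : cwin (cp (- e) 1) (cp e 0) (cp e 1).
Proof. by rewrite /cwin /cp !pt2E -Bb -Gc; case: e1 => ->; split; ring. Qed.

Lemma cwin_012 : cwin (cp e 0) (cp e 1) (cp e 2).
Proof. by rewrite /cwin /cp !pt2E -Bb -Gc; case: e1 => ->; split; ring. Qed.

Lemma cwin_123 : cwin (cp e 1) (cp e 2) (cp e 3).
Proof. by rewrite /cwin /cp !pt2E -Bb -Gc; case: e1 => ->; split; ring. Qed.

Lemma cwin_rev p q r : cwin p q r -> cwin r q p.
Proof. by rewrite /cwin => -[h1 h2]; split; [rewrite -[RHS]h1 | rewrite -[RHS]h2]; ring. Qed.

End Sign.

Lemma signN (e : C) : e = 1 \/ e = -1 -> - e = 1 \/ - e = -1.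
Proof. by case=> ->; [right | left; rewrite opprK]. Qed.

Lemma two_neq0 : (2%:R : C) != 0. Proof. exact: natr_neq0. Qed.

Lemma cp_nzs (e : C) n : e = 1 \/ e = -1 -> nzp (cp e n) /\ nzp (cp (- e) n).
Proof. by move=> e1; split; apply: cp_nz => //; apply: signN. Qed.

Lemma cubic_orbit_chain (e : C) : e = 1 \/ e = -1 ->
  exists P, [/\ chain 2 rc P, seg P 4 = [:: cp e 0; cp e 1; cp e 2; cp e 3] & ev (seg P 4) g = 0].
Proof.
move=> e1; have [a0 b0 c0] := cubic_neq0 gen; have [B0 G0] := BG_neq0.
(* The explicit chain starts one point earlier, at [cp (- e) 1], so that these five points suffice;
   the second vanishing is the one wanted. *)
have [||||| P [cP sP _ g1]] := @cubic_chain (cp (- e) 1) (cp e 0) (cp e 1) (cp e 2) (cp e 3).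
- by rewrite /= (cp_nzs 1 e1).2 !(cp_nzs _ e1).1.
- exact: cwin_m101.
- exact: cwin_012.
- exact: cwin_123.
- rewrite /cp !pt2E.
  rewrite (_ : _ - _ = e * B * G * (c ^+ 2 - b ^+ 2)); last by ring.
  have bc0 : c ^+ 2 - b ^+ 2 != 0 by rewrite subr_eq0 eq_sym (cubic_bc gen).
  by rewrite !mulf_neq0 // (sign_neq0 e1).
exists (shift 1 P); split=> //; first exact: shift_chain.
by move/(congr1 behead): sP; rewrite segS.
Qed.

Section Cofactor.
Variable h : fser 2.
Hypothesis hh : hom 3 h.
Hypotheses (yh : Id (g - x Y2 * h)) (hy : Id (g - h * x Y2)).

Lemma ev_x k (p : point k) (i : 'I_k) : ev [:: p] (x i : fser k) = p i.
Proof. by rewrite /ev /= -[x i]mulr1 ctr_xM fserZ fser1_nil mulr1. Qed.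

Lemma cofactor_vanish q0 q1 q2 q3 q4 : all (@nzp 2) [:: q0; q1; q2; q3; q4] ->
  cwin q0 q1 q2 -> cwin q1 q2 q3 -> cwin q2 q3 q4 -> q4 X2 * q0 Y2 - q4 Y2 * q0 X2 != 0 ->
  [/\ q3 Y2 != 0 -> ev [:: q0; q1; q2] h = 0, q0 Y2 != 0 -> ev [:: q1; q2; q3] h = 0 &
      q1 Y2 != 0 -> ev [:: q2; q3; q4] h = 0].
Proof.
move=> nq w0 w1 w2 np; have [P [cP sP g0 g1]] := cubic_chain nq w0 w1 w2 np.
have hY : hom 1 (x Y2 : fser 2) by apply: (hom_wd [:: Y2]).
have hyh : hom 4%:Z (x Y2 * h) by apply: homE (homM hY hh) _.
have hhy : hom 4%:Z (h * x Y2) by apply: homE (homM hh hY) _.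
have m0 (u v : C) : u * v = 0 -> u != 0 -> v = 0.
  by move=> /eqP; rewrite mulf_eq0 => /orP[-> //|/eqP].
have [s4 s4'] : seg P 4 = [:: q0; q1; q2; q3] /\ seg (shift 1 P) 4 = [:: q1; q2; q3; q4].
  split; last by move/(congr1 behead): sP; rewrite segS.
  by move: sP; rewrite /seg /mkseq /= => -[-> -> -> -> _].
split=> q_0.
- move: g0; rewrite (ev_mod ell cP cubic_g_hom hhy hy) s4 -[[:: q0; q1; q2; q3]]/([:: q0; q1; q2] ++ [:: q3]).
  by rewrite ev_mul // ev_x mulrC => /m0; apply.
- move: g0; rewrite (ev_mod ell cP cubic_g_hom hyh yh) s4 -[[:: q0; q1; q2; q3]]/([:: q0] ++ [:: q1; q2; q3]).
  by rewrite ev_mul // ev_x => /m0; apply.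
move: g1; rewrite (ev_mod ell (shift_chain 1 cP) cubic_g_hom hyh yh) s4'.
rewrite -[[:: q1; q2; q3; q4]]/([:: q1] ++ [:: q2; q3; q4]).
by rewrite ev_mul // ev_x => /m0; apply.
Qed.

(** A chain centred at [(1 : 0)] gives three windows on which [h] vanishes; exchanging the variables
    gives a fourth. *)
Lemma cubic_mid_chain (e : C) : e = 1 \/ e = -1 ->
  [/\ ev [:: cp (- e) 2; cp (- e) 1; cp e 0] h = 0, ev [:: cp (- e) 1; cp e 0; cp e 1] h = 0,
      ev [:: cp e 0; cp e 1; cp e 2] h = 0 &
      ev [:: swp (cp e 0); swp (cp e 1); swp (cp e 2)] h = 0].
Proof.
move=> e1; have [a0 b0 c0] := cubic_neq0 gen; have [B0 G0] := BG_neq0.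
have e0 := sign_neq0 e1; have ne1 := signN e1; have ne0 := sign_neq0 ne1.
have w0 : cwin (cp (- e) 2) (cp (- e) 1) (cp e 0) by apply: cwin_rev; apply: (cwin_012 ne1).
have w1 := cwin_m101 e1; have w2 := cwin_012 e1.
have np : cp e 2 X2 * cp (- e) 2 Y2 - cp e 2 Y2 * cp (- e) 2 X2 != 0.
  rewrite /cp !pt2E (_ : _ - _ = 2%:R * a * e * B * G); last by ring.
  by rewrite !mulf_neq0 ?two_neq0.
have nq : all (@nzp 2) [:: cp (- e) 2; cp (- e) 1; cp e 0; cp e 1; cp e 2].
  by rewrite /= !(cp_nzs _ e1).1 !(cp_nzs _ e1).2.
have [v0 v1 v2] := cofactor_vanish nq w0 w1 w2 np.
have nq' : all (@nzp 2) [:: swp (cp (- e) 2); swp (cp (- e) 1); swp (cp e 0); swp (cp e 1); swp (cp e 2)].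
  by rewrite /= !nzp_swp // ?(cp_nzs _ e1).1 ?(cp_nzs _ e1).2.
have np' : swp (cp e 2) X2 * swp (cp (- e) 2) Y2 - swp (cp e 2) Y2 * swp (cp (- e) 2) X2 != 0.
  rewrite /swp !pt2E; have -> : cp e 2 Y2 * cp (- e) 2 X2 - cp e 2 X2 * cp (- e) 2 Y2 =
    - (cp e 2 X2 * cp (- e) 2 Y2 - cp e 2 Y2 * cp (- e) 2 X2) by ring.
  by rewrite oppr_eq0.
have [_ _ v3] := cofactor_vanish nq' (cwin_swp w0) (cwin_swp w1) (cwin_swp w2) np'.
split; [apply: v0 | apply: v1 | apply: v2 | apply: v3]; rewrite /swp /cp !pt2E // ?oppr_eq0 ?mulf_neq0 //.
Qed.

Lemma pm_split (u v : C) : (forall e : C, e = 1 \/ e = -1 -> u + e * v = 0) -> u = 0 /\ v = 0.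
Proof.
move=> H; have h1 := H 1 (or_introl erefl); have h2 := H (-1) (or_intror erefl).
split; apply: (mulfI two_neq0); rewrite mulr0.
  by transitivity ((u + 1 * v) + (u + -1 * v)); [ring | rewrite h1 h2 addr0].
by transitivity ((u + 1 * v) - (u + -1 * v)); [ring | rewrite h1 h2 subrr].
Qed.

(** Separated into parts even and odd in the sign [e], the vanishing on these windows relates the
    eight coefficients of [h] so that they are those of a combination of the two relations. *)
Lemma cofactor_in_ideal : Id h.
Proof.
have [a0 b0 c0] := cubic_neq0 gen; have [B0 G0] := BG_neq0.
have m0 (u v : C) : u * v = 0 -> u != 0 -> v = 0.
  by move=> /eqP; rewrite mulf_eq0 => /orP[-> //|/eqP].
pose hw i j t := h [:: i; j; t].
have [/m0/(_ B0)/subr0_eq f1 /m0/(_ G0)/subr0_eq f2] :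
    B * (a * hw X2 X2 X2 - c * hw X2 Y2 Y2) = 0 /\ G * (a * hw X2 Y2 X2 - b * hw X2 X2 Y2) = 0.
  apply: pm_split => e e1; have [_ _ <- _] := cubic_mid_chain e1.
  by rewrite ev3 !sum2 /cp !pt2E -/(hw _ _ _) -Bb -Gc /hw; case: e1 => ->; ring.
have [/m0/(_ B0)/subr0_eq f3 _] :
    B * (a * hw X2 X2 X2 - c * hw Y2 Y2 X2) = 0 /\ - (G * (a * hw X2 Y2 X2 - b * hw Y2 X2 X2)) = 0.
  apply: pm_split => e e1; have [<- _ _ _] := cubic_mid_chain e1.
  by rewrite ev3 !sum2 /cp !pt2E -Bb -Gc /hw; case: e1 => ->; ring.
have [/subr0_eq f4 /m0/(_ (mulf_neq0 B0 G0))/subr0_eq f5] :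
    b * hw X2 X2 X2 - c * hw Y2 X2 Y2 = 0 /\ B * G * (hw X2 X2 Y2 - hw Y2 X2 X2) = 0.
  apply: pm_split => e e1; have [_ <- _ _] := cubic_mid_chain e1.
  by rewrite ev3 !sum2 /cp !pt2E -Bb -Gc /hw; case: e1 => ->; ring.
have [/m0/(_ B0)/subr0_eq f6 _] :
    B * (a * hw Y2 Y2 Y2 - c * hw Y2 X2 X2) = 0 /\ G * (a * hw Y2 X2 Y2 - b * hw Y2 Y2 X2) = 0.
  apply: pm_split => e e1; have [_ _ _ <-] := cubic_mid_chain e1.
  by rewrite ev3 !sum2 /swp /cp !pt2E -Bb -Gc /hw; case: e1 => ->; ring.
have f7 : b * hw Y2 Y2 Y2 = c * hw X2 Y2 X2.
  by apply: (mulfI a0); rewrite mulrCA f6 [RHS]mulrCA f2 f5 mulrCA.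
pose f n : fser 2 := nth (@fa0 2) rc n.
have -> : h = c^-1 *: (hw X2 X2 X2 *: f X2 + hw Y2 Y2 Y2 *: f Y2).
  apply: hom3_ext => //.
    by apply: homZ; apply: homD; apply: homZ; apply: cubic_hom.
  move=> i j t; apply: (mulfI c0); rewrite fserZ !fserD !fserZ mulVKf // /f !cubic_val -/(hw i j t).
  rewrite f5 in f2 *.
  elim/ord2P: i; elim/ord2P: j; elim/ord2P: t; rewrite !cmatE -?f1 -?f3 -?f4 ?f5 -?f6 -?f7 ?eqxx;
    rewrite /hw X2E Y2E /= ?eqE /=; ring.
apply: IdZ; apply: IdD; apply: IdZ; exact: Id_rel.
Qed.

End Cofactor.

Lemma cubic_not_divisible : ~ lineI rc (x Y2) 4%:Z g.
Proof.
have hY : hom 1 (x Y2 : fser 2) by apply: (hom_wd [:: Y2]).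
move/(central_cofactor ell ks cubic_g_central hY (x_neq0 Y2)) => [h [hh yh hy]].
have {}hh : hom 3 h by apply: homE hh _.
have Ih := cofactor_in_ideal hh yh hy.
apply: cubic_g_nId; rewrite -[g](subrK (h * x Y2)); apply: (IdD hy); apply: Id_homr hY Ih.
Qed.

Lemma cubic_line_torsion_free_sqrt d v : hom d v -> lineI rc (x Y2) (d + 4%:Z) (v * g) ->
  lineI rc (x Y2) d v.
Proof.
have hx i : hom 1 (x i : fser 2) by apply: (hom_wd [:: i]).
have [B0 G0] := BG_neq0.
pose e i : C := (-1) ^+ i.
have e1 i : e i = 1 \/ e i = -1.
  rewrite /e; elim: i => [|i IH]; first by left; rewrite expr0.
  by rewrite exprS mulN1r; apply: signN.
have /choice[P HP] : forall i, exists P, [/\ chain 2 rc P,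
    seg P 4 = [:: cp (e i) 0; cp (e i) 1; cp (e i) 2; cp (e i) 3] & ev (seg P 4) g = 0].
  by move=> i; apply: cubic_orbit_chain.
have P01 i : P i 0%N = pt2 1 0 /\ P i 1%N = pt2 B (e i * G).
  by have [_ + _] := HP i; rewrite /seg /mkseq /= => -[-> -> _ _].
apply: (line_torsion_free ell ks cubic_g_hom cubic_g_central (T := 2) (P := P)) => //.
- by move=> i _; have [cP _ _] := HP i; rewrite (P01 i).1 ev_x pt2E.
- move=> i j ij; have [-> ->] : i = 0%N /\ j = 1%N by lia.
  rewrite mul0n !shift0.
  (* Both chains start at [(1 : 0)] and differ at the second point; the form is nonzero at the first
     and vanishes at [(B : G)] in the second. *)
  exists (x X2 * (G *: x X2 - B *: x Y2)); split.
  + by apply: (homMd (hx _)); apply: homB; apply: homZ.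
  + rewrite /seg /mkseq /= -[[:: _; _]]/([:: P 0%N 0%N] ++ [:: P 0%N 1%N]) ev_mul //.
    by rewrite evB !evZ !ev_x !(P01 _).1 !(P01 _).2 !pt2E /e expr0; ring.
  rewrite /seg /mkseq /= -[[:: _; _]]/([:: P 1%N 0%N] ++ [:: P 1%N 1%N]) ev_mul //.
  rewrite evB !evZ !ev_x !(P01 _).1 !(P01 _).2 !pt2E /e expr1; apply/eqP.
  by rewrite (_ : _ * _ = 2%:R * B * G); [rewrite !mulf_neq0 ?two_neq0 | ring].
- exact: x_neq0.
- by move=> i _; case: (HP i).
exact: cubic_not_divisible.
Qed.

End CubicTorsion.

(** * Counting dimensions of cokernels *)

Section Growth.
Variable s : nat.
Hypothesis s12 : s = 1%N \/ s = 2%N.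

Lemma lam_bounds (n : nat) : (n.+1 <= 2 * lam s n <= 2 * n.+1)%N.
Proof. by case: s12 => ->; rewrite /lam; lia. Qed.

Lemma hilbS (n : nat) : hilb s n.+1 = (hilb s n + lam s n.+1)%N.
Proof. by rewrite /hilb big_ord_recr. Qed.

Lemma hilb0 : hilb s 0%N = 1%N.
Proof. by rewrite /hilb big_ord_recl big_ord0 /lam div0n. Qed.

Lemma hilb_le (n : nat) : (hilb s n <= n.+1 ^ 2)%N.
Proof.
elim: n => [|n IH]; first by rewrite hilb0.
by rewrite hilbS; have := lam_bounds n.+1; rewrite -[n.+2]addn1 sqrnD; lia.
Qed.

Lemma hilb_ge (n : nat) : (n.+1 ^ 2 <= 4 * hilb s n)%N.
Proof.
suff : (n.+1 * n.+2 <= 4 * hilb s n)%N by rewrite -mulnn; nia.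
elim: n => [|n IH]; first by rewrite hilb0.
by rewrite hilbS; have := lam_bounds n.+1; nia.
Qed.

(* The dimension of [A_{<= d}]. *)
Definition chilb (d : int) : nat := if d is Posz n then (\sum_(i < n.+1) hilb s i)%N else 0%N.

Lemma chilbS (n : nat) : chilb n.+1 = (chilb n + hilb s n.+1)%N.
Proof. by rewrite /chilb big_ord_recr. Qed.

Lemma chilb_ge (n : nat) : (n.+1 ^ 3 <= 12 * chilb n)%N.
Proof.
elim: n => [|n IH].
  by rewrite /chilb big_ord_recl big_ord0 hilb0.
have cubeS m : (m.+1 ^ 3 = m ^ 3 + 3 * m ^ 2 + 3 * m + 1)%N.
  by rewrite -addn1 !expnS expn0; lia.
have := hilb_ge n.+1; rewrite chilbS cubeS -[n.+2]addn1 sqrnD; lia.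
Qed.

Lemma chilb_mono (d e : int) : d <= e -> (chilb d <= chilb e)%N.
Proof.
case: d => // m; case: e => // n; rewrite lez_nat => mn.
elim: n mn => [|n IH]; first by rewrite leqn0 => /eqP ->.
rewrite leq_eqVlt => /orP[/eqP -> //|]; rewrite ltnS => /IH h.
by rewrite chilbS (leq_trans h) // leq_addr.
Qed.

Lemma chilb_diff (n t : nat) : (chilb (n + t)%N <= chilb n + t * (n + t).+1 ^ 2)%N.
Proof.
elim: t => [|t IH]; first by rewrite addn0 mul0n addn0.
rewrite addnS chilbS; have := hilb_le (n + t).+1.
have : ((n + t).+1 ^ 2 <= (n + t).+2 ^ 2)%N by rewrite leq_sqr.
by nia.
Qed.

(** [chilb] grows cubically and its increments only quadratically, so one more copy wins over any
    bounded shift. *)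
Lemma chilb_gap (N p : nat) : exists t : nat, (p * chilb (t + 2 * N)%N < p.+1 * chilb t)%N.
Proof.
(* [2 * N] ensures [T + 2 * N <= 2 * T]. The factor [97] beats [96 = 12 * 2 * 4], from the [12] in
   [chilb_ge] and the increment [2 * N * (2 * T) ^ 2]. *)
pose T := (97 * N * p + 2 * N + 1)%N; exists T.-1.
have h1 := chilb_ge T.-1; have h2 := chilb_diff T.-1 (2 * N).
have TT : T.-1.+1 = T by rewrite /T addn1.
rewrite -addSn TT in h1 h2.
have h3 : ((T + 2 * N) ^ 2 <= 4 * T ^ 2)%N.
  by rewrite -[4%N]/(2 ^ 2)%N -expnMn leq_sqr /T; lia.
have h4 : (p * (2 * N * (T + 2 * N) ^ 2) < chilb T.-1)%N.
  have : (12 * (p * (2 * N * (4 * T ^ 2))) < T ^ 3)%N.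
    rewrite [(T ^ 3)%N]expnS; have -> : (12 * (p * (2 * N * (4 * T ^ 2))) = 96 * N * p * T ^ 2)%N by lia.
    by rewrite ltn_pmul2r ?expn_gt0 /T ?addn1 //; lia.
  have : (p * (2 * N * (T + 2 * N) ^ 2) <= p * (2 * N * (4 * T ^ 2)))%N by rewrite !leq_mul2l h3 !orbT.
  by lia.
have : (p * chilb (T.-1 + 2 * N)%N <= p * (chilb T.-1 + 2 * N * (T + 2 * N) ^ 2))%N by rewrite leq_mul2l h2 orbT.
by rewrite mulnDr mulSn; lia.
Qed.

End Growth.

(** * Truncation by degree and graded free modules *)

Section Truncation.
Variable k : nat.
Implicit Types (p q u v : fser k) (d e : int).

Definition trunc d p : fser k := fun w => if (size w)%:Z <= d then p w else 0.

Lemma trunc_is_linear d : linear (trunc d).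
Proof.
move=> a p q; apply/funext => w; rewrite fserD fserZ /trunc fserD fserZ.
by case: ifP; rewrite ?mulr0 ?addr0.
Qed.
HB.instance Definition _ d := GRing.isLinear.Build C (fser k) (fser k) _ (trunc d) (trunc_is_linear d).

Definition ledeg d p := trunc d p = p.

Lemma ledeg_subspace d : subspace (ledeg d).
Proof.
split=> [|a u v hu hv]; first exact: linear0.
by rewrite /ledeg trunc_is_linear hu hv.
Qed.

Lemma ledeg_trunc d p : ledeg d (trunc d p).
Proof. by apply/funext => w; rewrite /trunc; case: ifP => // ->. Qed.

Lemma ledegP d p : ledeg d p <-> forall w, p w <> 0 -> (size w)%:Z <= d.
Proof.
split=> [<- w|H]; first by rewrite /trunc; case: ifP.
apply/funext => w; rewrite /trunc; case: ifP => // /negP sw.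
by apply/esym/eqP/negP => /negP/eqP/H.
Qed.

Lemma ledeg_neg d p : ledeg d p -> d < 0 -> p = 0.
Proof.
move=> <- d0; apply/funext => w; rewrite /trunc ifF //.
by apply/negbTE; rewrite -ltNge; apply: lt_le_trans d0 _.
Qed.

Lemma ledeg_fin d p : ledeg d p -> fa_fin p.
Proof.
move=> /ledegP H; exists `|d|%N => w sw; apply/eqP/negP => /negP/eqP/H; lia.
Qed.

Lemma trunc_mull d e p q : hom e p -> trunc d (p * q) = p * trunc (d - e) q.
Proof.
move=> hp; apply/funext => w; rewrite /trunc !fserM.
have E i : p (take i w) * trunc (d - e) q (drop i w) =
    if (size w)%:Z <= d then p (take i w) * q (drop i w) else 0.
  have [->|/eqP/(hom_size hp) sp] := eqVneq (p (take i w)) 0; first by rewrite !mul0r if_same.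
  rewrite /trunc -sp lerBrDl -size_take_drop; by case: ifP; rewrite ?mulr0.
by rewrite /fa_mul; under [RHS]eq_bigr => i _ do rewrite E; case: ifP => // _; rewrite big1.
Qed.

Lemma hom_ledeg e d p : hom e p -> e <= d -> ledeg d p.
Proof. by move=> hp ed; apply/ledegP => w /(hom_size hp) ->. Qed.

Lemma trunc_hom_gt e d p : hom e p -> d < e -> trunc d p = 0.
Proof.
move=> hp de; apply/funext => w; rewrite /trunc fser0; case: ifP => // sw.
by apply/eqP/negP => /negP/eqP/(hom_size hp) es; move: sw; rewrite es leNgt de.
Qed.

Variable rl : seq (fa k).
Variable r : nat.
Hypothesis rl_hom : forall n, hom r%:Z (nth (@fa0 k) rl n).
Hypothesis r_gt0 : (0 < r)%N.
Notation Id := (idl rl).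

Lemma Id_trunc d p : Id p -> Id (trunc d p).
Proof.
move=> Ip; have [B pE] := fin_hcomp (Id_fin rl_hom Ip).
rewrite pE linear_sum; apply: Id_sum => e /=.
have [ed|de] := lerP e%:Z d.
  by rewrite (hom_ledeg (hom_hcomp _ _) ed); apply: (Id_hcomp rl_hom).
by rewrite (trunc_hom_gt (hom_hcomp _ _) de); apply: Id0.
Qed.

Variable s : nat.
Hypothesis hilbert_fn : forall d, qdim (hom d) Id (hilb s d).

Lemma ledeg_qdim d : qdim (ledeg d) Id (chilb s d).
Proof.
case: d => n; last first.
  exists (fun=> 0); first by move=> a u v; rewrite scaler0 addr0.
  split=> [v hv|w]; last by exists 0; [exact: linear0 | apply/rowP => -[]].
  by rewrite (ledeg_neg hv) //; split=> // _; apply: Id0.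
rewrite /chilb; apply: (@qdim_family _ _ (fser k) (fser k) _ _ (fun (e : 'I_n.+1) v => hcomp e%:Z v)
  (fun e : 'I_n.+1 => hom (e : nat)%:Z) (fun=> Id) (fun e : 'I_n.+1 => hilb s (e : nat)%:Z)) => //.
- by move=> e; apply: hcomp_is_linear.
- by move=> e v _; apply: hom_hcomp.
- move=> v hv; split=> [Iv e|H]; first exact: (Id_hcomp rl_hom).
  apply: Id_hcompP => [|d]; first exact: ledeg_fin hv.
  have [dn|nd] := ltnP d n.+1; first exact: (H (Ordinal dn)).
  suff -> : hcomp d%:Z v = 0 by apply: Id0.
  rewrite -hv; apply/funext => w; rewrite /hcomp /trunc fser0; case: eqP => // ->.
  by rewrite ifF //; lia.
move=> F hF; exists (\sum_e F e).
  by apply: subspace_sum (ledeg_subspace _) _ => e; apply: (hom_ledeg (hF e)); have := ltn_ord e; lia.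
move=> e; rewrite linear_sum (bigD1 e) //= hcomp_id // big1 ?addr0 // => e' ne.
by apply: (hcomp_other (hF e')); rewrite eqz_nat eq_sym.
Qed.

(** The part of degree at most [d] of a free module with generators in degrees [dg]; [B] selects a
    direct summand. *)
Definition fmod (S : finType) (dg : S -> int) (B : pred S) d (v : {ffun S -> fser k}) :=
  forall t, if B t then ledeg (d - dg t) (v t) else v t = 0.

Lemma fmod_subspace (S : finType) (dg : S -> int) B d : subspace (fmod dg B d).
Proof.
split=> [t|a u v hu hv t]; rewrite !ffunE.
  by case: ifP => // _; case: (ledeg_subspace (d - dg t)).
have := hu t; have := hv t; case: ifP => _; last by move=> -> ->; rewrite scaler0 addr0.
by move=> h1 h2; case: (ledeg_subspace (d - dg t)) => _; apply.
Qed.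

Definition fideal (S : finType) (v : {ffun S -> fser k}) := forall t, Id (v t).

Lemma fideal_subspace (S : finType) : subspace (@fideal S).
Proof.
split=> [t|a u v hu hv t]; rewrite !ffunE; first exact: Id0.
by apply: IdD => //; apply: IdZ.
Qed.

Lemma fmod_qdim (S : finType) (dg : S -> int) (B : pred S) d :
  qdim (fmod dg B d) (@fideal S) (\sum_(t | B t) chilb s (d - dg t))%N.
Proof.
rewrite big_mkcond /=.
apply: (@qdim_family _ _ _ _ _ _ (fun (t : S) (v : {ffun S -> fser k}) => v t)
  (fun t => if B t then ledeg (d - dg t) else (fun v => v = 0)) (fun=> Id)
  (fun t => if B t then chilb s (d - dg t) else 0%N)).
- move=> t; case: (B t); first exact: ledeg_qdim.
  exists (fun=> 0); first by move=> a u v; rewrite scaler0 addr0.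
  split=> [v ->|w]; first by split=> // _; apply: Id0.
  by exists 0 => //; apply/rowP => -[].
- by move=> t a u v; rewrite !ffunE.
- by move=> t v /(_ t); case: (B t).
- by [].
move=> F hF; exists (finfun F) => t; rewrite ffunE //.
by have := hF t; case: (B t).
Qed.

End Truncation.

Section Cokernel.
Variables (k s r m n : nat) (rl : seq (fa k)).
Hypothesis rl_hom : forall n, hom r%:Z (nth (@fa0 k) rl n).
Hypothesis r_gt0 : (0 < r)%N.
Notation Id := (idl rl).
Hypothesis hilbert_fn : forall d, qdim (hom d) Id (hilb s d).
Variables (da : 'I_m -> int) (db : 'I_n -> int) (phi : 'I_m -> 'I_n -> fser k).
Hypothesis hphi : forall al be, hom (db be - da al) (phi al be).
Notation EA := {ffun 'I_m -> fser k}.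
Notation EB := {ffun 'I_n -> fser k}.

Definition phimap (v : EB) : EA := [ffun al => \sum_be phi al be * v be].

Lemma phimap_linear : linear phimap.
Proof.
move=> a u v; apply/ffunP => al; rewrite !ffunE scaler_sumr -big_split /=.
by apply: eq_bigr => be _; rewrite !ffunE mulrDr -scalerAr.
Qed.

Definition finite_vec (v : EB) := forall be, fa_fin (v be).

Lemma finite_vec_subspace : subspace finite_vec.
Proof.
split=> [be|a u v hu hv be]; rewrite !ffunE; first by exists 0%N.
have [B1 h1] := hu be; have [B2 h2] := hv be; exists (maxn B1 B2) => w.
by rewrite gtn_max fserD fserZ => /andP[s1 s2]; rewrite h1 // h2 // mulr0 addr0.
Qed.

Definition image (x : EA) := exists2 v : EB, finite_vec v & fideal rl (x - phimap v).

Lemma image_subspace : subspace image.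
Proof.
split; first exists 0; first by case: finite_vec_subspace.
  by rewrite (linear0_fun phimap_linear) subr0; case: (fideal_subspace rl 'I_m).
move=> a x y [u hu Iu] [v hv Iv]; exists (a *: u + v); first by case: finite_vec_subspace => _; apply.
rewrite phimap_linear opprD addrACA -scalerBr.
by case: (fideal_subspace rl 'I_m) => _; apply.
Qed.

Definition injective_mod := forall v, finite_vec v -> fideal rl (phimap v) -> fideal rl v.

Definition coker_ge (d : int) (N : nat) := exists2 xs : 'I_N -> EA,
  (forall i, fmod da predT d (xs i)) & indep image xs.

Lemma phimap_fmod (BX : pred 'I_n) (BY : pred 'I_m) d v :
  (forall al be, BX be -> ~~ BY al -> phi al be = 0) ->
  fmod db BX d v -> fmod da BY d (phimap v).
Proof.
move=> H hv al; rewrite ffunE; case: ifP => hal; last first.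
  rewrite big1 // => be _; have := hv be; case: ifP => hbe; last by move=> ->; rewrite mulr0.
  by rewrite H ?hal // mul0r.
apply: subspace_sum (ledeg_subspace _ _) _ => be.
have := hv be; case: ifP => _; last first.
  by move=> ->; rewrite mulr0; case: (ledeg_subspace k (d - da al)).
by move=> lv; rewrite /ledeg (trunc_mull _ _ (hphi al be)) (_ : _ - _ = d - db be) ?lv //; lia.
Qed.

Lemma coker_lower d : exists2 N, coker_ge d N &
  (\sum_al chilb s (d - da al) <= N + \sum_be chilb s (d - db be))%N.
Proof.
have qA := fmod_qdim rl_hom r_gt0 hilbert_fn da predT d.
have qB := fmod_qdim rl_hom r_gt0 hilbert_fn db predT d.
have sA := @fmod_subspace k _ da predT d; have sB := @fmod_subspace k _ db predT d.
have [z qz] : exists z, qdim (fmod da predT d) image z.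
  case: (qA) => pi lpi [kpi spi]; apply: (qdim_exists lpi sA image_subspace _ spi) => v hv /kpi.
  move=> /(_ hv) Iv; exists 0; first by case: finite_vec_subspace.
  by rewrite (linear0_fun phimap_linear) subr0.
have [b ib hb] := qdim_indep qz sA.
exists z; first by exists b.
case: (qz) => J lJ [kJ _]; rewrite addnC.
have e (T : 'I_0 -> Prop) i : T i by case: i.
have := @exact_count _ _ _ _ _ _ _ _ _ z 0 phimap J (fun=> 0) sB sA qB qA phimap_linear lJ.
rewrite add0n /=; apply=> [v hv|v _ Iv|v hv Jv|||]; try exact: e.
- by apply: phimap_fmod hv.
- move=> al; rewrite ffunE; apply: Id_sum => be; exact: Id_homl (hphi al be) (Iv be).
(* The preimage [u] may have components of large degree; [phi] being homogeneous, truncating it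
   changes nothing in degrees at most [d]. *)
- have [u fu Iu] := (kJ v hv).1 Jv.
  exists [ffun be => trunc (d - db be) (u be)].
    by move=> be /=; rewrite ffunE; apply: ledeg_trunc.
  move=> al; have := Id_trunc rl_hom (d - da al) (Iu al).
  rewrite !ffunE linearB linear_sum /= (hv al); congr (Id (_ - _)).
  apply: eq_bigr => be _; rewrite ffunE (trunc_mull _ _ (hphi al be)); congr (_ * trunc _ _); lia.
by move=> c _; apply: e.
Qed.

Hypothesis inj : injective_mod.

Lemma fmod_finite B d v : fmod db B d v -> finite_vec v.
Proof.
move=> hv be; have := hv be; case: ifP => _; first exact: ledeg_fin.
by move=> ->; exists 0%N.
Qed.

Lemma inj_mask (BX : pred 'I_n) (BY : pred 'I_m) d :
  (forall al be, BX be -> ~~ BY al -> phi al be = 0) ->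
  (\sum_(be | BX be) chilb s (d - db be) <= \sum_(al | BY al) chilb s (d - da al))%N.
Proof.
move=> H; have sB := @fmod_subspace k _ db BX d.
have [b ib hb] := qdim_indep (fmod_qdim rl_hom r_gt0 hilbert_fn db BX d) sB.
apply: (indep_le (g := fun i => phimap (b i)) (@fmod_subspace k _ da BY d)
  (fmod_qdim rl_hom r_gt0 hilbert_fn da BY d)) => [i|c].
  exact: phimap_fmod H (hb i).
rewrite -(linear_comb phimap_linear) => /inj Ic; apply: ib; apply: Ic.
apply: (@fmod_finite BX d); apply: (subspace_sum _ sB) => i; exact: (subspaceZ _ sB (hb i)).
Qed.

(** Elements independent modulo the image stay independent when joined by the images of a basis of
    the source. *)
Lemma coker_upper d N : coker_ge d N ->
  (N + \sum_be chilb s (d - db be) <= \sum_al chilb s (d - da al))%N.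
Proof.
move=> [xs hx ix]; have sB := @fmod_subspace k _ db predT d.
have [b ib hb] := qdim_indep (fmod_qdim rl_hom r_gt0 hilbert_fn db predT d) sB.
pose g i := match split i with inl i => xs i | inr j => phimap (b j) end.
apply: (indep_le (g := g) (@fmod_subspace k _ da predT d)
  (fmod_qdim rl_hom r_gt0 hilbert_fn da predT d)) => [i|c].
  rewrite /g; case: (split i) => j; first exact: hx.
  by apply: phimap_fmod (hb j).
rewrite big_split_ord /=.
have -> : \sum_(i < N) c (lshift _ i) *: g (lshift _ i) = \sum_(i < N) c (lshift _ i) *: xs i.
  by apply: eq_bigr => i _; rewrite /g (unsplitK (inl i)).
have -> : \sum_i c (rshift N i) *: g (rshift N i) = phimap (\sum_i c (rshift N i) *: b i).
  rewrite (linear_comb phimap_linear); apply: eq_bigr => i _; by rewrite /g (unsplitK (inr i)).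
set v := \sum_i _ *: b i => I.
have fv : finite_vec v.
  apply: (@fmod_finite predT d); apply: (subspace_sum _ sB) => i; exact: (subspaceZ _ sB (hb i)).
have c0 i : c (lshift _ i) = 0.
  apply: (ix (fun i => c (lshift _ i))).
  exists (- v); first exact: subspaceN finite_vec_subspace fv.
  suff -> : phimap (- v) = - phimap v by rewrite opprK.
  by rewrite -[- v]sub0r (linearB_fun _ _ phimap_linear) (linear0_fun phimap_linear) sub0r.
have c1 : forall i, c (rshift N i) = 0.
  apply: (ib (fun i => c (rshift N i))); apply: inj fv _.
  by move: I; rewrite big1 ?add0r // => i _; rewrite c0 scale0r.
by move=> i; rewrite -(splitK i); case: (split i) => j; [exact: c0 | exact: c1].
Qed.

End Cokernel.

(** * Betti numbers *)

Section Sequences.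
Variables (N : nat) (c : int -> int).

Lemma size_Sseq : (forall i, 0 <= c i) -> (size (Sseq N c))%:Z = wsum N c.
Proof.
move=> c0; rewrite /Sseq size_flatten /shape -map_comp sumnE big_map.
rewrite (_ : \sum_(j <- iota 0 _) _ = \sum_(j < (2 * N).+1) nonneg_part (c (j%:Z - N%:Z)))%N.
  rewrite (big_morph Posz PoszD (erefl (Posz 0))); apply: eq_bigr => j _.
  by case: (c _) (c0 (j%:Z - N%:Z)).
rewrite -(big_mkord xpredT (fun j => nonneg_part (c (j%:Z - N%:Z)))) /index_iota subn0.
by apply: eq_bigr => j _; rewrite /= size_nseq.
Qed.

Lemma Sseq_bound t : t \in Sseq N c -> `|t| <= N%:Z.
Proof.
move/flattenP => [s /mapP[j]]; rewrite mem_iota => jN -> /nseqP[-> _]; lia.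
Qed.

Lemma Sseq_sorted : sorted <=%R (Sseq N c).
Proof.
rewrite (sorted_pairwise le_trans) /Sseq; elim: (2 * N).+1 {1}0%N => [//|n IH] m /=.
rewrite pairwise_cat IH andbT; apply/andP; split.
  apply/allrelP => t u /nseqP[-> _] /flattenP[s /mapP[j]]; rewrite mem_iota => mj -> /nseqP[-> _].
  lia.
by elim: (nonneg_part _) => //= p ->; rewrite andbT all_nseq lexx orbT.
Qed.

End Sequences.

Section Numeric.
Variable s : nat.
Hypothesis s12 : s = 1%N \/ s = 2%N.
Notation chilb := (chilb s).

(** One generator more in the target than in the source makes the cokernel grow cubically, while
    dimension two with [q = 2] bounds the square of its dimension by [d ^ 5]. *)
Lemma chilb_cubic_gap (N n D : nat) : exists2 t : nat, (D <= t)%N & forall r : nat,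
  (n.+1 * chilb t <= r + n * chilb (t + 2 * N)%N)%N -> ((t + N) ^ 5 < r ^ 2)%N.
Proof.
(* This keeps the large constant opaque. *)
have [K KE] : exists K, K = (576 * 2 ^ 5)%N by exists (576 * 2 ^ 5)%N.
(* The summands ensure, in turn: [576 * (2 * T) ^ 5 < T ^ 6]; the shift costs at most half of
   [T ^ 3]; [T + 2 * N <= 2 * T]; [D <= T.-1]. *)
pose T := (K.+1 + 192 * n * N + 2 * N + D)%N.
have T0 : (0 < T)%N by rewrite /T; lia.
exists T.-1 => [|r hr]; first by rewrite /T; lia.
have h1 := chilb_ge s12 T.-1; have h2 := chilb_diff s12 T.-1 (2 * N).
rewrite -addSn (prednK T0) in h1 h2.
have h3 : ((T + 2 * N) ^ 2 <= 4 * T ^ 2)%N.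
  by rewrite -[4%N]/(2 ^ 2)%N -expnMn leq_sqr /T; lia.
have h4 : (n * chilb (T.-1 + 2 * N)%N <= n * chilb T.-1 + 8 * n * N * T ^ 2)%N.
  apply: leq_trans (_ : n * (chilb T.-1 + 2 * N * (T + 2 * N) ^ 2) <= _)%N.
    by rewrite leq_mul2l h2 orbT.
  rewrite mulnDr leq_add2l.
  apply: leq_trans (_ : n * (2 * N * (4 * T ^ 2)) <= _)%N; last by lia.
  by rewrite !leq_mul2l h3 !orbT.
have h5 : (192 * n * N * T ^ 2 <= T ^ 3)%N.
  by rewrite [(T ^ 3)%N]expnS leq_mul2r /T; apply/orP; right; lia.
have h6 : (T ^ 3 <= 24 * r)%N by move: hr; rewrite mulSn; lia.
have h7 : (T ^ 6 <= 576 * r ^ 2)%N.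
  by rewrite (expnM T 3 2) -[576%N]/(24 ^ 2)%N -expnMn leq_sqr.
rewrite -(ltn_pmul2l (isT : (0 < 576)%N)); apply: leq_trans h7.
apply: leq_ltn_trans (_ : 576 * (2 * T) ^ 5 < _)%N.
  by rewrite leq_mul2l /= leq_exp2r // /T; lia.
by rewrite expnMn mulnA -KE [(T ^ 6)%N]expnS ltn_pmul2r ?expn_gt0 ?T0 // /T; lia.
Qed.

End Numeric.

Section Resolutions.
Variables (k s : nat) (rl : seq (fa k)).
Hypothesis ell : elliptic s rl.
Hypothesis ks : (k, s) = (3, 1)%N \/ (k, s) = (2, 2)%N.
Let rh := rel_hom ell.
Let hf := hilbert ell ks.
Notation chilb := (chilb s).

Let s12 : s = 1%N \/ s = 2%N.
Proof. by case: ks => -[_ ->]; [left | right]. Qed.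

Variable N : nat.
Variables da db : seq int.
Hypothesis da_bound : forall t, t \in da -> `|t| <= N%:Z.
Hypothesis db_bound : forall t, t \in db -> `|t| <= N%:Z.
Notation m := (size da).
Notation n := (size db).
Notation dA := (fun al : 'I_m => nth 0 da al).
Notation dB := (fun be : 'I_n => nth 0 db be).

Lemma dA_bound al : `|dA al| <= N%:Z. Proof. by apply/da_bound/mem_nth. Qed.
Lemma dB_bound be : `|dB be| <= N%:Z. Proof. by apply/db_bound/mem_nth. Qed.

Section Map.
Variable phi : 'I_m -> 'I_n -> fser k.
Hypothesis hphi : forall al be, hom (dB be - dA al) (phi al be).

Lemma phimapE (v : 'I_n -> fser k) al : (phi_app phi v al : fser k) = phimap phi (finfun v) al.
Proof.
apply/funext => w; rewrite ffunE fser_sum /phi_app; apply: eq_bigr => be _.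
by rewrite ffunE.
Qed.

Lemma injectiveP : phi_injective rl phi <-> injective_mod rl phi.
Proof.
split=> [H v fv Iv be|H v fv Iv be].
  by apply: (H v) => // al; rewrite (phimapE v) ffunK; apply: Iv.
have := H (finfun v); rewrite /fideal => /(_ _ _ be); rewrite ffunE; apply.
  by move=> b'; rewrite ffunE; apply: fv.
by move=> al; rewrite /idl -phimapE; apply: Iv.
Qed.

Lemma phimapBE (x : {ffun 'I_m -> fser k}) v al :
  (fun w => x al w - phi_app phi v al w) = (x - phimap phi (finfun v)) al.
Proof. by apply/funext => w; rewrite (phimapE v) !ffunE fserB. Qed.

Lemma in_imageP (x : {ffun 'I_m -> fser k}) : in_image rl phi x <-> image rl phi x.
Proof.
split=> [[v fv H]|[v fv H]].
  exists (finfun v); first by move=> be; rewrite ffunE; apply: fv.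
  by move=> al; rewrite /idl -phimapBE; apply: H.
by exists v => // al; rewrite phimapBE ffunK; apply: H.
Qed.

Lemma coker_dimP (d r : nat) : coker_dim_ge rl phi d r <-> coker_ge rl dA phi d%:Z r.
Proof.
split=> [[xs [hx ix]]|[xs hx ix]].
  exists (fun i => finfun (xs i)) => [i al|c Ic].
    by rewrite /= ffunE; apply/ledegP => w /(hx i al w); rewrite lerBrDr.
  apply: ix; have := (in_imageP _).2 Ic; congr in_image; apply/funext => al; apply/funext => w.
  rewrite sum_ffunE fser_sum; apply: eq_bigr => i _; by rewrite !ffunE fserZ.
exists (fun i => xs i); split=> [i al w|c Ic].
  by have := hx i al => /= /ledegP H /H; rewrite lerBrDr.
apply: ix; apply/in_imageP; move: Ic; congr in_image; apply/funext => al; apply/funext => w.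
by rewrite sum_ffunE fser_sum; apply: eq_bigr => i _; rewrite !ffunE fserZ.
Qed.

Lemma sum_chilb_ge (I : finType) (B : pred I) (dg : I -> int) (t : nat) :
  (forall i, `|dg i| <= N%:Z) -> (#|B| * chilb t <= \sum_(i | B i) chilb ((t + N)%N%:Z - dg i)%R)%N.
Proof.
move=> hB; rewrite -sum_nat_const; apply: leq_sum => i _; apply: chilb_mono.
by have := hB i; lia.
Qed.

Lemma sum_chilb_le (I : finType) (B : pred I) (dg : I -> int) (t : nat) :
  (forall i, `|dg i| <= N%:Z) -> (\sum_(i | B i) chilb ((t + N)%N%:Z - dg i)%R <= #|B| * chilb (t + 2 * N)%N)%N.
Proof.
move=> hB; rewrite -sum_nat_const; apply: leq_sum => i _; apply: chilb_mono.
by have := hB i; lia.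
Qed.

(** Only growth is compared: with more generators in the source, [chilb_gap] contradicts [inj_mask]
    in a large degree, whatever the bounded shifts. *)
Lemma inj_card (BX : pred 'I_n) (BY : pred 'I_m) : injective_mod rl phi ->
  (forall al be, BX be -> ~~ BY al -> phi al be = 0) -> (#|BX| <= #|BY|)%N.
Proof.
move=> inj H; rewrite leqNgt; apply/negP => lt.
have [t] := chilb_gap s12 N #|BY|; rewrite ltnNge => /negP; apply.
apply: leq_trans (leq_mul lt (leqnn _)) _.
apply: leq_trans (sum_chilb_ge BX t dB_bound) _.
apply: leq_trans (sum_chilb_le BY t dA_bound).
exact: (inj_mask rh isT hf hphi inj (t + N)%N%:Z H).
Qed.

Lemma card_ltn_ord p q : (q <= p)%N -> #|[pred i : 'I_p | (i < q)%N]| = q.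
Proof.
move=> qp; rewrite -sum1_card -(big_ord_widen p (fun=> 1%N) qp) sum_nat_const card_ord.
by rewrite muln1.
Qed.

Lemma rank_eq : injective_mod rl phi -> GKdim_eq (coker_dim_ge rl phi) 2 -> m = n.
Proof.
move=> inj [gk _]; apply/eqP; rewrite eqn_leq; apply/andP; split; last first.
  by have := @inj_card predT predT inj (fun _ _ _ => _); rewrite !card_ord; apply=> // -[].
rewrite leqNgt; apply/negP => nm.
have [D HD] := gk 2%N isT.
have [t Dt Ht] := chilb_cubic_gap s12 N n D.
have [r cr hr] := coker_lower rh isT hf hphi (t + N)%N%:Z.
have := HD (t + N)%N r (leq_trans Dt (leq_addr _ _)); rewrite leqNgt => /(_ _)/negP; apply.
  exact/coker_dimP.
apply: Ht; apply: leq_trans (_ : r + \sum_be chilb ((t + N)%N%:Z - dB be)%R <= _)%N.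
  apply: leq_trans hr; apply: leq_trans (sum_chilb_ge predT t dA_bound).
  by rewrite leq_mul2r card_ord nm orbT.
by rewrite leq_add2l; have := sum_chilb_le predT t dB_bound; rewrite card_ord.
Qed.

Hypothesis da_sorted : sorted <=%R da.
Hypothesis db_sorted : sorted <=%R db.
Hypothesis phi_pos : forall al be, phi al be != 0 -> 0 < dB be - dA al.

Lemma degree_lt (al : 'I_m) (be : 'I_n) : injective_mod rl phi -> (al <= be)%N -> dA al < dB be.
Proof.
move=> inj ab; rewrite ltNge; apply/negP => ge.
(* Indices start at zero: the first [be + 1] generators of the source would map into the first [al]
   of the target, so [be + 1 <= al <= be]. *)
have := @inj_card [pred i : 'I_n | (i < be.+1)%N] [pred i : 'I_m | (i < al)%N] inj.
rewrite !card_ltn_ord ?(ltnW (ltn_ord al)) ?ltn_ord // => H.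
suff : (be < be)%N by rewrite ltnn.
apply: leq_trans (H _) ab => al' be' /=; rewrite ltnS -leqNgt => hbe hal.
apply/eqP; apply: contraT => /phi_pos; rewrite subr_gt0 ltNge => /negP[].
apply: le_trans (_ : dB be <= _).
  by apply: (sorted_leq_nth le_trans lexx) => //; rewrite inE ltn_ord.
apply: le_trans ge _.
by apply: (sorted_leq_nth le_trans lexx) => //; rewrite inE ltn_ord.
Qed.

End Map.

End Resolutions.

(** * Quadratic growth of the cokernel *)

Section CokernelGrowth.
Variables (k s : nat) (rl : seq (fa k)).
Hypothesis ell : elliptic s rl.
Hypothesis ks : (k, s) = (3, 1)%N \/ (k, s) = (2, 2)%N.
Let rh := rel_hom ell.
Let hf := hilbert ell ks.
Notation chilb := (chilb s).

Let s12 : s = 1%N \/ s = 2%N.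
Proof. by case: ks => -[_ ->]; [left | right]. Qed.

Variable N : nat.
Variables da db : seq int.
Hypothesis da_bound : forall t, t \in da -> `|t| <= N%:Z.
Hypothesis db_bound : forall t, t \in db -> `|t| <= N%:Z.
Hypothesis size_eq : size da = size db.
Hypothesis size_gt0 : (0 < size db)%N.
Hypothesis d_lt : forall i, (i < size db)%N -> nth 0 da i < nth 0 db i.
Notation m := (size da).
Notation n := (size db).
Notation dA := (fun al : 'I_m => nth 0 da al).
Notation dB := (fun be : 'I_n => nth 0 db be).

Variable phi : 'I_m -> 'I_n -> fser k.
Hypothesis hphi : forall al be, hom (dB be - dA al) (phi al be).
Hypothesis inj : injective_mod rl phi.

(** Equal numbers of generators cancel the cubic terms; the shifts, at most [2 * N], leave
    [m * (2 * N) * (2 * d) ^ 2]. *)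
Lemma coker_quadratic_above (d r : nat) : (N < d)%N -> coker_dim_ge rl phi d r ->
  (r <= 8 * m * N * d ^ 2)%N.
Proof.
move=> Nd /coker_dimP /(coker_upper rh isT hf hphi inj) H.
have [t dE] : exists t, d = (t + N)%N by exists (d - N)%N; lia.
have := sum_chilb_ge ks predT t (dB_bound db_bound).
have := sum_chilb_le ks predT t (dA_bound da_bound).
rewrite -dE !card_ord => h1 h2.
have h3 := chilb_diff s12 t (2 * N).
have h4 : ((t + 2 * N).+1 ^ 2 <= 4 * d ^ 2)%N.
  by rewrite -[4%N]/(2 ^ 2)%N -expnMn leq_sqr; lia.
have h5 : (r + m * chilb t <= m * chilb (t + 2 * N)%N)%N.
  by apply: leq_trans h1; apply: leq_trans H; rewrite leq_add2l size_eq.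
have h6 : (m * chilb (t + 2 * N)%N <= m * (chilb t + 2 * N * (4 * d ^ 2)))%N.
  by rewrite leq_mul2l (leq_trans h3) ?orbT // leq_add2l leq_mul2l h4 orbT.
have := leq_trans h5 h6; rewrite mulnDr addnC leq_add2l => /leq_trans; apply.
by rewrite leq_eqVlt; apply/orP; left; apply/eqP; lia.
Qed.

(** Every pair of degrees contributes a nonnegative difference, and the first pair alone at least
    [hilb (e + 1)], which is at least [(e + 2)^2 / 4], while [d <= 2 (e + 2)]. *)
Lemma coker_quadratic_below (d : nat) : (2 * N <= d)%N ->
  exists2 r, coker_dim_ge rl phi d r & (d ^ 2 <= 16 * r)%N.
Proof.
move=> Nd; have [t dE] : exists t, d = (t + N)%N by exists (d - N)%N; lia.
have [r cr hr] := coker_lower rh isT hf hphi d%:Z.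
exists r; first exact/coker_dimP.
move: hr; rewrite -(big_mkord xpredT (fun i => chilb (d%:Z - nth 0 da i))).
rewrite -(big_mkord xpredT (fun i => chilb (d%:Z - nth 0 db i))) size_eq.
rewrite [X in (X <= _)%N]big_ltn // [X in (_ <= _ + X)%N]big_ltn //.
have : (\sum_(1 <= i < n) chilb (d%:Z - nth 0%R db i)%R <=
        \sum_(1 <= i < n) chilb (d%:Z - nth 0%R da i)%R)%N.
  rewrite big_nat_cond [X in (_ <= X)%N]big_nat_cond; apply: leq_sum => i /andP[/andP[_ i_n] _].
  by apply: chilb_mono; rewrite lerD2l lerN2 ltW // d_lt.
set X := (\sum_(1 <= i < n) _)%N; set Y := (\sum_(1 <= i < n) _)%N => XY.
have b0 : `|nth 0 db 0%N| <= N%:Z by apply/db_bound/mem_nth.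
have [e eE] : exists e : nat, d%:Z - nth 0 db 0%N = e.
  by exists `|(d%:Z - nth 0 db 0%N)%R|%N; lia.
have te : (t <= e)%N by lia.
have : (chilb e.+1%N <= chilb (d%:Z - nth 0 da 0%N)%R)%N.
  by apply: chilb_mono; have := d_lt size_gt0; lia.
rewrite eE chilbS.
have := hilb_ge s12 e.+1; have : ((d ^ 2) <= 4 * e.+2 ^ 2)%N.
  by rewrite -[4%N]/(2 ^ 2)%N -expnMn leq_sqr; lia.
move: XY; move: X Y (chilb e) (chilb _) (hilb _ _) (d ^ 2)%N (e.+2 ^ 2)%N => *; lia.
Qed.

Lemma coker_GKdim : GKdim_eq (coker_dim_ge rl phi) 2.
Proof.
split=> [q q0|q q0 D].
  (* For such [d], one extra factor [d] absorbs [(8 * m * N) ^ q]. *)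
  exists ((8 * m * N) ^ q + N).+1%N => d r hd cr.
  have := @coker_quadratic_above d r _ cr; rewrite (_ : (N < d)%N); last by lia.
  move=> /(_ isT); rewrite -(leq_exp2r _ _ q0) => /leq_trans; apply.
  by rewrite expnMn -expnM expnD expn1 mulnC leq_mul2l; apply/orP; right; lia.
(* [16 ^ q <= d] pays for the constant [16] with one factor [d]. *)
pose d := (D + 2 * N + 16 ^ q)%N.
have Nd : (2 * N <= d)%N by rewrite /d; lia.
have [r cr hr] := coker_quadratic_below Nd.
exists d, r; split => //; first by rewrite /d; lia.
rewrite -(leq_pmul2l (_ : 0 < 16 ^ q)%N) ?expn_gt0 // -expnMn.
apply: leq_trans (_ : d * d ^ (2 * q - 1) <= _)%N; first by rewrite leq_mul2r /d; lia.
rewrite -expnS (_ : (2 * q - 1).+1 = 2 * q)%N; last by lia.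
by rewrite expnM leq_exp2r.
Qed.

End CokernelGrowth.

(** * Diagonal matrices of powers of a linear form *)

Section Diagonal.
Variables (k : nat) (l : fser k) (da db : seq int).
Hypothesis hl : hom 1 l.
Hypothesis d_lt : forall i, (i < size db)%N -> nth 0 da i < nth 0 db i.
Notation m := (size da).
Notation n := (size db).
Notation dA := (fun al : 'I_m => nth 0 da al).
Notation dB := (fun be : 'I_n => nth 0 db be).

Definition gap (i : nat) : nat := `|(nth 0%R db i - nth 0%R da i)%R|%N.

Definition diag (al : 'I_m) (be : 'I_n) : fser k :=
  if al == be :> nat then l ^+ gap al else 0.

Lemma diag_hom al be : hom (dB be - dA al) (diag al be).
Proof.
rewrite /diag; case: eqP => [E|_]; last exact: hom0.
by apply: homE (hom_exp hl _) _; have := d_lt (ltn_ord be); rewrite /gap -E; lia.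
Qed.

Lemma diag_minimal : phi_graded_minimal diag.
Proof.
move=> al be; split=> [|w]; first exact: hom_fin (diag_hom al be).
move=> nz; have sw := hom_size (diag_hom al be) nz; split=> //.
move: nz; rewrite /diag; case: eqP => // E _.
by have := d_lt (ltn_ord be); rewrite -E; move: sw; rewrite /= -E; lia.
Qed.

Hypothesis size_eq : size da = size db.

Lemma phimap_diag v al :
  phimap diag v al = l ^+ gap al * v (cast_ord size_eq al).
Proof.
rewrite ffunE (bigD1 (cast_ord size_eq al)) //= /diag eqxx big1 ?addr0 // => be ne.
by rewrite ifF ?mul0r //; apply: contraNF ne => /eqP E; apply/eqP/val_inj; rewrite /= E.
Qed.

Variables (s : nat) (rl : seq (fa k)).
Hypothesis ell : elliptic s rl.
Hypothesis ks : (k, s) = (3, 1)%N \/ (k, s) = (2, 2)%N.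
Hypothesis l0 : l != 0.
Notation Id := (idl rl).

Lemma diag_injective : injective_mod rl diag.
Proof.
move=> v fv Iv be; have := Iv (cast_ord (esym size_eq) be).
by rewrite phimap_diag cast_ordKV; apply: (pow_regular ell ks hl l0).
Qed.

(** The cokernel is the direct sum of the quotients of [A] by powers of [l], so [pow_torsion]
    applies in each coordinate. *)
Lemma diag_torsion_free (G : nat) (g : fser k) : hom G%:Z g ->
  (forall d v, hom d v -> lineI rl l (d + G%:Z) (v * g) -> lineI rl l d v) ->
  torsion_free rl diag g.
Proof.
move=> hg tf x fx [v fv Iv].
have H (be : 'I_n) : exists b : fser k, fa_fin b /\
    Id ((x (cast_ord (esym size_eq) be) : fser k) - l ^+ gap be * b).
  have := Iv (cast_ord (esym size_eq) be).
  rewrite [X in in_ideal _ X](_ : _ = (x (cast_ord (esym size_eq) be) : fser k) * g -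
    l ^+ gap be * v be); last first.
    by apply/funext => w; rewrite (phimapE _ v) phimap_diag ffunE cast_ordKV.
  by move=> /(pow_torsion ell ks hg hl l0 tf (fx _) (fv _)) [b]; exists b.
move: H => /choice[b Hb].
exists b => [be|al]; first by case: (Hb be).
have [_] := Hb (cast_ord size_eq al); rewrite cast_ordK.
rewrite [X in in_ideal _ X](_ : _ = (x al : fser k) - l ^+ gap al * b (cast_ord size_eq al)) //.
by apply/funext => w; rewrite (phimapE _ b) phimap_diag ffunE.
Qed.

End Diagonal.

(** * Characterization of the Betti numbers *)

Section Betti.
Variables (k s : nat) (rl : seq (fa k)).
Hypothesis ell : elliptic s rl.
Hypothesis ks : (k, s) = (3, 1)%N \/ (k, s) = (2, 2)%N.
Variables (N : nat) (a b : int -> int).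

Lemma betti_necessary (phi : 'I_(size (Sseq N a)) -> 'I_(size (Sseq N b)) -> fa k) :
  condA a b -> phi_graded_minimal phi -> phi_injective rl phi ->
  GKdim_eq (coker_dim_ge rl phi) 2 -> condB N a b /\ condC N a b.
Proof.
move=> cA mini /injectiveP inj gk.
have hphi (al : 'I_(size (Sseq N a))) (be : 'I_(size (Sseq N b))) :
  hom (nth 0 (Sseq N b) be - nth 0 (Sseq N a) al) (phi al be).
  by apply: Hom => w /(mini al be).2 [].
have sab := rank_eq ell ks (@Sseq_bound N a) (@Sseq_bound N b) hphi inj gk.
have wa : (size (Sseq N a))%:Z = wsum N a by apply: size_Sseq => i; case: (cA i).
have wb : (size (Sseq N b))%:Z = wsum N b by apply: size_Sseq => i; case: (cA i).
split=> [|al be]; first by rewrite /condB -wa -wb sab.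
rewrite -wa -wb !lez_nat => al0 alm be0 ben ab.
have al' : (al.-1 < size (Sseq N a))%N by rewrite prednK.
have be' : (be.-1 < size (Sseq N b))%N by rewrite prednK.
apply: (degree_lt ell ks (@Sseq_bound N a) (@Sseq_bound N b) hphi (Sseq_sorted N a)
  (Sseq_sorted N b) _ (al := Ordinal al') (be := Ordinal be') inj) => [i j|]; last first.
  by rewrite /= -ltnS !prednK.
apply: contraNT => np; apply/eqP/funext => w; apply/eqP; apply: contraNT np => /eqP /(mini i j).2.
by move=> [<-]; rewrite ltz_nat.
Qed.

Variable l : fser k.
Hypotheses (hl : hom 1 l) (l0 : l != 0).

Lemma betti_sufficient :
  condA a b -> condB N a b -> condC N a b -> (0 < size (Sseq N b))%N ->
  exists phi : 'I_(size (Sseq N a)) -> 'I_(size (Sseq N b)) -> fa k,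
  [/\ phi_graded_minimal phi, phi_injective rl phi, GKdim_eq (coker_dim_ge rl phi) 2 &
      forall (G : nat) (g : fser k), hom G%:Z g ->
        (forall d v, hom d v -> lineI rl l (d + G%:Z) (v * g) -> lineI rl l d v) ->
        torsion_free rl phi g].
Proof.
move=> cA cB cC n0.
have wa : (size (Sseq N a))%:Z = wsum N a by apply: size_Sseq => i; case: (cA i).
have wb : (size (Sseq N b))%:Z = wsum N b by apply: size_Sseq => i; case: (cA i).
have sab : size (Sseq N a) = size (Sseq N b) by apply/eqP; rewrite -eqz_nat wa wb; apply/eqP.
have lt i : (i < size (Sseq N b))%N -> nth 0 (Sseq N a) i < nth 0 (Sseq N b) i.
  by move=> i_n; apply: (cC i.+1 i.+1) => //; rewrite -?wa -?wb lez_nat ?sab.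
have inj : injective_mod rl (@diag k l (Sseq N a) (Sseq N b)).
  by move=> v; exact: (diag_injective hl sab ell ks l0).
exists (@diag k l (Sseq N a) (Sseq N b)); split.
- exact: (diag_minimal hl lt).
- exact/injectiveP.
- exact: (coker_GKdim ell ks (@Sseq_bound N a) (@Sseq_bound N b) sab n0 lt (diag_hom hl lt) inj).
- move=> G g hg tf; exact: (diag_torsion_free hl sab ell ks l0 hg tf).
Qed.

End Betti.

Lemma Sseq_size_gt0 N (a b : int -> int) : supp_in N a -> supp_in N b -> condA a b ->
  condB N a b -> ~ (forall i, a i = 0 /\ b i = 0) -> (0 < size (Sseq N b))%N.
Proof.
move=> sa sb cA cB; rewrite lt0n; apply: contra_notN => /eqP n0.
have vanish c : supp_in N c -> (forall i, 0 <= c i) -> wsum N c = 0 -> forall i, c i = 0.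
  move=> sc c0 /eqP; rewrite psumr_eq0 // => /allP H i.
  have [/sc //|iN] := ltP N%:Z `|i|.
  have jN : (`|(i + N%:Z)%R|%N < (2 * N).+1)%N by lia.
  have /eqP := H (Ordinal jN) (mem_index_enum _).
  by rewrite /= (_ : _ - _ = i) //; lia.
have wb : wsum N b = 0 by rewrite -size_Sseq ?n0 // => i; case: (cA i).
move=> i; split; apply: vanish => //; try by move=> j; case: (cA j).
by rewrite cB.
Qed.

(** The lines are chosen for their chains: [x = 0] contains three inflection points of the cubic
    curve, and [y = 0] is the point [(1 : 0)], which has two continuations. *)
Lemma line_torsion_free_exists (A : ASalg) : generic A -> exists s (l : fser (ngen A)),
  [/\ elliptic s (rels A), (ngen A, s) = (3, 1)%N \/ (ngen A, s) = (2, 2)%N,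
      hom 1 l, l != 0 & forall g, @central_elt A g -> hom (gdeg A)%:Z (g : fser _) /\
        forall d v, hom d v -> lineI (rels A) l (d + (gdeg A)%:Z) (v * (g : fser _)) ->
          lineI (rels A) l d v].
Proof.
case: A => [a b c|a b c] gen.
  exists 1%N, (x X3); split; [exact: quad_elliptic | by left | exact: (hom_wd [:: X3]) |
    exact: x_neq0 | ].
  by move=> g cg; split; [exact: (quad_g_hom cg) | exact: (quad_line_torsion_free gen cg)].
have [B Bb] := sqrt_exists b; have [G Gc] := sqrt_exists c.
exists 2%N, (x Y2); split; [exact: cubic_elliptic | by right | exact: (hom_wd [:: Y2]) |
  exact: x_neq0 | ].
by move=> g cg; split; [exact: (cubic_g_hom cg) |
  exact: (cubic_line_torsion_free_sqrt gen cg Bb Gc)].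
Qed.

Theorem theoremA :
  forall A : ASalg, generic A -> sigma_infinite_order A ->
  forall (N : nat) (a b : int -> int), supp_in N a -> supp_in N b ->
    ~ (forall i, a i = 0 /\ b i = 0) ->
    ((exists phi, @betti_GK2_pd1 A N a b phi) <-> [/\ condA a b, condB N a b & condC N a b])
    /\
    ([/\ condA a b, condB N a b & condC N a b] ->
       exists phi, @betti_GK2_pd1 A N a b phi /\
         forall g, @central_elt A g -> torsion_free (rels A) phi g).
Proof.
move=> A gen _ N a b sa sb nz.
have [s [l [ell ks hl l0 tf]]] := line_torsion_free_exists gen.
have exist : [/\ condA a b, condB N a b & condC N a b] -> exists phi, @betti_GK2_pd1 A N a b phi /\
    forall g, @central_elt A g -> torsion_free (rels A) phi g.
  move=> [cA cB cC]; have n0 := Sseq_size_gt0 sa sb cA cB nz.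
  have [phi [mini inj gk tor]] := betti_sufficient ell ks hl l0 cA cB cC n0.
  by exists phi; split=> // g /tf[hg tg]; exact: tor hg tg.
split=> //; split=> [[phi [cA _ mini inj gk]]|/exist[phi [H _]]]; last by exists phi.
by have [] := betti_necessary ell ks cA mini inj gk.
Qed.
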